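(* Let $G_{np8'}$ be a $\mathfrak{T}_2$-group whose associated Lie ring $L(G_{np8'})$ has the presentation $$L(G_{np8'})=\left\langle x_1,x_2,x_3,x_4,x_5,x_6,y_1,y_2 \;\middle|\; [x_i,x_j]=M(\boldsymbol{y})_{ij}\right\rangle,$$ additively free abelian of rank $8$ with basis $x_1,\dots,x_6,y_1,y_2$ and with all unlisted brackets of generators equal to zero, where $$M(\boldsymbol{y})=\begin{pmatrix}0&0&0&y_1&y_2&0\\0&0&0&0&y_1&y_2\\0&0&0&2y_2&0&y_1\\-y_1&0&-2y_2&0&0&0\\-y_2&-y_1&0&0&0&0\\0&-y_2&-y_1&0&0&0\end{pmatrix}.$$ Then the normal subgroup zeta function $\zeta_{G_{np8'}}^{\triangleleft}(s)$ is not RFORC.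
   Context: A $\mathfrak{T}_2$-group is a finitely generated torsion-free nilpotent group of nilpotency class $2$. For such a group $G$ with derived group $G'=[G,G]$ and $G/G'$, $G'$ torsion-free abelian, the associated Lie ring is $L(G)=G/G'\oplus G'$ (written additively), with Lie bracket induced by the group commutator $G/G'\times G/G'\to G'$ and with $G'$ central. Normal zeta functions: for a finitely generated torsion-free nilpotent group $G$ let $a_m^{\triangleleft}(G)$ be the number of normal subgroups of index $m$ in $G$, let $\zeta_G^{\triangleleft}(s)=\sum_{m\ge1}a_m^{\triangleleft}(G)m^{-s}$, and for a prime $p$ let $\zeta_{G,p}^{\triangleleft}(s)=\sum_{i\ge0}a_{p^i}^{\triangleleft}(G)p^{-is}$; then $\zeta_G^{\triangleleft}(s)=\prod_p\zeta_{G,p}^{\triangleleft}(s)$. RFORC (rational functions on residue classes): $\zeta_G^{\triangleleft}(s)$ is said to be RFORC if there exist a fixed integer $N\ge1$ and finitely many rational functions $W_1(X,Y),\dots,W_N(X,Y)\in\mathbb{Q}(X,Y)$ such that for every prime $p$ and every $i\in\{1,\dots,N\}$, if $p\equiv i\bmod N$ then $\zeta_{G,p}^{\triangleleft}(s)=W_i(p,p^{-s})$. *)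

(* Defs.v *)
From HB Require Import structures.
From mathcomp Require Import all_boot all_order all_algebra.
From mathcomp Require Import finmap generic_quotient.
From mathcomp Require Import all_classical all_reals all_analysis.
From mathcomp Require Import complex.

Set Implicit Arguments.
Unset Strict Implicit.
Unset Printing Implicit Defensive.

Import Order.TTheory GRing.Theory Num.Theory.
Import numFieldNormedType.Exports.

Local Open Scope classical_set_scope.
Local Open Scope card_scope.
Local Open Scope ring_scope.

Section InfiniteGroups.
Variable G : groupType.
Local Open Scope group_scope.
Implicit Types (A B H : set G) (x y : G).

Definition subgroup H : Prop :=
  [/\ H 1, forall x y, H x -> H y -> H (x * y) & forall x, H x -> H x^-1].

Definition normal_subgroup H : Prop :=
  subgroup H /\ forall x y, H x -> H (x ^ y).

Definition left_cosets H : set (set G) :=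
  [set [set x * h | h in H] | x in [set: G]].

Definition has_index H (m : nat) : Prop := left_cosets H #= `I_m.

Definition generated A : set G := smallest subgroup A.

Definition commutator_subgroup A B : set G :=
  generated [set [~ x, y] | x in A & y in B].

Definition derived : set G := commutator_subgroup [set: G] [set: G].

(* Indexed from 0: lower_central c is the term usually written gamma_(c+1). *)
Fixpoint lower_central (c : nat) : set G :=
  if c is c'.+1 then commutator_subgroup (lower_central c') [set: G]
  else [set: G].

Definition nilpotency_class (c : nat) : Prop :=
  lower_central c = [set 1] /\
  forall k, (k < c)%N -> lower_central k <> [set 1].

Definition finitely_generated : Prop :=
  exists2 A, finite_set A & generated A = [set: G].

Definition torsion_free : Prop :=
  forall x (n : nat), (0 < n)%N -> x ^+ n = 1 -> x = 1.

Definition T2_group : Prop :=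
  [/\ finitely_generated, torsion_free & nilpotency_class 2].

(* The set is finite when G is finitely generated; fset_set sends infinite
   sets to fset0. *)
Definition nb_normal_subgroups (m : nat) : nat :=
  #|` fset_set [set H | normal_subgroup H /\ has_index H m] |%fset.

End InfiniteGroups.

Section GroupFacts.
Variable G : groupType.
Local Open Scope group_scope.
Implicit Types (A B H : set G) (x y z : G).

Lemma generated_subgroup A : subgroup (generated A).
Proof.
split=> [H [[]]//|x y Ax Ay H /[dup] HH [[_ HM _] _]
  |x Ax H /[dup] HH [[_ _ HV] _]].
- by apply: HM; [apply: Ax|apply: Ay].
- by apply: HV; apply: Ax.
Qed.

Lemma sub_generated A : A `<=` generated A.
Proof. by move=> x Ax H [_]; apply. Qed.

Lemma derived_subgroup : subgroup (@derived G).
Proof. exact: generated_subgroup. Qed.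

Lemma derived1 : derived (1 : G).
Proof. by case: derived_subgroup. Qed.

Lemma derivedM x y : derived x -> derived y -> derived (x * y).
Proof. by case: derived_subgroup => _ h _; apply: h. Qed.

Lemma derivedV x : derived x -> derived x^-1.
Proof. by case: derived_subgroup => _ _; apply. Qed.

Lemma derivedR x y : derived [~ x, y].
Proof. by apply: sub_generated; exists x => //; exists y. Qed.

Lemma derivedJ x y : derived x -> derived (x ^ y).
Proof.
move=> dx; have -> : x ^ y = x * [~ x, y] by rewrite commgEl mulVKg.
by apply: derivedM => //; apply: derivedR.
Qed.

Lemma derived_central (hG : T2_group G) x y : derived x -> x * y = y * x.
Proof.
case: hG => _ _ [lc2 _] dx; suff h : [~ x, y] = 1.
  exact/commgP/eqP.
suff : @lower_central G 2 [~ x, y] by rewrite lc2.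
by apply: sub_generated; exists x => //; exists y.
Qed.

End GroupFacts.

Section Abelianization.
Variable G : groupType.
Local Open Scope group_scope.
Local Open Scope quotient_scope.
Implicit Types x y z : G.

Definition derived_rel : rel G := fun x y => `[< derived (x^-1 * y) >].

Lemma derived_rel_equiv : equiv_class_of derived_rel.
Proof.
split=> [x|x y|y x z].
- by apply/asboolP; rewrite mulVg; apply: derived1.
- by apply/asboolP/asboolP => /derivedV; rewrite invgM invgK.
- move=> /asboolP h1 /asboolP h2; apply/asboolP.
  by have := derivedM h1 h2; rewrite mulgA mulgK.
Qed.

Canonical derived_equiv := EquivRelPack derived_rel_equiv.

(* G/G', written additively. *)
Definition abelianization := {eq_quot derived_rel}.
HB.instance Definition _ := Choice.on abelianization.
HB.instance Definition _ := EqQuotient.on abelianization.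

Lemma abel_eqP x y :
  reflect (derived (x^-1 * y)) (\pi_abelianization x == \pi_abelianization y).
Proof. by rewrite eqmodE; apply: asboolP. Qed.

Definition abel_zero : abelianization := \pi_abelianization (1 : G).
Definition abel_opp (u : abelianization) : abelianization := 
  \pi_abelianization ((repr u)^-1 : G).
Definition abel_add (u v : abelianization) : abelianization :=
  \pi_abelianization (repr u * repr v : G).

Lemma abel_piP (u : abelianization) : {x | u = \pi_abelianization x}.
Proof. by exists (repr u); rewrite reprK. Qed.

Lemma abel_repr x : derived ((repr (\pi_abelianization x))^-1 * x).
Proof. by apply/abel_eqP; rewrite reprK. Qed.

Lemma abel_addE x y :
  abel_add (\pi_abelianization x) (\pi_abelianization y) =
  \pi_abelianization (x * y).
Proof.
apply/eqP/abel_eqP; set x' := repr _; set y' := repr _.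
have -> : (x' * y')^-1 * (x * y) = (x'^-1 * x) ^ y' * (y'^-1 * y).
  by rewrite conjgE invgM !mulgA mulgK.
by apply: derivedM; [apply: derivedJ|]; apply: abel_repr.
Qed.

Lemma abel_oppE x : abel_opp (\pi_abelianization x) = \pi_abelianization x^-1.
Proof.
apply/eqP/abel_eqP; set x' := repr _; rewrite invgK.
have -> : x' * x^-1 = ((x'^-1 * x)^-1) ^ x'^-1.
  by rewrite conjgE invgM !invgK !mulgA mulgK.
by apply: derivedJ; apply: derivedV; apply: abel_repr.
Qed.

Lemma abel_addA : associative abel_add.
Proof.
move=> u v w; have [x ->] := abel_piP u; have [y ->] := abel_piP v.
by have [z ->] := abel_piP w; rewrite !abel_addE mulgA.
Qed.

Lemma abel_addC : commutative abel_add.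
Proof.
move=> u v; have [x ->] := abel_piP u; have [y ->] := abel_piP v.
rewrite !abel_addE; apply/eqP/abel_eqP.
have -> : (x * y)^-1 * (y * x) = [~ y, x].
  by rewrite commgEl conjgE invgM !mulgA.
exact: derivedR.
Qed.

Lemma abel_add0 : left_id abel_zero abel_add.
Proof. by move=> u; have [x ->] := abel_piP u; rewrite abel_addE mul1g. Qed.

Lemma abel_addN : left_inverse abel_zero abel_opp abel_add.
Proof.
by move=> u; have [x ->] := abel_piP u; rewrite abel_oppE abel_addE mulVg.
Qed.

HB.instance Definition _ :=
  GRing.isZmodule.Build abelianization abel_addA abel_addC abel_add0 abel_addN.

End Abelianization.

Section DerivedModule.
Variables (G : groupType) (hG : T2_group G).
Local Open Scope group_scope.

(* G', written additively. *)
Definition derived_module of T2_group G := {x : G | x \in @derived G}.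
Local Notation D := (derived_module hG).

HB.instance Definition _ := SubChoice.on D.

Definition to_derived (x : G) (dx : derived x) : D := exist _ x (mem_set dx).

Lemma derived_moduleP (u : D) : derived (val u).
Proof. exact/set_mem/(valP u). Qed.

Definition der_zero : D := to_derived (@derived1 G).
Definition der_opp (u : D) : D := to_derived (derivedV (derived_moduleP u)).
Definition der_add (u v : D) : D :=
  to_derived (derivedM (derived_moduleP u) (derived_moduleP v)).

Lemma der_addA : associative der_add.
Proof. by move=> u v w; apply: val_inj; rewrite /= mulgA. Qed.

Lemma der_addC : commutative der_add.
Proof.
move=> u v; apply: val_inj => /=; apply: (derived_central hG).
exact: derived_moduleP.
Qed.

Lemma der_add0 : left_id der_zero der_add.
Proof. by move=> u; apply: val_inj; rewrite /= mul1g. Qed.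

Lemma der_addN : left_inverse der_zero der_opp der_add.
Proof. by move=> u; apply: val_inj; rewrite /= mulVg. Qed.

HB.instance Definition _ :=
  GRing.isZmodule.Build D der_addA der_addC der_add0 der_addN.

End DerivedModule.

(* L(G) = G/G' (+) G'. The bracket is computed on representatives;
   lie_bracketE shows that it does not depend on them. *)
Section AssociatedLieRing.
Variables (G : groupType) (hG : T2_group G).
Local Open Scope quotient_scope.

Definition lie_ring : zmodType := (abelianization G * derived_module hG)%type.

Definition lie_bracket (u v : lie_ring) : lie_ring :=
  (0, to_derived hG (derivedR (repr u.1) (repr v.1))).

Lemma lie_bracketE (x y : G) (a b : derived_module hG) :
  lie_bracket (\pi x, a) (\pi y, b) = (0, to_derived hG (derivedR x y)).
Proof.
rewrite /lie_bracket /=; apply: (f_equal (pair 0)); apply: val_inj => /=.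
set x' := repr _; set y' := repr _.
have cent (c z : G) : derived c -> commute c z.
  by move=> dc; apply: (derived_central hG).
have [c dc ->] : exists2 c, derived c & x = (x' * c)%g.
  by exists (x'^-1 * x)%g; [apply: abel_repr|rewrite mulVKg].
have [d dd ->] : exists2 d, derived d & y = (y' * d)%g.
  by exists (y'^-1 * y)%g; [apply: abel_repr|rewrite mulVKg].
have cJ (z w : G) : derived z -> (z ^ w = z)%g.
  by move=> dz; apply/conjg_fixP/commgP/cent.
have Jd (z w : G) : derived w -> (z ^ w = z)%g.
  by move=> dw; apply/conjg_fixP/commgP/commute_sym/cent.
have e1 : ([~ x' * c, y' * d] = [~ x' * c, y'])%g.
  by rewrite !commgEl conjgM (Jd _ _ dd).
have e2 : ([~ x' * c, y'] = [~ x', y'])%g.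
  rewrite !commgEl conjMg (cJ _ _ dc) invgM -mulgA; set z := (_ * (_ * c))%g.
  by rewrite (cent _ z (derivedV dc)) /z -!mulgA mulgV mulg1.
by rewrite e1 e2.
Qed.

End AssociatedLieRing.

Definition Z_basis (V : zmodType) (I : finType) (b : I -> V) : Prop :=
  forall v, exists! c : {ffun I -> int}, v = \sum_i b i *~ c i.

Definition relation_matrix (V : zmodType) (y : 'I_2 -> V) : 'M[V]_6 :=
  let y1 := y ord0 in let y2 := y ord_max in
  \matrix_(i < 6, j < 6) nth 0 (nth [::]
    [:: [::    0;    0;           0;       y1; y2;  0];
        [::    0;    0;           0;        0; y1; y2];
        [::    0;    0;           0;  y2 *+ 2;  0; y1];
        [:: - y1;    0; - (y2 *+ 2);        0;  0;  0];
        [:: - y2; - y1;           0;        0;  0;  0];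
        [::    0; - y2;        - y1;        0;  0;  0]] i) j.

Definition has_presentation_np8' (G : groupType) (hG : T2_group G) : Prop :=
  exists (x : 'I_6 -> lie_ring hG) (y : 'I_2 -> lie_ring hG),
  [/\ Z_basis (fun k : 'I_6 + 'I_2 =>
        match k with inl i => x i | inr j => y j end),
      forall i j, lie_bracket (x i) (x j) = relation_matrix y i j,
      forall i j, lie_bracket (x i) (y j) = 0,
      forall i j, lie_bracket (y i) (x j) = 0 &
      forall i j, lie_bracket (y i) (y j) = 0].

Section NormalZeta.
Variable R : realType.
Local Notation C := R[i].

(* a ^ s = exp (s * ln a) for a real a > 0 and a complex exponent s. *)
Definition cpow (a : R) (s : C) : C :=
  let r := expR (complex.Re s * ln a) in
  let t := complex.Im s * ln a in
  Complex (r * cos t) (r * sin t).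

(* C^o is C as a normed space over itself, with the usual topology. *)
Section LocalZeta.
Variables (G : groupType) (p : nat) (s : C).

Definition normal_zeta_term (i : nat) : C^o :=
  (nb_normal_subgroups G (p ^ i))%:R * cpow p%:R (- (i%:R * s)).

Definition normal_zeta_cvg : Prop := cvgn (series normal_zeta_term).

Definition normal_zeta : C^o := limn (series normal_zeta_term).

End LocalZeta.

(* Q(X,Y) is the fraction field of {poly {poly rat}}: X is the outer variable
   and Y the inner one. *)
Definition poly2_eval (P : {poly {poly rat}}) (x y : C) : C :=
  (map_poly (map_poly (ratr : rat -> C)) P).[x%:P].[y].

(* W is defined at (x, y), with value v. *)
Definition ratfun_value (W : {fraction {poly {poly rat}}}) (x y v : C) : Prop :=
  exists P Q : {poly {poly rat}},
    [/\ W = tofrac P / tofrac Q, poly2_eval Q x y != 0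
      & v = poly2_eval P x y / poly2_eval Q x y].

(* The equality of functions of s is meant on some right half-plane on which
   the series converges. *)
Definition normal_zeta_RFORC (G : groupType) : Prop :=
  exists (N : nat) (W : nat -> {fraction {poly {poly rat}}}),
    (0 < N)%N /\
    forall p i : nat, prime p -> (1 <= i <= N)%N -> p = i %[mod N] ->
    exists alpha : R, forall s : C, alpha < complex.Re s ->
      normal_zeta_cvg G p s /\
      ratfun_value (W i) p%:R (cpow p%:R (- s)) (normal_zeta G p s).

End NormalZeta.

(* Main.v *)
From HB Require Import structures.
Require Import Defs.
From mathcomp Require Import all_boot all_order all_fingroup all_algebra all_solvable all_field.
From mathcomp Require Import finmap generic_quotient.
From mathcomp Require Import all_classical all_reals all_analysis.
From mathcomp Require Import complex ring lra zify.
Set Implicit Arguments.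
Unset Strict Implicit.
Unset Printing Implicit Defensive.
Import Order.TTheory GRing.Theory Num.Theory.
Import numFieldNormedType.Exports.

(** The group fails to be RFORC because the number of its normal subgroups of
    index p^5 depends on whether 2 is a cube modulo p.

    Pairing the commutator form of G with (c0, c1) gives an alternating form in
    six variables with Pfaffian c0^3 + 2 c1^3. If 2 is not a cube modulo p, all
    the nonzero pairings are nondegenerate modulo p. A normal subgroup of index
    p^5 is too large to consist of elements of their radicals, and therefore
    contains G' (noncube_over_derived); these subgroups are counted by the
    subgroups of index p^5 of G/G' = Z^6, whose number is a polynomial in p
    (count_Zpower, card_over_derived). If 2 is a cube modulo p, some pairing has
    a radical of rank 2, and G maps onto the Heisenberg group of order p^5 over
    F_p; the kernel is one more normal subgroup (cube_not_over_derived).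

    If the zeta function is RFORC, there are N > 0 and polynomials q != 0 and A
    with q(p) a_{p^5} = A(p) for all primes p = 1 modulo N (RFORC_coef): clear
    denominators in the power series expansion of W_1(p, Y). It remains to know
    that among the primes p = 1 modulo N there are infinitely many modulo which 2
    is a cube, and infinitely many modulo which it is not. The second kind forces
    A = q S, where S is the polynomial that counts the subgroups of Z^6, and then
    one large prime of the first kind gives a contradiction.

    Both statements on primes are instances of the Chebotarev density theorem
    for Q(z, 2^(1/3)), with z a root of unity of order N. They are proved here
    by an elementary argument in the style of Euclid. Values of integral
    polynomials at roots of unity have norms, which are determinants
    of integral matrices; a prime p that divides such a norm provides a root of
    unity in characteristic p with prescribed properties, and the Frobenius map
    then yields information on p. Suitable polynomials give primes modulo which
    2 is a cube (exists_prime_cube). For the other kind, one uses that a prime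
    p = 1 modulo 3 modulo which 2 is a cube has the form x^2 + 27 y^2, by a
    computation with cubic Jacobi sums (cube_mod_norm_form), and that products
    of such primes and of primes p = 2 modulo 3 are norms only of Eisenstein
    integers subject to a congruence modulo 2 (eisen_norm_descent). A norm that
    violates this congruence is constructed by interpolation over F_4
    (exists_norm_cubert1), so one of its prime divisors is of the other kind
    (primes_not_all_cube). *)

Local Open Scope card_scope.
Local Open Scope ring_scope.

Local Notation pZto R := (map_poly (intr : int -> R)).

(** * Norms of polynomial values at the eigenvalues of a matrix *)

Lemma prodr_seqMl (R : comPzRingType) (I : Type) (s : seq I) (x : R) (F : I -> R) :
  \prod_(i <- s) (x * F i) = x ^+ size s * \prod_(i <- s) F i.
Proof.
elim: s => [|i s IH]; first by rewrite !big_nil mulr1.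
by rewrite !big_cons IH /= exprS mulrACA.
Qed.

(** Both sides are multiplicative in u. For u = X - s the left-hand side is,
    up to sign, the characteristic polynomial evaluated at s. *)
Lemma det_horner_mx (E : closedFieldType) (n : nat) (C : 'M[E]_n.+1)
    (rs : seq E) (u : {poly E}) :
  char_poly C = \prod_(r <- rs) ('X - r%:P) ->
  \det (horner_mx C u) = \prod_(r <- rs) u.[r].
Proof.
move=> defC.
have sz_rs : size rs = n.+1.
  by apply: succn_inj; rewrite -(size_prod_XsubC rs id) -defC size_char_poly.
have det_lin s : \det (horner_mx C ('X - s%:P)) = \prod_(r <- rs) (r - s).
  rewrite rmorphB /= horner_mx_X horner_mx_C -opprB -scaleN1r detZ.
  have -> : \det (s%:M - C) = (char_poly C).[s].
    rewrite /char_poly -[in RHS]horner_evalE -det_map_mx; congr (\det _).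
    apply/matrixP=> i j; rewrite !mxE rmorphB rmorphMn /= !horner_evalE.
    by rewrite hornerX hornerC.
  rewrite defC horner_prod -sz_rs -prodr_seqMl; apply: eq_bigr => r _.
  by rewrite hornerXsubC mulN1r opprB.
have [us ->] := closed_field_poly_normal u.
rewrite -mul_polyC rmorphM /= det_mulmx horner_mx_C det_scalar rmorph_prod /=.
rewrite (big_morph _ (@det_mulmx E n.+1) (@det1 E n.+1)).
rewrite (eq_bigr _ (fun s _ => det_lin s)) exchange_big /=.
rewrite -sz_rs -prodr_seqMl; apply: eq_bigr => r _.
rewrite hornerM hornerC horner_prod; congr (_ * _).
by apply: eq_bigr => s _; rewrite hornerXsubC.
Qed.

(** If the order d of r were a proper divisor of n, then r would be a root of
    Phi_k for some divisor k of d as well as of Phi_n, hence a double root of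
    X^n - 1, which is separable. *)
Lemma cyclotomic_prim_root (F : fieldType) (n : nat) (r : F) :
  n%:R != 0 :> F -> root (pZto F 'Phi_n) r -> n.-primitive_root r.
Proof.
move=> nF0 rPhi.
have n_gt0 : (0 < n)%N by case: n nF0 {rPhi} => //; rewrite eqxx.
have XnE k : (0 < k)%N ->
    \prod_(d <- divisors k) pZto F 'Phi_d = 'X^k - 1 :> {poly F}.
  move=> k_gt0; rewrite -rmorph_prod prod_Cyclotomic //=.
  by rewrite rmorphB rmorph1 /= map_polyXn.
have split_n : \prod_(d <- divisors n) pZto F 'Phi_d =
    pZto F 'Phi_n * \prod_(d <- divisors n | d != n) pZto F 'Phi_d :=
  bigD1_seq n (divisors_id n_gt0) (divisors_uniq n).
have rn1 : r ^+ n = 1.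
  apply/eqP; rewrite -subr_eq0 -[X in _ - X](hornerC _ r) -hornerXn -hornerN -hornerD.
  by rewrite -XnE // split_n hornerM (rootP rPhi) mul0r.
have [d dr dn] := prim_order_exists n_gt0 rn1.
have d_gt0 := prim_order_gt0 dr.
have [d_eq_n|d_neq_n] := eqVneq d n; first by rewrite -d_eq_n.
have [k kd rk] : exists2 k, k \in divisors d & root (pZto F 'Phi_k) r.
  have : root (\prod_(k <- divisors d) pZto F 'Phi_k) r.
    by rewrite XnE // rootE !hornerE (prim_expr_order dr) subrr.
  by rewrite rootE horner_prod prodf_seq_eq0 => /hasP[k kd rk]; exists k.
rewrite -dvdn_divisors // in kd.
have k_lt_n : k != n.
  apply: contraNneq d_neq_n => kn; rewrite -kn in dn *.
  by rewrite eqn_dvd dn kd.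
set B := \prod_(d <- divisors n | d != n) _ in split_n.
have rB : B.[r] = 0.
  apply/eqP; rewrite /B horner_prod prodf_seq_eq0; apply/hasP; exists k.
    by rewrite -dvdn_divisors // (dvdn_trans kd).
  by rewrite k_lt_n.
have := congr1 (fun p : {poly F} => p^`().[r]) (XnE n n_gt0).
rewrite split_n derivM hornerD !hornerM rB (rootP rPhi) mulr0 mul0r addr0.
rewrite derivB derivXn derivC subr0 hornerMn hornerXn => /eqP.
rewrite eq_sym -mulr_natr mulf_eq0 (negPf nF0) orbF expf_eq0 => /andP[_ /eqP r0].
by move: rn1; rewrite r0 expr0n (gtn_eqF n_gt0) => /esym/eqP; rewrite oner_eq0.
Qed.

Section MatrixNorm.
Variables (n : nat) (C : 'M[int]_n.+1).

(** The norm from R[x]/(char_poly C) down to R, as a determinant: it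
    specialises along ring homomorphisms, although the roots do not. *)
Definition matnorm (R : comNzRingType) (u : {poly R}) : R :=
  \det (horner_mx (map_mx intr C) u).

Lemma matnorm_map (R S : comNzRingType) (f : {rmorphism R -> S}) (u : {poly R}) :
  f (matnorm u) = matnorm (map_poly f u).
Proof.
rewrite /matnorm -det_map_mx map_horner_mx; congr (\det (horner_mx _ _)).
by apply/matrixP=> i j; rewrite !mxE rmorph_int.
Qed.

(** The determinant of 1 + X A is a polynomial in X with constant coefficient
    1. *)
Lemma matnorm1D (R : comNzRingType) (a : R) (u : {poly R}) :
  exists c, matnorm (1 + a *: u) = 1 + a * c.
Proof.
pose A := horner_mx (map_mx intr C) u.
pose p : {poly R} := \det (1%:M + 'X *: map_mx polyC A).
have pE b : p.[b] = \det (1%:M + b *: A).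
  rewrite -[LHS]horner_evalE -det_map_mx; congr (\det _).
  apply/matrixP=> i j; rewrite !mxE rmorphD rmorphM rmorphMn /= !horner_evalE.
  by rewrite hornerX !hornerC.
have p0 : p.[0] = 1 by rewrite pE scale0r addr0 det1.
have [q [c pq]] : exists q c, p = q * 'X + c%:P.
  elim/poly_ind: (p) => [|q c _]; last by exists q, c.
  by exists 0, 0; rewrite mul0r addr0.
exists q.[a].
have -> : matnorm (1 + a *: u) = p.[a].
  rewrite pE /matnorm rmorphD rmorph1 -[a *: u]mul_polyC rmorphM /=.
  by rewrite horner_mx_C -[_ * _]/(_ *m _) mul_scalar_mx.
move: p0; rewrite pq !hornerMXaddC mulr0 add0r => ->.
by rewrite addrC mulrC.
Qed.

Lemma matnorm_prod (E : closedFieldType) (rs : seq E) (u : {poly E}) :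
  pZto E (char_poly C) = \prod_(r <- rs) ('X - r%:P) ->
  matnorm u = \prod_(r <- rs) u.[r].
Proof. by rewrite map_char_poly; apply: det_horner_mx. Qed.

Lemma char_poly_split (E : closedFieldType) :
  {rs : seq E | pZto E (char_poly C) = \prod_(r <- rs) ('X - r%:P)}.
Proof.
have [rs def] := closed_field_poly_normal (pZto E (char_poly C)); exists rs.
rewrite [LHS]def; suff /monicP -> : pZto E (char_poly C) \is monic by rewrite scale1r.
by rewrite map_char_poly char_poly_monic.
Qed.

Lemma matnorm_eq0 (E : closedFieldType) (u : {poly E}) :
  matnorm u = 0 <-> exists2 r, root (pZto E (char_poly C)) r & u.[r] = 0.
Proof.
have [rs def] := char_poly_split E; rewrite (matnorm_prod _ def) def.
split=> [/eqP|[r]].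
  rewrite prodf_seq_eq0 => /hasP[r r_rs /eqP ur]; exists r => //.
  by rewrite root_prod_XsubC.
rewrite root_prod_XsubC => r_rs ur; apply/eqP.
by rewrite prodf_seq_eq0; apply/hasP; exists r; rewrite // ur eqxx.
Qed.

End MatrixNorm.

(** * Integral matrices whose eigenvalues are roots of unity *)

(** The Frobenius map x |-> x^2 fixes the coefficients of q, which are
    integers. *)
Lemma comp_polyX2_pchar2 (R : comNzRingType) (q : {poly int}) :
  2 \in [pchar R] -> pZto R (q \Po 'X^2) = pZto R q ^+ 2.
Proof.
move=> R2; have P2 : 2 \in [pchar {poly R}] by rewrite pchar_poly.
rewrite -(pFrobenius_autE P2).
elim/poly_ind: q => [|q c IH]; first by rewrite comp_poly0 !rmorph0.
rewrite comp_poly_MXaddC !(rmorphD, IH) /= rmorphM [in RHS]rmorphM /= IH.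
rewrite [in RHS]rmorphM /= map_polyXn map_polyX !map_polyC /= !pFrobenius_autE.
congr (_ + _).
by rewrite -rmorphXn /= -(pFrobenius_autE R2) pFrobenius_aut_int.
Qed.

Lemma comp_polyX2n_pchar2 (R : comNzRingType) (q : {poly int}) (e : nat) :
  2 \in [pchar R] -> pZto R (q \Po 'X^(2 ^ e)) = pZto R q ^+ (2 ^ e).
Proof.
move=> R2; elim: e => [|e IH]; first by rewrite expr1 comp_polyXr.
have -> : 'X^(2 ^ e.+1) = 'X^(2 ^ e) \Po 'X^2 :> {poly int}.
  by rewrite comp_Xn_poly -exprM expnS.
by rewrite comp_polyA comp_polyX2_pchar2 // IH -exprM expnSr.
Qed.

(** All fields are considered at once, because C is going to be reduced modulo
    primes that depend on C. *)
Definition cyclotomic_mx (n : nat) (C : 'M[int]_n.+1) (N : nat) : Prop :=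
  forall (F : fieldType) (r : F), N%:R != 0 :> F ->
    root (pZto F (char_poly C)) r -> N.-primitive_root r.

Lemma monic_char_poly (p : {poly int}) : p \is monic -> (1 < size p)%N ->
  exists n (C : 'M[int]_n.+1), char_poly C = p.
Proof.
move=> /companionmxK; move: (companionmx p); case: (size p) => [|[|n]] //= C defp _.
by exists n, C.
Qed.

(** The characteristic polynomial is Phi_m(- X^(2^e)), made monic. If r is a
    root, then - r^(2^e) has odd order m, so r has order 2^(e+1) m. In
    characteristic 2 the signs disappear and the substitution of X^(2^e)
    becomes a power. *)
Lemma exists_cyclotomic_mx (e m : nat) : odd m -> (1 < m)%N ->
  exists n (C : 'M[int]_n.+1),
    cyclotomic_mx C (2 ^ e.+1 * m) /\
    forall R : comNzRingType, 2 \in [pchar R] ->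
      pZto R (char_poly C) = pZto R 'Phi_m ^+ (2 ^ e).
Proof.
move=> m_odd m_gt1; have m_gt0 := ltnW m_gt1.
pose h := (2 ^ e)%N; pose k := (size 'Phi_m).-1.
have h_gt0 : (0 < h)%N by rewrite expn_gt0.
pose Xh : {poly int} := - 'X^h.
have szXh : size Xh = h.+1 by rewrite size_polyN size_polyXn.
have lcXh : lead_coef Xh = -1 by rewrite lead_coefN lead_coefXn.
pose P : {poly int} := (-1) ^+ k *: ('Phi_m \Po Xh).
have Pmonic : P \is monic.
  rewrite monicE lead_coefZ lead_coef_comp ?szXh // lcXh.
  by rewrite (monicP (Cyclotomic_monic m)) mul1r -exprMn mulrNN mulr1 expr1n.
have szP : (1 < size P)%N.
  rewrite -ltn_predRL size_scale ?signr_eq0 // size_comp_poly szXh.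
  by rewrite size_Cyclotomic muln_gt0 totient_gt0 m_gt0 h_gt0.
have [n [C defC]] := monic_char_poly Pmonic szP.
exists n, C; rewrite /cyclotomic_mx defC; split=> [F r|R R2]; last first.
  rewrite -comp_polyX2n_pchar2 // /P /Xh map_polyZ rmorphXn rmorphN1.
  have N1 : -1 = 1 :> R by rewrite (oppr_pchar2 R2).
  by rewrite N1 expr1n scale1r !map_comp_poly !rmorphN /= -scaleN1r N1 scale1r.
rewrite -/h expnS -/h => N_neq0 rP; have hm_gt0 : (0 < 2 * h * m)%N by rewrite !muln_gt0 h_gt0.
have m_neq0 : m%:R != 0 :> F.
  by apply: contra_neq N_neq0 => m0; rewrite natrM m0 mulr0.
have two_neq0 : 2%:R != 0 :> F.
  by apply: contra_neq N_neq0 => m0; rewrite !natrM m0 !mul0r.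
have sP : m.-primitive_root (- r ^+ h).
  apply: cyclotomic_prim_root => //; move: rP; rewrite map_polyZ rootZ.
    by rewrite map_comp_poly root_comp rmorphN /= map_polyXn !hornerE.
  by rewrite rmorphXn rmorphN1 signr_eq0.
have rN : r ^+ (2 * h * m) = 1.
  rewrite mulnAC mulnC exprM -[r ^+ h]opprK exprM sqrrN -exprM mulnC exprM.
  by rewrite (prim_expr_order sP) expr1n.
have [d dr dN] := prim_order_exists hm_gt0 rN.
suff -> : (2 * h * m)%N = d by [].
have rd := prim_expr_order dr.
have m_dvd_d : (m %| d)%N.
  have : (m %| 2 * d)%N.
    rewrite (prim_order_dvd sP).
    suff -> : (- r ^+ h) ^+ (2 * d) = (r ^+ d) ^+ (h * 2) by rewrite rd expr1n.
    by rewrite exprM sqrrN -!exprM; congr (_ ^+ _); rewrite mulnA mulnC.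
  by rewrite mulnC Gauss_dvdl // coprimen2.
have [d' defd] := dvdnP m_dvd_d.
move: dN; rewrite defd dvdn_pmul2r // -expnS => /(dvdn_pfactor _ _ (isT : prime 2)).
case=> f fe fd; rewrite fd; congr (_ * _)%N.
move: fe; rewrite leq_eqVlt => /predU1P[-> //|fe].
have : (- r ^+ h) ^+ m = -1.
  rewrite exprNn -signr_odd m_odd expr1 -exprM.
  have /dvdnP[c ->] : (d %| h * m)%N.
    by rewrite defd fd dvdn_pmul2r // dvdn_Pexp2l.
  by rewrite mulnC exprM rd expr1n mulr1.
rewrite (prim_expr_order sP) => /eqP; rewrite -subr_eq0 opprK -(natrD _ 1 1).
by rewrite (negPf two_neq0).
Qed.

(** * Fields of characteristic p *)

Lemma closed_field_pchar (p : nat) : prime p ->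
  exists E : closedFieldType, p \in [pchar E].
Proof.
move=> p_pr; have [K [f _]] := countable_algebraic_closure 'F_p.
by exists K; rewrite (fmorph_pchar f) pchar_Fp.
Qed.

Lemma natr_pchar_inj (F : fieldType) (p : nat) : p \in [pchar F] ->
  {in gtn p &, injective (fun k => k%:R : F)}.
Proof.
move=> Fp i j; wlog le_ij : i j / (i <= j)%N => [W ip jp eij|].
  by case/orP: (leq_total i j) => le; [apply: W|symmetry; apply: W].
rewrite !inE => ip jp /esym/eqP; rewrite -subr_eq0 -natrB // -(dvdn_pcharf Fp).
by case: (posnP (j - i)) => [|ji_gt0 /(dvdn_leq ji_gt0)]; lia.
Qed.

Lemma natr_mod_pchar (F : nzSemiRingType) (p a : nat) : p \in [pchar F] ->
  (a %% p)%:R = a%:R :> F.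
Proof.
by move=> Fp; rewrite {2}(divn_eq a p) natrD natrM (pcharf0 Fp) mulr0 add0r.
Qed.

Lemma natr_pchar_modn (F : fieldType) (p a b : nat) : p \in [pchar F] ->
  a%:R = b%:R :> F -> a = b %[mod p].
Proof.
move=> Fp; rewrite -(natr_mod_pchar a Fp) -(natr_mod_pchar b Fp).
have p_gt0 := prime_gt0 (pcharf_prime Fp).
by apply: (natr_pchar_inj Fp); rewrite inE ltn_pmod.
Qed.

(** The p elements of the prime field already exhaust the roots of X^p - X. *)
Lemma pFrobenius_fixed (F : fieldType) (p : nat) (x : F) : p \in [pchar F] ->
  x ^+ p = x -> exists k : nat, x = k%:R.
Proof.
move=> Fp xp; have p_pr := pcharf_prime Fp; have p_gt1 := prime_gt1 p_pr.
pose rs := [seq k%:R : F | k <- iota 0 p].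
have [|x_rs] := boolP (x \in rs); first by case/mapP=> k _ ->; exists k.
have szq : size ('X^p - 'X : {poly F}) = p.+1.
  by rewrite size_polyDl size_polyXn // size_polyN size_polyX.
have : (size (x :: rs) < size ('X^p - 'X : {poly F})%R)%N.
  apply: max_poly_roots; first by rewrite -size_poly_eq0 szq.
    rewrite /= rootE !hornerE xp subrr eqxx /=; apply/allP=> _ /mapP[k _ ->].
    by rewrite rootE !hornerE -(pFrobenius_autE Fp) pFrobenius_aut_nat subrr.
  rewrite /= x_rs map_inj_in_uniq ?iota_uniq // => i j.
  by rewrite !mem_iota /= !add0n => ip jp; apply: (natr_pchar_inj Fp).
by rewrite szq /= size_map size_iota ltnn.
Qed.

Lemma intr_pchar_eq0 (F : fieldType) (p : nat) (z : int) : p \in [pchar F] ->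
  (z%:~R == 0 :> F) = (p %| `|z|)%N.
Proof.
move=> Fp; rewrite (dvdn_pcharf Fp); case: z => k //=.
by rewrite NegzE rmorphN /= oppr_eq0.
Qed.

Lemma exists_nat_nonroot (F : numDomainType) (q : {poly F}) (K : nat) : q != 0 ->
  exists2 c : nat, (K <= c)%N & q.[c%:R] != 0.
Proof.
move=> q0; pose rs := [seq k%:R : F | k <- iota K (size q)].
have [|] := boolP (all (root q) rs) => [rs_root|].
  have : (size rs < size q)%N.
    apply: max_poly_roots => //; rewrite map_inj_uniq ?iota_uniq //.
    by move=> i j /eqP; rewrite eqr_nat => /eqP.
  by rewrite size_map size_iota ltnn.
case/allPn=> _ /mapP[k + ->]; rewrite mem_iota => /andP[Kk _] rk.
by exists k.
Qed.

Lemma dvdp_pchar_neq0 (F : fieldType) (p n d : nat) : p \in [pchar F] ->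
  ~~ (p %| n)%N -> (d %| n)%N -> d%:R != 0 :> F.
Proof.
move=> Fp pn dn; rewrite -(dvdn_pcharf Fp); apply: contra pn => pd.
exact: dvdn_trans dn.
Qed.

Lemma cubert1_exp (R : comNzRingType) (w : R) : w ^+ 2 + w + 1 = 0 -> w ^+ 3 = 1.
Proof.
move=> w2; apply/eqP; rewrite -subr_eq0; apply/eqP.
transitivity ((w - 1) * (w ^+ 2 + w + 1)); [ring | by rewrite w2 mulr0].
Qed.

Lemma cubert1_prim (F : fieldType) (w : F) : 3.-primitive_root w -> w ^+ 2 + w + 1 = 0.
Proof.
move=> w3; have w1 : w - 1 != 0 by rewrite subr_eq0 -{1}[w]expr1 -(prim_order_dvd w3).
apply: (mulfI w1); rewrite mulr0; transitivity (w ^+ 3 - 1); first by ring.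
by rewrite (prim_expr_order w3) subrr.
Qed.

(** * Primes modulo which 2 is a cube *)

Definition cube_mod (a p : nat) : Prop := exists k : nat, k ^ 3 = a %[mod p].

Lemma prod_norm_gt1 (F : numDomainType) (rs : seq F) (f : F -> F) :
  (0 < size rs)%N -> (forall r, r \in rs -> 1 < `|f r|) -> 1 < `|\prod_(r <- rs) f r|.
Proof.
case: rs => // r0 rs _; elim: rs r0 => [|r rs IH] r0 h.
  by rewrite big_seq1 h ?mem_head.
rewrite big_cons normrM -[ltLHS]mulr1; apply: ltr_pM; rewrite ?ler01 //.
  by rewrite h ?mem_head.
by apply: IH => s s_rs; apply: h; rewrite inE s_rs orbT.
Qed.

Section CubeCase.
Variables (n : nat) (C : 'M[int]_n.+1) (N : nat).
Hypotheses (CN : cyclotomic_mx C N) (N3 : (3 %| N)%N) (N_gt0 : (0 < N)%N).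

Let Q := char_poly C.

(** Let z = r^((j + 1) N/3) be one of the two primitive cube roots of unity.
    If s^3 = 2 and (z - 1) s = c (r - r^k), then this polynomial vanishes at
    r: cubing the second equation eliminates s. *)
Let discr (c : int) (jk : 'I_2 * 'I_N) : {poly int} :=
  2%:P * (1 - 'X^(jk.1.+1 * (N %/ 3))) ^+ 3 + (c ^+ 3)%:P * ('X - 'X^(jk.2)) ^+ 3.

Lemma discr_horner (R : comNzRingType) c jk (r : R) :
  (pZto R (discr c jk)).[r] =
  2 * (1 - r ^+ (jk.1.+1 * (N %/ 3))) ^+ 3 + c%:~R ^+ 3 * (r - r ^+ jk.2) ^+ 3.
Proof.
pose f : {rmorphism {poly int} -> {poly R}} := map_poly intr.
rewrite /discr -[map_poly _ _]/(f _) !(rmorphXn f, rmorphN f, rmorphD f, rmorphM f).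
by rewrite rmorph1 /= !map_polyC !map_polyX !hornerE /= rmorphXn.
Qed.

Lemma prim_cube_neq1 (R : fieldType) (r : R) (j : 'I_2) :
  N.-primitive_root r -> r ^+ (j.+1 * (N %/ 3)) != 1.
Proof.
move=> rN; rewrite -(prim_order_dvd rN); case/dvdnP: N3 N_gt0 => k ->.
rewrite mulnK // => k_gt0; rewrite mulnC dvdn_pmul2r; last by lia.
by case: j => [[|[|]]].
Qed.

(** Each of these norms is a polynomial in c whose constant coefficient is the
    norm of 2 (1 - z)^3 for a primitive cube root of unity z, so that it is
    not the zero polynomial. *)
Lemma discr_separates : exists2 c : nat, (3 <= c)%N &
  \prod_jk matnorm C (discr c jk) != 0.
Proof.
have [rs defQ] := char_poly_split C algC.
pose A (z : algC) (j : 'I_2) := 2 * (1 - z ^+ (j.+1 * (N %/ 3))) ^+ 3.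
pose q : {poly algC} := \prod_(jk : 'I_2 * 'I_N) \prod_(z <- rs)
  ((A z jk.1)%:P + ((z - z ^+ jk.2) ^+ 3)%:P * 'X^3).
have prim z : z \in rs -> N.-primitive_root z.
  by move=> z_rs; apply: CN; rewrite ?pnatr_eq0 -?lt0n // defQ root_prod_XsubC.
have q0 : q.[0] != 0.
  rewrite horner_prod; apply/prodf_neq0=> jk _; rewrite horner_prod.
  rewrite prodf_seq_neq0; apply/allP=> z /prim zN /=.
  rewrite /A hornerD hornerC hornerCM hornerXn expr0n mulr0 addr0 mulf_neq0 ?pnatr_eq0 // expf_neq0 //.
  by rewrite subr_eq0 eq_sym prim_cube_neq1.
have [|c c3 qc] := @exists_nat_nonroot _ q 3.
  by apply: contraNneq q0 => ->; rewrite horner0.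
exists c => //; apply/prodf_neq0=> jk _.
rewrite -(intr_eq0 algC) matnorm_map (matnorm_prod _ defQ).
move: qc; rewrite horner_prod => /prodf_neq0/(_ jk isT).
rewrite horner_prod !prodf_seq_neq0; apply: sub_all => z /=.
by rewrite discr_horner /A hornerD hornerC hornerCM hornerXn -pmulrn [c%:R ^+ 3 * _]mulrC.
Qed.

(** Let u = (1 - m c X)^3 - 2 m^3, and let p be a prime divisor of its norm.
    Since u = 1 modulo m, the prime p does not divide m. In characteristic p
    there is a primitive N-th root of unity r with u(r) = 0, which means that
    s = 1/m - c r is a cube root of 2. The Frobenius map multiplies s by a
    cube root of unity. If this were not 1, then p would divide one of the
    norms that discr_separates makes nonzero, and m is divisible by their
    product. So s and r lie in the prime field: 2 is a cube modulo p, and N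
    divides p - 1. *)
Lemma exists_prime_cube (M : nat) : exists p : nat,
  [/\ prime p, (M < p)%N, (N %| p.-1)%N & cube_mod 2 p].
Proof.
have [c c3 D0] := discr_separates; set D := \prod_jk _ in D0.
pose m : nat := (6 * N * c * M`! * `|D|)%N.
have [m2 mN mc mM mD] :
    [/\ (2 %| m)%N, (N %| m)%N, (c %| m)%N, (M`! %| m)%N & (`|D| %| m)%N].
  rewrite /m; split; [do 4!apply: dvdn_mulr | do 3!apply: dvdn_mulr
    | do 2!apply: dvdn_mulr | apply: dvdn_mulr | ]; by rewrite ?dvdn_mull.
have m_gt0 : (0 < m)%N by rewrite !muln_gt0 fact_gt0 absz_gt0 D0 N_gt0; lia.
clearbody m; pose mP : {poly int} := m%:Z%:P; pose cP : {poly int} := c%:Z%:P.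
pose u : {poly int} := (1 - mP * cP * 'X) ^+ 3 - 2 * mP ^+ 3.
have u_horner (R : comNzRingType) (r : R) :
    (pZto R u).[r] = (1 - m%:R * c%:R * r) ^+ 3 - 2 * m%:R ^+ 3.
  pose f : {rmorphism {poly int} -> {poly R}} := map_poly intr.
  rewrite /u -[map_poly _ _]/(f _) !(rmorphXn f, rmorphN f, rmorphD f, rmorphM f).
  by rewrite rmorph1 /= !map_polyC map_polyX !hornerE /= -!pmulrn.
have [d bE] : exists d, matnorm C u = 1 + m%:Z * d.
  pose w : {poly int} := - (cP * 'X).
  have -> : u = 1 + m%:Z *: (3 * w + 3 * mP * w ^+ 2 + mP ^+ 2 * w ^+ 3 - 2 * mP ^+ 2).
    by rewrite /u -mul_polyC /w; ring.
  exact: matnorm1D.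
have b_gt1 : 1 < `|matnorm C u|.
  rewrite -(ltr_int algC) intr_norm matnorm_map.
  have [rs defQ] := char_poly_split C algC; rewrite (matnorm_prod _ defQ).
  apply: prod_norm_gt1 => [|r r_rs].
    rewrite -ltnS -(size_prod_XsubC rs id) -defQ size_map_inj_poly ?size_char_poly //.
    exact: intr_inj.
  have rN : N.-primitive_root r.
    by apply: CN; rewrite ?pnatr_eq0 -?lt0n // defQ root_prod_XsubC.
  have r1 : `|r| = 1.
    apply/eqP; rewrite -(@pexpr_eq1 _ _ N) ?normr_ge0 // -normrX.
    by rewrite (prim_expr_order rN) normr1.
  rewrite u_horner.
  (* Here c >= 3 is used. *)
  have t_ge : (2 * m)%:R <= `|1 - m%:R * c%:R * r|.
    rewrite distrC; apply: le_trans (lerB_dist _ _).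
    rewrite normr1 normrM r1 mulr1 -natrM normr_nat lerBrDr natr1 ler_nat.
    by nia.
  have t3_ge : ((2 * m) ^ 3)%:R <= `|1 - m%:R * c%:R * r| ^+ 3.
    by rewrite natrX lerXn2r // nnegrE.
  apply: lt_le_trans (lerB_dist _ _); rewrite normrX.
  rewrite -(natrX _ m 3) -(natrM _ 2) normr_nat ltrBrDr; apply: lt_le_trans t3_ge.
  by rewrite nat1r ltr_nat !expnS expn0; nia.
have [p p_pr pb] : exists2 p, prime p & (p %| `|matnorm C u|)%N.
  by exists (pdiv `|matnorm C u|); rewrite ?pdiv_dvd // pdiv_prime //; lia.
have pm : ~~ (p %| m)%N.
  apply/negP=> pm; move: pb; rewrite bE -(dvdzE p) => pb.
  have pmd : (p%:Z %| m%:Z * d)%Z by apply: dvdz_mulr.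
  have : (p%:Z %| 1)%Z by rewrite -(rpredDr _ pmd).
  by rewrite dvdz1 absz_nat => /eqP p1; rewrite p1 in p_pr.
have [E Ep] := closed_field_pchar p_pr.
have mE d' : (d' %| m)%N -> d'%:R != 0 :> E := dvdp_pchar_neq0 Ep pm.
have [r rQ ur] : exists2 r, root (pZto E Q) r & (pZto E u).[r] = 0.
  by apply/matnorm_eq0; rewrite -matnorm_map; apply/eqP; rewrite (intr_pchar_eq0 _ Ep).
have rN : N.-primitive_root r by apply: CN => //; apply: mE.
have r_neq0 : r != 0 by rewrite (prim_root_eq0 rN) -lt0n.
have c_neq0 : c%:R != 0 :> E by apply: mE.
have m_neq0 : m%:R != 0 :> E by apply: mE.
have two_neq0 : 2 != 0 :> E by apply: mE.
pose s := m%:R^-1 - c%:R * r.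
have s3 : s ^+ 3 = 2.
  move: ur; rewrite u_horner => /eqP; rewrite subr_eq0 => /eqP ur.
  apply: (mulfI (expf_neq0 3 m_neq0)); rewrite -exprMn [RHS]mulrC -ur.
  by congr (_ ^+ 3); rewrite /s mulrBr mulfV // mulrA.
have s_neq0 : s != 0 by apply: contra_neq two_neq0 => s0; rewrite -s3 s0 expr0n.
have sp : s ^+ p = m%:R^-1 - c%:R * r ^+ p.
  pose phi : {rmorphism E -> E} := pFrobenius_aut Ep.
  have phiE x : phi x = x ^+ p by exact: pFrobenius_autE.
  by rewrite -!phiE /s rmorphB rmorphM fmorphV !rmorph_nat.
have rp : r ^+ p = r ^+ (p %% N) by rewrite (prim_expr_mod rN).
pose w := s ^+ p / s.
have w3 : w ^+ 3 = 1.
  rewrite exprMn exprVn exprAC s3 -(pFrobenius_autE Ep) pFrobenius_aut_nat.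
  by rewrite divff.
have r3 := dvdn_prim_root rN N3.
have [i wE] := prim_rootP r3 w3.
have spE : s ^+ p = s * w by rewrite /w mulrCA mulfV // mulr1.
(* A nontrivial cube root of unity w would make p divide the discriminant D,
   hence m. *)
have w1 : w = 1.
  apply/eqP; have [i0|i_neq0] := eqVneq (i : nat) 0%N; first by rewrite wE i0.
  exfalso; case/negP: pm; apply: dvdn_trans mD; rewrite -(intr_pchar_eq0 _ Ep).
  have i2 : (i.-1 < 2)%N by case: (i : 'I_3) i_neq0 => [[|[|[|]]]].
  rewrite rmorph_prod /=; apply/prodf_eq0.
  exists (Ordinal i2, Ordinal (ltn_pmod p N_gt0)) => //=; apply/eqP.
  rewrite matnorm_map; apply/matnorm_eq0; exists r => //.
  rewrite discr_horner /= prednK ?lt0n // mulnC exprM -wE -rp -pmulrn.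
  have : s * (w - 1) = c%:R * (r - r ^+ p) by rewrite mulrBr mulr1 -spE sp /s; ring.
  move/(congr1 (fun x => x ^+ 3)); rewrite !exprMn s3 => <-; ring.
have s_fix : s ^+ p = s by rewrite spE w1 mulr1.
have r_fix : r ^+ p = r.
  by apply: (mulfI c_neq0); apply: oppr_inj; apply: (addrI m%:R^-1); rewrite -sp s_fix.
exists p; split=> //.
- rewrite ltnNge; apply: contra pm => pM; apply: dvdn_trans mM.
  by rewrite dvdn_fact // prime_gt0.
- rewrite (prim_order_dvd rN); apply/eqP; apply: (mulfI r_neq0).
  by rewrite -exprS prednK ?prime_gt0 // r_fix mulr1.
- have [k sk] := pFrobenius_fixed Ep s_fix.
  by exists k; apply: (natr_pchar_modn Ep); rewrite natrX -sk s3.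
Qed.
End CubeCase.

(** * Jacobi sums of cubic characters *)

Lemma even_card_involution (T : finType) (A : {set T}) (f : T -> T) :
  {in A, forall x, [/\ f x \in A, f (f x) = x & f x != x]} -> ~~ odd #|A|.
Proof.
move=> fA; pose B := [set x in A | enum_rank x < enum_rank (f x)]%N.
have defA : A = B :|: f @: B.
  apply/setP=> x; rewrite !inE; apply/idP/idP=> [xA|].
    have [fxA ffx fx_neq] := fA x xA; rewrite xA /=.
    have [//|lt_fx|/val_inj/enum_rank_inj/eqP] := ltngtP; last by rewrite eq_sym (negPf fx_neq).
    by apply/imsetP; exists (f x); rewrite ?inE ?ffx ?fxA.
  by case/orP=> [/andP[]//|/imsetP[y]]; rewrite inE => /andP[/fA[? _ _] _] ->.
have dis : [disjoint B & f @: B].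
  rewrite -setI_eq0; apply/eqP/setP=> x; rewrite !inE; apply/negP.
  case/andP=> /andP[_ lt1] /imsetP[y]; rewrite inE => /andP[yA lt2] xy.
  by have [_ ffy _] := fA y yA; move: lt1; rewrite xy ffy ltnNge ltnW.
rewrite defA cardsU disjoint_setI0 // cards0 subn0.
rewrite card_in_imset ?addnn ?odd_double // => x y; rewrite !inE.
by case/andP=> /fA[_ + _] _ /andP[/fA[_ + _] _] => {2}<- {2}<- ->.
Qed.

Section CubicChar.
Variables (F : finFieldType) (k : nat) (z : algC).
Hypotheses (cardF : #|F| = (3 * k).+1) (z3 : 3.-primitive_root z).

Lemma expf_3k (x : F) : x != 0 -> (x ^+ k) ^+ 3 = 1.
Proof.
move=> x0; rewrite -exprM mulnC; apply: (mulfI x0).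
by rewrite mulr1 -exprS -cardF expf_card.
Qed.

Lemma exists_cubic_nonresidue : exists2 g : F, g != 0 & g ^+ k != 1.
Proof.
have k_gt0 : (0 < k)%N.
  by have := finRing_gt1 F; rewrite cardF; case: (k).
have [|/forallPn[g]] := boolP [forall x : F, (x == 0) || (x ^+ k == 1)]; last first.
  by rewrite negb_or => /andP[g0 gk]; exists g.
move/forallP=> all_res; pose rs := enum (predC1 (0 : F)).
have szp : size ('X^k - 1 : {poly F}) = k.+1 by rewrite size_XnsubC.
have : (size rs < size ('X^k - 1 : {poly F})%R)%N.
  apply: max_poly_roots; rewrite ?enum_uniq -?size_poly_eq0 ?szp //.
  apply/allP=> x; rewrite mem_enum inE => x0; rewrite rootE !hornerE.
  by have := all_res x; rewrite (negPf x0) subr_eq0.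
by rewrite szp -cardE cardC1 cardF /=; lia.
Qed.

(** The map x |-> x^k sends the nonzero elements of F onto the cube roots of
    unity in F, and chi transports these to the powers of z. *)
Lemma exists_cubic_char : exists chi : F -> algC,
  [/\ chi 0 = 0, {morph chi : x y / x * y}, forall x, x != 0 -> chi x ^+ 3 = 1
    & exists2 g, g != 0 & chi g != 1].
Proof.
have [g g0 gk] := exists_cubic_nonresidue; pose w := g ^+ k.
have w3 : 3.-primitive_root w.
  have [d dw d3] := prim_order_exists (isT : (0 < 3)%N) (expf_3k g0 : w ^+ 3 = 1).
  have [[|[|//]] _ dE] := dvdn_pfactor _ 1 (isT : prime 3) d3; last by rewrite dE in dw.
  rewrite dE in dw.
  by case/eqP: gk; exact: (prim_expr_order dw).
pose e (x : F) : nat := odflt 0%R [pick i : 'I_3 | x ^+ k == w ^+ i].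
have eP x : x != 0 -> x ^+ k = w ^+ e x.
  move=> x0; rewrite /e; case: pickP => [i /eqP //|no].
  by have [i xi] := prim_rootP w3 (expf_3k x0); have := no i; rewrite xi eqxx.
pose chi x := if x == 0 then 0 else z ^+ e x.
have chiE x j : x != 0 -> x ^+ k = w ^+ j -> chi x = z ^+ j.
  move=> x0 xj; rewrite /chi (negPf x0); apply/eqP.
  by rewrite (eq_prim_root_expr z3) -(eq_prim_root_expr w3) -xj eP.
exists chi; split=> [|x y|x x0|]; first by rewrite /chi eqxx.
- have [->|x0] := eqVneq x 0; first by rewrite mul0r /chi eqxx mul0r.
  have [->|y0] := eqVneq y 0; first by rewrite mulr0 /chi eqxx mulr0.
  rewrite (chiE _ (e x + e y)%N) ?mulf_neq0 //; last by rewrite exprMn exprD !eP.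
  by rewrite exprD (chiE x (e x)) ?eP // (chiE y (e y)) ?eP.
- by rewrite /chi (negPf x0) -exprM mulnC exprM (prim_expr_order z3) expr1n.
- exists g => //; rewrite (chiE _ 1%N) // expr1.
  by rewrite -(prim_order_dvd z3 1).
Qed.

End CubicChar.

(** Replacing x by g x multiplies the sum by c g. *)
Lemma sum_char0 (F : finFieldType) (c : F -> algC) (g : F) :
  {morph c : x y / x * y} -> g != 0 -> c g != 1 -> \sum_x c x = 0.
Proof.
move=> cM g0 cg; apply/eqP; have : c g * (\sum_x c x) = \sum_x c x.
  rewrite [RHS](reindex_onto ( *%R g) ( *%R g^-1)) => [|x _]; last by rewrite mulVKf.
  rewrite mulr_sumr; apply: eq_big => [x|x _]; last by rewrite cM.
  by rewrite mulKf ?eqxx.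
by move/eqP; rewrite -subr_eq0 -[X in _ - X]mul1r -mulrBl mulf_eq0 subr_eq0 (negPf cg).
Qed.

Section JacobiSum.
Variables (F : finFieldType) (chi : F -> algC).
Hypotheses (chi0 : chi 0 = 0) (chiM : {morph chi : x y / x * y}).
Hypothesis chi3 : forall x, x != 0 -> chi x ^+ 3 = 1.
Hypothesis chi_nontriv : exists2 g, g != 0 & chi g != 1.

Lemma cubic_char1 : chi 1 = 1.
Proof.
have c3 := chi3 (oner_neq0 F).
have c0 : chi 1 != 0 by apply: contra_eq_neq c3 => ->; rewrite expr0n eq_sym oner_eq0.
by apply: (mulfI c0); rewrite -chiM !mulr1.
Qed.

Let chi1 := cubic_char1.

Let sum_chi : \sum_x chi x = 0.
Proof. by have [g g0 cg] := chi_nontriv; apply: sum_char0 g0 cg. Qed.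

Let sum_chi2 : \sum_x chi x ^+ 2 = 0.
Proof.
have [g g0 cg] := chi_nontriv; apply: (sum_char0 _ g0) => [x y|].
  by rewrite chiM exprMn.
by apply: contra_neq cg => c2; rewrite -(chi3 g0) exprS c2 mulr1.
Qed.

(** The quotient (1 - t y) / (1 - y) is a Moebius transform of y: for t != 1
    it takes every value once as y runs over the projective line. *)
Let sum_inner (t : F) :
  \sum_(y | (y != 0) && (y != 1)) chi ((1 - t * y) / (1 - y)) =
  if t == 1 then #|F|%:R - 2 else - chi t - 1.
Proof.
rewrite (reindex_onto (fun s => 1 - s^-1) (fun y => (1 - y)^-1)) /=; last first.
  by move=> y _; rewrite invrK subKr.
have -> : \sum_(s | (1 - s^-1 != 0) && (1 - s^-1 != 1) && ((1 - (1 - s^-1))^-1 == s))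
    chi ((1 - t * (1 - s^-1)) / (1 - (1 - s^-1))) =
  \sum_(s | (s != 0) && (s != 1)) chi ((1 - t) * s + t).
  apply: eq_big => [s|s].
    rewrite subKr invrK eqxx andbT subr_eq0 eq_sym invr_eq1 andbC.
    by rewrite -[X in _ != X]subr0 (inj_eq (addrI _)) eqr_opp invr_eq0.
  rewrite subKr invrK eqxx andbT => /andP[_ s1].
  have s0 : s != 0 by apply: contra_neq s1 => ->; rewrite invr0 subr0.
  by congr chi; field.
have split01 (f : F -> algC) :
    \sum_(s | (s != 0) && (s != 1)) f s = \sum_s f s - f 0 - f 1.
  rewrite [in RHS](bigD1 0) //= [in RHS](bigD1 1) ?oner_neq0 //=; ring.
rewrite split01; case: eqVneq => [->|t1].
  under eq_bigr do rewrite subrr mul0r add0r chi1.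
  by rewrite sumr_const subrr !mul0r !add0r chi1; ring.
rewrite mulr0 add0r mulr1 subrK chi1; congr (_ - _); rewrite -[RHS]add0r; congr (_ - _).
rewrite -[RHS]sum_chi [RHS](reindex_onto (fun s => (1 - t) * s + t) (fun x => (x - t) / (1 - t))) /=.
  apply: eq_bigl => s; rewrite addrK mulrAC mulfV ?mul1r ?eqxx //.
  by rewrite subr_eq0 eq_sym.
by move=> x _; rewrite mulrC divfK ?subrK // subr_eq0 eq_sym.
Qed.

(** The second factor is the conjugate of the Jacobi sum, since the conjugate
    of chi is its square. The substitution x = t y turns the product into a
    sum over t of chi(t) times the sum computed in sum_inner, where only t = 1
    gives a term of size #|F|. *)
Lemma jacobi_sum_norm :
  (\sum_x chi (x * (1 - x))) * (\sum_x chi (x * (1 - x)) ^+ 2) = #|F|%:R.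
Proof.
have chiN0 x : x != 0 -> chi x != 0.
  by move/chi3 => c3; apply: contra_eq_neq c3 => ->; rewrite expr0n eq_sym oner_eq0.
rewrite mulr_sumr (bigID (fun y : F => (y != 0) && (y != 1))) /= [X in _ + X]big1 ?addr0; last first.
  move=> y; rewrite negb_and !negbK => /orP[]/eqP->.
    by rewrite mul0r chi0 expr0n mulr0.
  by rewrite subrr mulr0 chi0 expr0n mulr0.
have -> : \sum_(y | (y != 0) && (y != 1))
     (\sum_x chi (x * (1 - x))) * chi (y * (1 - y)) ^+ 2 =
   \sum_(y | (y != 0) && (y != 1)) \sum_t chi t * chi ((1 - t * y) / (1 - y)).
  apply: eq_bigr => y /andP[y0 y1].
  rewrite mulr_suml (reindex_onto ( *%R^~ y) ( *%R^~ y^-1)) => [|x _]; last by rewrite divfK.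
  apply: eq_big => [t|t _]; first by rewrite mulfK ?eqxx.
  have y1' : 1 - y != 0 by rewrite subr_eq0 eq_sym.
  rewrite -{1}[1 - t * y](divfK y1') !chiM exprMn.
  transitivity (chi t * (chi (1 - t * y) * chi (1 - y)^-1) * chi y ^+ 3 * chi (1 - y) ^+ 3).
    by ring.
  by rewrite !chi3 // !mulr1.
rewrite exchange_big /=.
under eq_bigr do rewrite -mulr_sumr sum_inner.
rewrite (bigD1 1) //= eqxx chi1 mul1r.
have -> : \sum_(t | t != 1) chi t * (if t == 1 then #|F|%:R - 2 else - chi t - 1)
  = \sum_(t | t != 1) (- chi t ^+ 2) + \sum_(t | t != 1) (- chi t).
  rewrite -big_split /=; apply: eq_bigr => t /negPf ->; ring.
rewrite !sumrN; move: sum_chi sum_chi2; rewrite (bigD1 1) //= (bigD1 1 (F := fun x => chi x ^+ 2)) //=.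
rewrite chi1 expr1n => /eqP; rewrite addrC addr_eq0 => /eqP -> /eqP.
by rewrite addrC addr_eq0 => /eqP ->; ring.
Qed.

End JacobiSum.

Lemma big_ord3 (R : Type) (idx : R) (op : Monoid.law idx) (f : 'I_3 -> R) :
  \big[op/idx]_(j < 3) f j = op (op (f 0) (f 1)) (f 2).
Proof.
rewrite !big_ord_recr big_ord0 Monoid.mul1m /=.
by congr (op (op (f _) (f _)) (f _)); apply: val_inj.
Qed.

(** Gauss's criterion. Let z be a primitive cube root of unity and A_j the set
    of the x with chi (x (1 - x)) = z^j. The Jacobi sum is (#A_0 - #A_2) +
    (#A_1 - #A_2) z, and its norm is p. The product of the values chi (x (1 -
    x)) over x != 0, 1 is 1, hence 3 divides #A_1 + 2 #A_2. The involution x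
    |-> 1 - x preserves A_1 and A_2; its only fixed point 1/2 lies in A_0,
    because 2 is a cube; hence #A_1 and #A_2 are even. So 6 divides #A_1 -
    #A_2 = 6 e, and a^2 - 6 a e + 36 e^2 = (a - 3 e)^2 + 27 e^2. *)
Lemma cube_mod_norm_form (p : nat) : prime p -> (3 %| p.-1)%N -> cube_mod 2 p ->
  exists x y : int, p%:Z = x ^+ 2 + 27 * y ^+ 2.
Proof.
move=> p_pr /dvdnP[k pk] [c c3]; have p_gt0 := prime_gt0 p_pr.
have cardF : #|'F_p| = (3 * k).+1 by rewrite card_Fp // mulnC -pk prednK.
have [z z3] := C_prim_root_exists (isT : (0 < 3)%N).
have [chi [chi0 chiM chi3 chi_nt]] := exists_cubic_char cardF z3.
have z31 : z ^+ 3 = 1 := prim_expr_order z3.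
have zz : z ^+ 2 = - 1 - z.
  by apply/eqP; rewrite -subr_eq0 -(cubert1_prim z3); apply/eqP; ring.
have chi1 := cubic_char1 chiM chi3.
have zj_neq0 j : z ^+ j != 0 by rewrite expf_neq0 // (prim_root_eq0 z3).
have zj_inj (i j : 'I_3) : (z ^+ i == z ^+ j) = (i == j).
  by rewrite (eq_prim_root_expr z3) !modn_small.
pose g (x : 'F_p) := chi (x * (1 - x)).
have gN x : x * (1 - x) = 0 -> g x = 0 by rewrite /g => ->.
have gV x : x * (1 - x) != 0 -> exists j : 'I_3, g x = z ^+ j.
  by move=> x0; have [j] := prim_rootP z3 (chi3 _ x0); exists j.
pose A (j : 'I_3) := [set x | g x == z ^+ j].
have sumg (d : nat) : (0 < d)%N ->
    \sum_x g x ^+ d = \sum_(j < 3) #|A j|%:R * (z ^+ j) ^+ d.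
  move=> d_gt0; transitivity (\sum_x \sum_(j < 3) (x \in A j)%:R * (z ^+ j) ^+ d).
    apply: eq_bigr => x _; have [/gN gx|/gV[j gx]] := eqVneq (x * (1 - x)) 0.
      rewrite gx expr0n gtn_eqF // big1 // => j _.
      by rewrite inE gx eq_sym (negPf (zj_neq0 j)) mul0r.
    rewrite (bigD1 j) //= inE gx eqxx mul1r big1 ?addr0 // => i ij.
    by rewrite inE gx zj_inj eq_sym (negPf ij) mul0r.
  rewrite exchange_big /=; apply: eq_bigr => j _; rewrite -mulr_suml.
  by rewrite -natr_sum -big_mkcond /= sum1_card.
pose a0 : int := #|A 0|; pose a1 : int := #|A 1|; pose a2 : int := #|A 2|.
have pE : p%:Z = (a0 - a2) ^+ 2 - (a0 - a2) * (a1 - a2) + (a1 - a2) ^+ 2.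
  have := jacobi_sum_norm chi0 chiM chi3 chi_nt.
  rewrite -[\sum_x chi _](eq_bigr _ (fun x _ => expr1 (g x))) !sumg // !big_ord3 /=.
  rewrite card_Fp // => pE; apply: (@intr_inj algC).
  rewrite -pmulrn -pE !expr1 expr0 !(rmorphXn, rmorphN, rmorphD, rmorphM) /= -!pmulrn.
  have z4 : (z ^+ 2) ^+ 2 = z by rewrite -exprM (exprS z 3) z31 mulr1.
  rewrite z4 zz expr1n; ring: zz.
have n3 : (3 %| a1 + 2 * a2)%Z.
  have P2 : (\prod_(x | x != 0) chi x) ^+ 2 = 1.
    rewrite expr2 {1}(reindex_inj invr_inj) /=.
    rewrite (eq_bigl (fun x => x != 0)) => [|x]; last by rewrite invr_eq0.
    by rewrite -big_split /= big1 // => x x0; rewrite -chiM mulVf // chi1.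
  have : \prod_x \prod_(j < 3) (if x \in A j then z ^+ j else 1) = 1.
    transitivity (\prod_(x | x * (1 - x) != 0) g x).
      rewrite [RHS]big_mkcond /=; apply: eq_bigr => x _.
      have [/gN gx|/gV[j gx]] := eqVneq (x * (1 - x)) 0.
        by rewrite big1 // => j _; rewrite inE gx eq_sym (negPf (zj_neq0 j)).
      rewrite (bigD1 j) //= inE gx eqxx big1 ?mulr1 // => i ij.
      by rewrite inE gx zj_inj eq_sym (negPf ij).
    rewrite -[RHS]P2 expr2 [in RHS](bigD1 1) ?oner_neq0 //= chi1 mul1r.
    have e01 (x : 'F_p) : (x * (1 - x) != 0) = (x != 0) && (x != 1).
      by rewrite mulf_eq0 negb_or subr_eq0 [1 == _]eq_sym.
    rewrite (eq_bigl _ _ e01) /g; under eq_bigr do rewrite chiM.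
    rewrite big_split /=; congr (_ * _).
    rewrite (reindex_inj (can_inj (subKr 1))) /=; apply: eq_big => [x|x _].
      by rewrite -!e01 subKr mulrC.
    by rewrite subKr.
  rewrite exchange_big big_ord3 /=.
  have prodA (j : 'I_3) : \prod_x (if x \in A j then z ^+ j else 1) = z ^+ (j * #|A j|).
    by rewrite -big_mkcond /= prodr_const exprM.
  rewrite !prodA /= mul0n expr0 mul1r mul1n -exprD => /eqP.
  by rewrite -(prim_order_dvd z3).
have n2 (j : 'I_3) : j != 0 -> ~~ odd #|A j|.
  move=> j0; apply: (@even_card_involution _ _ (fun x => 1 - x)) => x.
  rewrite inE => gx; split; rewrite ?inE ?subKr //; first by rewrite /g subKr mulrC.
  apply: contra_neq j0 => x1; apply/eqP; rewrite -zj_inj -(eqP gx) expr0 /g x1 chiM.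
  have xx : x * 2 = 1 by rewrite mulr_natr mulr2n -{1}x1 subrK.
  have x0 : x != 0 by apply: contra_eq_neq xx => ->; rewrite mul0r eq_sym oner_eq0.
  have Fp : p \in [pchar 'F_p] by rewrite pchar_Fp.
  have c2 : (c%:R : 'F_p) ^+ 3 = 2.
    by rewrite -natrX -(natr_mod_pchar _ Fp) c3 natr_mod_pchar.
  have c0 : (c%:R : 'F_p) != 0.
    apply: contra_eq_neq c2 => ->; rewrite expr0n /= eq_sym.
    by apply: contra_eq_neq xx => ->; rewrite mulr0 eq_sym oner_eq0.
  have chi2 : chi 2 = 1 by rewrite -c2 !exprS expr0 mulr1 !chiM -[RHS](chi3 _ c0) !exprS expr0 mulr1.
  have chix : chi x = 1 by rewrite -[LHS]mulr1 -{1}chi2 -chiM xx chi1.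
  by rewrite chix mulr1.
have [e de] : exists e, a1 - a2 = 6 * e.
  have := n2 1 isT; have := n2 2 isT; case/dvdzP: n3 => l.
  rewrite /a1 /a2; set a := #|A 1|; set b := #|A 2| => nl b2 c2.
  exists (divz (a%:Z - b%:Z) 6); lia.
exists (a0 - a2 - 3 * e), e; rewrite pE de; ring.
Qed.

(** * Norms of Eisenstein integers *)

(** The norm from Z[w] of a + b w, where w is a primitive cube root of unity. *)
Definition eisen_norm (a b : int) : int := a ^+ 2 - a * b + b ^+ 2.

Lemma eisen_norm4 a b : 4 * eisen_norm a b = (2 * a - b) ^+ 2 + 3 * b ^+ 2.
Proof. rewrite /eisen_norm; ring. Qed.

Lemma eisen_norm_ge0 a b : 0 <= eisen_norm a b.
Proof.
have : 0 <= 4 * eisen_norm a b.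
  by rewrite eisen_norm4; apply: addr_ge0; [|apply: mulr_ge0 => //]; apply: sqr_ge0.
lia.
Qed.

Lemma eisen_norm_eq0 a b : eisen_norm a b = 0 -> a = 0 /\ b = 0.
Proof.
move=> n0; have := eisen_norm4 a b; rewrite n0 mulr0 => /esym/eqP.
rewrite paddr_eq0; [|exact: sqr_ge0|by apply: mulr_ge0 => //; apply: sqr_ge0].
rewrite expf_eq0 mulf_eq0 expf_eq0 /= => /andP[/eqP a0 /eqP b0].
by split; lia.
Qed.

(** The order of v in the multiplicative group is 1 or 3. *)
Lemma cubert1_dvd_pred (p : nat) (v : 'F_p) : prime p -> v ^+ 2 + v + 1 = 0 ->
  p = 3 \/ (3 %| p.-1)%N.
Proof.
move=> p_pr v2; have v3 := cubert1_exp v2.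
have [d dv d3] := prim_order_exists (isT : (0 < 3)%N) v3.
have [[|[|//]] _ dE] := dvdn_pfactor _ 1 (isT : prime 3) d3; rewrite dE in dv.
  left; have v1 : v = 1 by exact: (prim_expr_order dv).
  move: v2; rewrite v1 expr1n -(natrD _ 1 1) -(natrD _ 2 1) => /eqP.
  have Fp : p \in [pchar 'F_p] by rewrite pchar_Fp.
  by rewrite -(dvdn_pcharf Fp) dvdn_prime2 // => /eqP.
right; rewrite expn1 in dv; rewrite (prim_order_dvd dv).
have v0 : v != 0 by rewrite (prim_root_eq0 dv).
apply/eqP; apply: (mulfI v0); rewrite mulr1 -exprS prednK ?prime_gt0 //.
by rewrite -{2}[v]expf_card card_Fp.
Qed.

(** Otherwise - a / b would be a nontrivial cube root of unity modulo p. *)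
Lemma eisen_norm_inert (p : nat) (a b : int) : prime p -> (p %% 3)%N = 2%N ->
  (p%:Z %| eisen_norm a b)%Z -> (p%:Z %| a)%Z /\ (p%:Z %| b)%Z.
Proof.
move=> p_pr p2; have Fp : p \in [pchar 'F_p] by rewrite pchar_Fp.
rewrite !(dvdz_pcharf Fp) /eisen_norm !(rmorphXn, rmorphN, rmorphD, rmorphM) /=.
set x := a%:~R; set y := b%:~R => /eqP n0.
have [y0|y0] := eqVneq y 0.
  by split=> //; move: n0; rewrite y0 mulr0 subr0 expr0n addr0 => /eqP; rewrite expf_eq0.
have [||/dvdnP[k pk]] := @cubert1_dvd_pred p (- (x / y)) p_pr.
- apply: (mulfI (expf_neq0 2 y0)); rewrite mulr0 -n0; field; exact: y0.
- by move=> p3; rewrite p3 in p2.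
- by have := prime_gt0 p_pr; lia.
Qed.

Lemma dvdz3_mulr_prime (p : nat) (b : int) : prime p -> p != 3 ->
  (3 %| b * p%:Z)%Z -> (3 %| b)%Z.
Proof.
move=> p_pr p3; rewrite Gauss_dvdzl // coprimezE absz_nat prime_coprime //.
by rewrite dvdn_prime2 // eq_sym.
Qed.

(** This takes the place of the cubic reciprocity law for 2. The proof is a
    descent on the norm of a + b w. An odd prime p = 2 modulo 3 that divides
    the norm divides a and b. A prime p = x^2 + 27 y^2 is the norm of c + d w
    with d = 6 y, and a + b w is divisible by c + d w or by its conjugate; as
    6 divides d, passing to the quotient changes neither whether 3 divides b
    nor whether 2 does. When the norm is 1, the condition that 3 divides b
    leaves only b = 0. *)
Lemma eisen_norm_descent (a b : int) : (3 %| b)%Z ->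
  (forall p : nat, prime p -> (p%:Z %| eisen_norm a b)%Z ->
    (odd p /\ (p %% 3)%N = 2%N) \/ exists x y : int, p%:Z = x ^+ 2 + 27 * y ^+ 2) ->
  (2 %| b)%Z.
Proof.
have [m] := ubnP `|eisen_norm a b|%N; elim: m a b => // m IH a b.
rewrite ltnS => le_m b3 h.
have [n0|n0] := eqVneq (eisen_norm a b) 0; first by have [_ ->] := eisen_norm_eq0 n0.
have [n1|n1] := eqVneq (eisen_norm a b) 1.
  suff -> : b = 0 by [].
  by have := eisen_norm4 a b; rewrite n1; case/dvdzP: b3 => k ->; nia.
have := eisen_norm_ge0 a b => n_ge0.
have [p p_pr pn] : exists2 p, prime p & (p %| `|eisen_norm a b|)%N.
  by exists (pdiv `|eisen_norm a b|); rewrite ?pdiv_dvd // pdiv_prime //; lia.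
have p_gt1 := prime_gt1 p_pr.
have [[p_odd p2]|[x [y pxy]]] := h p p_pr pn.
  have p3 : p != 3 by apply: contra_eq_neq p2 => ->.
  have [/dvdzP[a' aE] /dvdzP[b' bE]] := eisen_norm_inert p_pr p2 pn.
  have nE : eisen_norm a b = eisen_norm a' b' * p%:Z ^+ 2.
    by rewrite /eisen_norm aE bE; ring.
  have n'0 : eisen_norm a' b' != 0.
    by apply: contra_neq n0 => n'0; rewrite nE n'0 mul0r.
  rewrite bE dvdz_mulr //; apply: (IH a').
  - by apply: leq_trans le_m; rewrite nE abszM ltn_Pmulr ?absz_gt0 //
       abszX absz_nat -[1%N]/(1 ^ 2)%N ltn_exp2r.
  - by move: b3; rewrite bE; apply: dvdz3_mulr_prime.
  - by move=> q q_pr qn; apply: h => //; rewrite nE dvdz_mulr.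
have p3 : p != 3.
  apply/eqP=> p3; move: pxy; rewrite p3 !expr2 => e3.
  have y0 : y = 0 by nia.
  have [x1 x2] : -2 < x /\ x < 2 by nia.
  have : x = -1 \/ x = 0 \/ x = 1 by lia.
  by case=> [|[]] x0; move: e3; rewrite x0 y0.
(* p is the norm of c + d w. *)
pose c := x + 3 * y; pose d := 6 * y.
have d2 : (2 %| d)%Z by rewrite dvdz_mulr.
have d3 : (3 %| d)%Z by rewrite dvdz_mulr.
have pE : p%:Z = eisen_norm c d by rewrite pxy /eisen_norm /c /d; ring.
have step (u v a' b' : int) : u = p%:Z * a' -> v = p%:Z * b' ->
    eisen_norm u v = eisen_norm a b * p%:Z -> (3 %| v)%Z -> (2 %| b')%Z.
  move=> uE vE nE v3.
  have nE' : eisen_norm a b = eisen_norm a' b' * p%:Z.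
    apply: (mulIf (_ : p%:Z != 0)); first by lia.
    by rewrite -nE /eisen_norm uE vE; ring.
  have n'0 : eisen_norm a' b' != 0.
    by apply: contra_neq n0 => n'0; rewrite nE' n'0 mul0r.
  apply: (IH a').
  - by apply: leq_trans le_m; rewrite nE' abszM ltn_Pmulr ?absz_gt0.
  - by move: v3; rewrite vE mulrC; apply: dvdz3_mulr_prime.
  - by move=> q q_pr qn; apply: h => //; rewrite nE' dvdz_mulr.
have p_sq (u v : int) : eisen_norm u v = eisen_norm a b * p%:Z ->
    (p%:Z %| v)%Z -> (p%:Z %| u)%Z.
  move=> nE /dvdzP[v' vE]; have /dvdzP[n' nE'] : (p%:Z %| eisen_norm a b)%Z by [].
  have : (p%:Z %| u ^+ 2)%Z.
    apply/dvdzP; exists (n' * p%:Z + u * v' - v' ^+ 2 * p%:Z).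
    have -> : u ^+ 2 = eisen_norm u v + u * v - v ^+ 2 by rewrite /eisen_norm; ring.
    by rewrite nE nE' vE; ring.
  by rewrite !dvdzE absz_nat abszX Euclid_dvdX // andbT.
have [/dvdzP[b' vE]|/dvdzP[b' vE]] :
    (p%:Z %| b * c - a * d)%Z \/ (p%:Z %| a * d + b * c - b * d)%Z.
  have : (p%:Z %| (b * c - a * d) * (a * d + b * c - b * d))%Z.
    have -> : (b * c - a * d) * (a * d + b * c - b * d) =
      b ^+ 2 * eisen_norm c d - d ^+ 2 * eisen_norm a b by rewrite /eisen_norm; ring.
    by rewrite -pE rpredB ?dvdz_mull.
  by rewrite !dvdzE absz_nat abszM Euclid_dvdM // => /orP.
- have nE : eisen_norm (a * c - a * d + b * d) (b * c - a * d) = eisen_norm a b * p%:Z.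
    by rewrite pE /eisen_norm; ring.
  have /dvdzP[a' uE] := p_sq _ _ nE (introT dvdzP (ex_intro _ b' vE)).
  have b'2 : (2 %| b')%Z.
    apply: step nE _; [by rewrite uE mulrC|by rewrite vE mulrC|].
    by apply: rpredB; [apply: dvdz_mulr|apply: dvdz_mull].
  suff -> : b = a' * d + b' * c - b' * d.
    by do ?[apply: rpredB|apply: rpredD]; first [by apply: dvdz_mull|by apply: dvdz_mulr].
  apply: (mulIf (_ : p%:Z != 0)); first by lia.
  transitivity ((a' * p%:Z) * d + (b' * p%:Z) * c - (b' * p%:Z) * d); last by ring.
  by rewrite -uE -vE pE /eisen_norm; ring.
- have nE : eisen_norm (a * c - b * d) (a * d + b * c - b * d) = eisen_norm a b * p%:Z.
    by rewrite pE /eisen_norm; ring.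
  have /dvdzP[a' uE] := p_sq _ _ nE (introT dvdzP (ex_intro _ b' vE)).
  have b'2 : (2 %| b')%Z.
    apply: step nE _; [by rewrite uE mulrC|by rewrite vE mulrC|].
    by do ?[apply: rpredB|apply: rpredD]; first [by apply: dvdz_mull|by apply: dvdz_mulr].
  suff -> : b = b' * c - a' * d.
    by apply: rpredB; [apply: dvdz_mulr|apply: dvdz_mull].
  apply: (mulIf (_ : p%:Z != 0)); first by lia.
  transitivity ((b' * p%:Z) * c - (a' * p%:Z) * d); last by ring.
  by rewrite -uE -vE pE /eisen_norm; ring.
Qed.

(** Polynomials with integer coefficients stand for elements of Z[w]: the
    specialisations of interest are those at roots of X^2 + X + 1. *)
Definition ev (R : comNzRingType) (w : R) : {poly int} -> R :=
  horner_eval w \o map_poly intr.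
HB.instance Definition _ (R : comNzRingType) (w : R) :=
  GRing.RMorphism.copy (ev w) (horner_eval w \o map_poly intr).

Lemma evX (R : comNzRingType) (w : R) : ev w 'X = w.
Proof. by rewrite /ev /= map_polyX /horner_eval hornerX. Qed.

Lemma ev_eisenstein (q : {poly int}) : exists a b : int,
  forall (R : comNzRingType) (w : R), w ^+ 2 + w + 1 = 0 -> ev w q = a%:~R + b%:~R * w.
Proof.
elim/poly_ind: q => [|q c [a [b abE]]].
  by exists 0, 0 => R w _; rewrite rmorph0 mul0r addr0.
exists (c - b), (a - b) => R w w2.
have evC : ev w c%:P = c%:~R by rewrite /ev /= map_polyC /horner_eval hornerC.
rewrite rmorphD rmorphM /= evX evC abE // !rmorphB /=.
apply/eqP; rewrite -subr_eq0; apply/eqP.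
transitivity (b%:~R * (w ^+ 2 + w + 1)); [ring | by rewrite w2 mulr0].
Qed.

Lemma eisen_norm_factor (R : comNzRingType) (w : R) (a b : int) :
  w ^+ 2 + w + 1 = 0 ->
  (eisen_norm a b)%:~R = (a%:~R + b%:~R * w) * (a%:~R + b%:~R * w ^+ 2).
Proof.
move=> w2; rewrite /eisen_norm !(rmorphXn, rmorphN, rmorphD, rmorphM) /=.
apply/eqP; rewrite -subr_eq0; apply/eqP; set x := a%:~R; set y := b%:~R.
transitivity (- (x * y + y ^+ 2 * (w - 1)) * (w ^+ 2 + w + 1)); first by ring.
by rewrite w2 mulr0.
Qed.

(** * A norm equal to a cube root of unity in characteristic 2 *)

Section CharTwo.
Variables (E : closedFieldType) (f : nat).
Hypotheses (E2 : 2 \in [pchar E]) (f_gt0 : (0 < f)%N).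
Let m := (4 ^ f).-1.

Let m_odd : odd m.
Proof. by rewrite /m; case: f f_gt0 => // k _; rewrite expnS; case: (4 ^ k)%N (expn_gt0 4 k) => // l _; rewrite mulnS /= oddM. Qed.

Let mS : m.+1 = (4 ^ f)%N.
Proof. by rewrite prednK // expn_gt0. Qed.

(** The number m of terms is odd, hence equal to 1 in E. *)
Lemma sum_unity_root (s : E) : s ^+ m = 1 ->
  \sum_(k < m) s ^+ k = (s == 1)%:R.
Proof.
move=> sm; case: eqVneq => [->|s1].
  under eq_bigr do rewrite expr1n.
  by rewrite sumr_const card_ord -(natr_mod_pchar _ E2) modn2 m_odd.
apply: (mulfI (_ : s - 1 != 0)); first by rewrite subr_eq0.
by rewrite mulr0 -subrX1 sm subrr.
Qed.

Let frob4 : {rmorphism E -> E} := pFrobenius_aut E2 \o pFrobenius_aut E2.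

Let frob4E (x : E) : frob4 x = x ^+ 4.
Proof. by rewrite /= !pFrobenius_autE -exprM. Qed.

Let frob4B (x y : E) j : (x - y) ^+ (4 ^ j) = x ^+ (4 ^ j) - y ^+ (4 ^ j).
Proof.
elim: j => [|j IH]; first by rewrite !expr1.
by rewrite expnSr !(exprM _ _ 4) IH -!frob4E rmorphB.
Qed.

(** Let r be a primitive m-th root of unity and u the function on the m-th
    roots of unity that is the identity on the Frobenius orbit r, r^4, ...,
    r^(4^(f - 1)) and takes the value 1 elsewhere. As u commutes with x |->
    x^4, its interpolation polynomial has coefficients in F_4 = {0, 1, w,
    w^2}, and these lift to polynomials in w. The product of the values of u
    is r^(1 + 4 + ... + 4^(f - 1)) = r^(m/3). *)
Lemma exists_norm_cubert1 : exists (w : E) (g : {poly {poly int}}),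
  w ^+ 2 + w + 1 = 0 /\
  forall rs, pZto E 'Phi_m = \prod_(r <- rs) ('X - r%:P) ->
    \prod_(r <- rs) (1 - map_poly (ev w) g).[r] = w.
Proof.
have m_gt0 : (0 < m)%N by case: (m) m_odd.
have m_neq0 : m%:R != 0 :> E by rewrite -(dvdn_pcharf E2) dvdn2 m_odd.
have mE : m = (3 * \sum_(j < f) 4 ^ j)%N by rewrite /m predn_exp.
have m3 : (3 %| m)%N by rewrite mE dvdn_mulr.
have [r rPhi] : exists r, root (pZto E 'Phi_m) r.
  apply/closed_rootP; rewrite size_map_poly_id0 ?size_Cyclotomic.
    by rewrite eqSS -lt0n totient_gt0.
  by rewrite (monicP (Cyclotomic_monic m)) oner_eq0.
have rm := cyclotomic_prim_root m_neq0 rPhi.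
pose w := r ^+ (m %/ 3).
have w3 : 3.-primitive_root w := dvdn_prim_root rm m3.
have w2 := cubert1_prim w3.
have r_neq0 : r != 0 by rewrite (prim_root_eq0 rm) -lt0n.
(* c k is the coefficient of X^k in the interpolation polynomial of u - 1. *)
pose v k j := ((r - 1) * r ^- k) ^+ (4 ^ j).
pose c k := \sum_(j < f) v k j.
have r4f : r ^+ (4 ^ f) = r by rewrite -mS exprS (prim_expr_order rm) mulr1.
have v4 k j : v k j ^+ 4 = v k j.+1 by rewrite /v -exprM -expnSr.
have vf k : v k f = v k 0%N.
  by rewrite /v expr1 exprMn frob4B r4f expr1n exprVn -exprM mulnC exprM r4f.
have c4 k : c k ^+ 4 = c k.
  rewrite -frob4E /c rmorph_sum.
  rewrite (eq_bigr (fun j : 'I_f => v k j.+1)) => [|j _]; last by rewrite -v4 -frob4E.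
  apply: (addrI (v k 0%N)); rewrite -(big_ord_recl f (fun j => v k j)).
  by rewrite big_ord_recr /= vf addrC.
have /fin_all_exists[cl clE] (k : 'I_m) : exists q : {poly int}, ev w q = c k.
  have [c0|c0] := eqVneq (c k) 0; first by exists 0; rewrite rmorph0.
  have /(prim_rootP w3)[i ->] : c k ^+ 3 = 1.
    by apply: (mulfI c0); rewrite -exprS c4 mulr1.
  by exists ('X^i); rewrite rmorphXn /= evX.
exists w, (- \sum_(k < m) cl k *: 'X^k); split=> // rs defPhi.
have rs_root t : (t \in rs) = root (pZto E 'Phi_m) t by rewrite defPhi root_prod_XsubC.
have rs_uniq : uniq rs.
  rewrite -separable_prod_XsubC -defPhi; apply: dvdp_separable (separable_Xn_sub_1 m_neq0).
  have -> : 'X^m - 1 = pZto E ('X^m - 1) by rewrite rmorphB rmorph1 /= map_polyXn.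
  rewrite -prod_Cyclotomic // (bigD1_seq m) ?divisors_uniq ?divisors_id //=.
  by rewrite rmorphM dvdp_mulr.
pose s (j : 'I_f) := r ^+ (4 ^ j).
have s_rs j : s j \in rs.
  rewrite rs_root /s -[4%N]/(2 ^ 2)%N -expnM rootE.
  have := congr1 (horner^~ r) (comp_polyX2n_pchar2 'Phi_m (2 * j) E2).
  rewrite map_comp_poly map_polyXn horner_comp hornerXn horner_exp => ->.
  by rewrite (rootP rPhi) expr0n expn_eq0.
have s_inj : injective s.
  have small (i : 'I_f) : (4 ^ i < m)%N.
    have := leq_pexp2l (isT : 0 < 4)%N (ltn_ord i); rewrite -mS expnS.
    have : (0 < 4 ^ i)%N by rewrite expn_gt0.
    lia.
  move=> i j /eqP; rewrite (eq_prim_root_expr rm) !modn_small // eqn_exp2l //.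
  by move/eqP/val_inj.
have uE t : t \in rs -> (1 - map_poly (ev w) (- \sum_(k < m) cl k *: 'X^k)).[t] =
    \prod_(j < f) (if t == s j then t else 1).
  rewrite rs_root => /(cyclotomic_prim_root m_neq0)/prim_expr_order tm.
  rewrite rmorphN opprK hornerD hornerC rmorph_sum /= horner_sum.
  have -> : \sum_(k < m) (map_poly (ev w) (cl k *: 'X^k)).[t] =
      \sum_(j < f) (s j - 1) * (t == s j)%:R.
    transitivity (\sum_(k < m) \sum_(j < f) (s j - 1) * (t / s j) ^+ k).
      apply: eq_bigr => k _; rewrite map_polyZ map_polyXn hornerZ hornerXn.
      rewrite -[_ (cl k)]/(ev w (cl k)) clE.
      rewrite /c mulr_suml; apply: eq_bigr => j _.
      rewrite /v exprMn frob4B expr1n exprVn -/(s j) -mulrA; congr (_ * _).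
      by rewrite exprMn exprVn mulrC /s -!exprM mulnC.
    rewrite exchange_big /=; apply: eq_bigr => j _; rewrite -mulr_sumr.
    rewrite sum_unity_root; last first.
      by rewrite exprMn tm exprVn /s -exprM mulnC exprM (prim_expr_order rm) expr1n invr1 mulr1.
    have sj0 : s j != 0 by rewrite expf_neq0.
    by rewrite -subr_eq0 -[1](divff sj0) -mulrBl mulf_eq0 invr_eq0 (negPf sj0) orbF subr_eq0.
  have [/existsP[j /eqP ->]|/existsPn no] := boolP [exists j, t == s j].
    rewrite [LHS](_ : _ = s j); last first.
      rewrite (bigD1 j) //= eqxx mulr1 big1 => [|i ij]; last first.
        by rewrite (inj_eq s_inj) eq_sym (negPf ij) mulr0.
      by rewrite addr0 addrC subrK.
    rewrite (bigD1 j) //= eqxx big1 ?mulr1 // => i ij.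
    by rewrite (inj_eq s_inj) eq_sym (negPf ij).
  by rewrite !big1 ?addr0 // => j _; rewrite (negPf (no j)) ?mulr0.
rewrite big_seq (eq_bigr _ uE) -big_seq exchange_big /=.
transitivity (\prod_(j < f) s j).
  apply: eq_bigr => j _; rewrite (bigD1_seq (s j)) //= eqxx big1 ?mulr1 // => t.
  by move/negPf->.
by rewrite /s -expr_sum /w mE mulKn.
Qed.

End CharTwo.

(** * Primes modulo which 2 is not a cube *)

(** By Euler's theorem the odd part of N0 divides 4^f - 1, where f is its
    totient. *)
Lemma exists_modulus (N0 : nat) : (0 < N0)%N ->
  exists e f : nat, (0 < f)%N /\ (N0 %| 2 ^ e.+1 * (4 ^ f).-1)%N.
Proof.
move=> N0_gt0; pose m0 := (N0`_2^')%N.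
have m0_odd : coprime 4 m0.
  rewrite -[4%N]/(2 ^ 2)%N coprimeXl // prime_coprime // -p'natE //.
  exact: part_pnat.
exists (logn 2 N0), (totient m0); split; first by rewrite totient_gt0 part_gt0.
rewrite -[X in (X %| _)%N](partnC 2%N N0_gt0) p_part; apply: dvdn_mul.
  by rewrite dvdn_exp2l.
rewrite -subn1 -eqn_mod_dvd ?expn_gt0 //; apply/eqP.
exact: Euler_exp_totient.
Qed.

Lemma modn3_cases (p : nat) : (0 < p)%N -> ~~ (3 %| p)%N ->
  (p %% 3)%N = 2%N \/ (3 %| p.-1)%N.
Proof. lia. Qed.

Section NonCubeCase.
Variables (e f n : nat) (C : 'M[int]_n.+1).
Let m := (4 ^ f).-1.
Let N := (2 ^ e.+1 * m)%N.
Hypotheses (f_gt0 : (0 < f)%N) (CN : cyclotomic_mx C N).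
Hypothesis C2 : forall R : comNzRingType, 2 \in [pchar R] ->
  pZto R (char_poly C) = pZto R 'Phi_m ^+ (2 ^ e).

Let m_gt2 : (2 < m)%N.
Proof. by rewrite /m; have := leq_pexp2l (isT : 0 < 4)%N f_gt0; lia. Qed.

Let N_gt1 : (1 < N)%N.
Proof. by apply: leq_trans (ltnW m_gt2) _; rewrite leq_pmull // expn_gt0. Qed.

(** In characteristic 2 the eigenvalues of C are the roots of Phi_m, each of
    them repeated 2^e times. *)
Lemma exists_norm_nontrivial : exists (E : closedFieldType) (w : E) (g : {poly {poly int}}),
  [/\ 2 \in [pchar E], w ^+ 2 + w + 1 = 0 &
      matnorm C (1 - map_poly (ev w) g) = w ^+ (2 ^ e)].
Proof.
have [E E2] := closed_field_pchar (isT : prime 2).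
have [w [g [w2 gP]]] := exists_norm_cubert1 E2 f_gt0.
exists E, w, g; split=> //.
have [rs defPhi] : exists rs, pZto E 'Phi_m = \prod_(r <- rs) ('X - r%:P).
  have [rs def] := closed_field_poly_normal (pZto E 'Phi_m); exists rs.
  rewrite [LHS]def (monicP _) ?scale1r //.
  by rewrite monic_map // Cyclotomic_monic.
rewrite (@matnorm_prod _ _ _ (flatten (nseq (2 ^ e) rs))); last first.
  rewrite C2 // defPhi big_flatten /=; elim: (2 ^ e)%N => [|k IH].
    by rewrite big_nil expr0.
  by rewrite exprS IH /= big_cons.
rewrite big_flatten /= -[in RHS](gP rs defPhi); elim: (2 ^ e)%N => [|k IH].
  by rewrite big_nil expr0.
by rewrite exprS -IH big_cons.
Qed.

Let pdiff (g : {poly {poly int}}) (c : 'I_N) := g - (g \Po 'X^c).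

Lemma pdiff_horner (F : fieldType) (w r : F) g (c : 'I_N) :
  (map_poly (ev w) (pdiff g c)).[r] =
  (map_poly (ev w) g).[r] - (map_poly (ev w) g).[r ^+ c].
Proof.
rewrite /pdiff rmorphB /= map_comp_poly map_polyXn hornerD hornerN.
by rewrite horner_comp hornerXn.
Qed.

(** The term 2 k X does not change g0 modulo 2. For all but finitely many k it
    makes the values at r and at r^c distinct, whatever the eigenvalue r of C.
    *)
Lemma exists_separating_shift (w : algC) (g0 : {poly {poly int}}) :
  exists k : nat, forall c : 'I_N, c != 1%N :> nat ->
    ev w (matnorm C (pdiff (g0 + (2 * k)%:R *: 'X) c)) != 0.
Proof.
have [rs defQ] := char_poly_split C algC.
have prim z : z \in rs -> N.-primitive_root z.
  move=> z_rs; apply: CN; rewrite ?pnatr_eq0 -?lt0n ?(ltnW N_gt1) //.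
  by rewrite defQ root_prod_XsubC.
pose h z := (map_poly (ev w) g0).[z].
pose q : {poly algC} := \prod_(c : 'I_N | c != 1%N :> nat) \prod_(z <- rs)
  ((h z - h (z ^+ c))%:P + (2 * (z - z ^+ c)) *: 'X).
have [|k _ qk] := @exists_nat_nonroot _ q 0.
  apply/prodf_neq0=> c c1; rewrite prodf_seq_neq0; apply/allP=> z /prim zN /=.
  apply/eqP=> /(congr1 (fun p : {poly algC} => p`_1)).
  rewrite coefD coefC coefZ coefX mulr1 add0r coef0 => /eqP.
  rewrite mulf_eq0 pnatr_eq0 /= subr_eq0 -{1}[z]expr1 (eq_prim_root_expr zN).
  by rewrite !modn_small // eq_sym (negPf c1).
exists k => c c1.
rewrite matnorm_map (matnorm_prod _ defQ).
move: qk; rewrite horner_prod => /prodf_neq0/(_ c c1).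
rewrite horner_prod !prodf_seq_neq0; apply: sub_all => z /=.
rewrite pdiff_horner [map_poly _ _]rmorphD /= map_polyZ map_polyX rmorph_nat.
rewrite !(hornerD, hornerZ, hornerX, hornerC) -/(h z) -/(h (z ^+ c)) natrM.
by apply: contraNneq => <-; apply/eqP; ring.
Qed.

(** Let a + b w be the norm of 1 - l g, where w is a primitive cube root of
    unity, l is odd and divisible by 3, and g is congruent modulo 2 to the g0
    of exists_norm_nontrivial. Then 3 divides b, because the norm is 1 modulo
    l, and b is odd, because modulo 2 the norm is a primitive cube root of
    unity. Let p be a prime divisor of the norm of a + b w. If p = 1 modulo 3,
    there are cube and N-th roots of unity w and r in characteristic p with l
    g(r) = 1. The Frobenius map fixes w, so that l g(r^p) = 1, and as p does
    not divide the norms of exists_separating_shift, by the choice of l, this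
    forces p = 1 modulo N. If 2 were a cube modulo p for all large p of this
    kind, all of them would be of the form x^2 + 27 y^2 by cube_mod_norm_form,
    and eisen_norm_descent would show that b is even. *)
Lemma primes_not_all_cube (M : nat) :
  ~ (forall p : nat, prime p -> (M < p)%N -> (N %| p.-1)%N -> cube_mod 2 p).
Proof.
move=> all_cube; have N_gt0 := ltnW N_gt1.
have [om om3] := C_prim_root_exists (isT : (0 < 3)%N); have om2 := cubert1_prim om3.
have [E2 [w2 [g0 [E2_2 w2E normg0]]]] := exists_norm_nontrivial.
have [k kP] := exists_separating_shift om g0; set g := g0 + _ in kP.
pose D := \prod_(c : 'I_N | c != 1%N :> nat) matnorm C (pdiff g c).
have [d1 [d2 DE]] := ev_eisenstein D.
have D0 : eisen_norm d1 d2 != 0.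
  apply/negP=> /eqP /eisen_norm_eq0[d10 d20].
  have /eqP : ev om D = 0 by rewrite DE // d10 d20 mul0r addr0.
  by rewrite rmorph_prod; apply/negP/prodf_neq0.
(* Prime divisors of T other than 2 are going to divide l, hence not the norm. *)
pose T : nat := (3 * N * M`! * `|eisen_norm d1 d2|)%N.
have T_gt0 : (0 < T)%N.
  by rewrite muln_gt0 absz_gt0 D0 andbT muln_gt0 fact_gt0 andbT muln_gt0.
have [T3 TN TM TD] : [/\ (3 %| T)%N, (N %| T)%N, (M`! %| T)%N & (`|eisen_norm d1 d2| %| T)%N].
  rewrite /T; split; [exact/dvdn_mulr/dvdn_mulr/dvdn_mulr
    | exact/dvdn_mulr/dvdn_mulr/dvdn_mull | exact/dvdn_mulr/dvdn_mull | exact/dvdn_mull].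
clearbody T; pose l := (T`_2^')%N.
have l_odd : odd l by rewrite -[odd l]negbK -dvdn2 -p'natE //; exact: part_pnat.
have prime_l p : prime p -> odd p -> (p %| T)%N -> (p %| l)%N.
  move=> p_pr p_odd; rewrite -[X in (_ %| X)%N](partnC 2%N T_gt0) p_part.
  rewrite Euclid_dvdM // Euclid_dvdX // => /orP[/andP[]|//].
  by rewrite dvdn_prime2 // => /eqP p2; rewrite p2 in p_odd.
have l3 : (3 %| l)%N by apply: prime_l.
clearbody l.
have [gam betaE] := @matnorm1D _ C _ (- l%:R) g.
set beta := matnorm C _ in betaE.
have [a0 [b0 gamE]] := ev_eisenstein gam.
pose a : int := 1 - l%:Z * a0; pose b : int := - (l%:Z * b0).
have betaab (R : comNzRingType) (w : R) : w ^+ 2 + w + 1 = 0 ->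
    ev w beta = a%:~R + b%:~R * w.
  move=> w2'; rewrite betaE rmorphD rmorph1 rmorphM rmorphN rmorph_nat /= gamE //.
  by rewrite /a /b rmorphB rmorphN !rmorphM rmorph1 /= -pmulrn; ring.
have beta_norm (R : comNzRingType) (w : R) :
    ev w beta = matnorm C (1 - l%:R *: map_poly (ev w) g).
  rewrite /beta matnorm_map rmorphD rmorph1 /= map_polyZ rmorphN rmorph_nat.
  by rewrite scaleNr.
have b3 : (3 %| b)%Z by rewrite /b rpredN dvdz_mulr.
have b_odd : ~~ (2 %| b)%Z.
  apply/negP=> b2; have := betaab _ _ w2E; rewrite beta_norm.
  move: (b2); rewrite (dvdz_pcharf E2_2) => /eqP->; rewrite mul0r addr0.
  have -> : l%:R = 1 :> E2 by rewrite -(natr_mod_pchar _ E2_2) modn2 l_odd.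
  have -> : map_poly (ev w2) g = map_poly (ev w2) g0.
    rewrite /g rmorphD /= map_polyZ rmorph_nat natrM (pcharf0 E2_2) mul0r scale0r.
    by rewrite addr0.
  rewrite scale1r normg0 => wa.
  have w_unit : w2 ^+ (2 ^ e) != 0.
    rewrite expf_neq0 //; apply: contra_eq_neq w2E => ->.
    by rewrite expr0n !add0r oner_eq0.
  have : w2 ^+ (2 ^ e) = 1.
    apply: (mulfI w_unit); rewrite mulr1 -expr2 wa.
    by rewrite -(pFrobenius_autE E2_2) pFrobenius_aut_int.
  elim: (e) => [|i IH].
    rewrite expr1 => w1; move: w2E; rewrite w1 expr1n -(natrD _ 1 1) -(natrD _ 2 1).
    by rewrite -(natr_mod_pchar _ E2_2) => /eqP; rewrite oner_eq0.
  rewrite expnSr exprM => /eqP; rewrite -subr_eq0 -{1}(expr1n _ 2) -!(pFrobenius_autE E2_2).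
  rewrite -pFrobenius_autB_comm; last exact: mulrC.
  by rewrite pFrobenius_autE expf_eq0 subr_eq0 => /eqP.
apply: (negP b_odd); apply: (@eisen_norm_descent a) => // p p_pr pn.
have [E Ep] := closed_field_pchar p_pr.
have p_odd : odd p.
  have [p2|//] := even_prime p_pr.
  by case/negP: b_odd; have [] := eisen_norm_inert p_pr (congr1 (modn^~ 3) p2) pn; rewrite p2.
have nE0 : (eisen_norm a b)%:~R = 0 :> E by apply/eqP; rewrite (intr_pchar_eq0 _ Ep).
have pl : ~~ (p %| l)%N.
  rewrite (dvdn_pcharf Ep); apply/negP=> /eqP l0; move/eqP: nE0; apply/negP.
  rewrite /eisen_norm /a /b !(rmorphXn, rmorphN, rmorphD, rmorphM) /= rmorph1 -pmulrn l0.
  by rewrite !mul0r oppr0 addr0 !mul1r oppr0 addr0 expr0n addr0 expr1n oner_eq0.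
have pT : ~~ (p %| T)%N by apply: contra pl; apply: prime_l.
have p_neq3 : p != 3 by apply: contraNneq pT => ->.
have [p2|p1] : (p %% 3)%N = 2%N \/ (3 %| p.-1)%N.
  by apply: modn3_cases; rewrite ?prime_gt0 // dvdn_prime2 // eq_sym.
  by left.
right; apply: cube_mod_norm_form => //; apply: all_cube => //.
  rewrite ltnNge; apply: contra pT => pM; apply: dvdn_trans TM.
  by rewrite dvdn_fact // prime_gt0.
have mE := dvdp_pchar_neq0 Ep pT.
have [w w2' bw] : exists2 w : E, w ^+ 2 + w + 1 = 0 & ev w beta = 0.
  have [w0 w0r] : exists w0, root ('X^2 + 'X + 1 : {poly E}) w0.
    apply/closed_rootP; rewrite -addrA size_polyDl ?size_polyXn //.
    by rewrite size_XaddC.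
  have {w0r} w0E : w0 ^+ 2 + w0 + 1 = 0 by move/rootP: w0r; rewrite !hornerE.
  move/eqP: nE0; rewrite (eisen_norm_factor _ _ w0E) mulf_eq0 => /orP[]/eqP w0b.
    by exists w0; rewrite // betaab.
  have w0E' : (w0 ^+ 2) ^+ 2 + w0 ^+ 2 + 1 = 0.
    transitivity ((w0 ^+ 2 + w0 + 1) * (w0 ^+ 2 - w0 + 1)); first by ring.
    by rewrite w0E mul0r.
  by exists (w0 ^+ 2); rewrite // betaab.
have [r rQ gr] : exists2 r, root (pZto E (char_poly C)) r & l%:R * (map_poly (ev w) g).[r] = 1.
  move: bw; rewrite beta_norm => /matnorm_eq0[r rQ /eqP]; rewrite hornerD hornerN hornerZ.
  by rewrite hornerC subr_eq0 => /eqP/esym gr; exists r.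
have rN : N.-primitive_root r by apply: CN => //; apply: mE.
have [|c1] := eqVneq (p %% N)%N 1%N.
  by rewrite -[X in _ = X](modn_small N_gt1) => /eqP; rewrite eqn_mod_dvd ?prime_gt0 // subn1.
have gr' : l%:R * (map_poly (ev w) g).[r ^+ (p %% N)] = 1.
  pose phi : {rmorphism E -> E} := pFrobenius_aut Ep.
  have phiE x : phi x = x ^+ p by exact: pFrobenius_autE.
  have phi_w : phi w = w.
    case/dvdnP: p1 => q pq; rewrite phiE -[p]prednK ?prime_gt0 // pq exprS mulnC exprM.
    by rewrite (cubert1_exp w2') expr1n mulr1.
  rewrite (prim_expr_mod rN) -phiE.
  transitivity (phi (l%:R * (map_poly (ev w) g).[r])); last by rewrite gr rmorph1.
  rewrite rmorphM rmorph_nat -horner_map -map_poly_comp; congr (_ * _.[_]).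
  apply: eq_map_poly => q /=.
  transitivity (phi (pZto E q).[w]); last by [].
  rewrite -horner_map phi_w -map_poly_comp.
  by congr (_.[_]); apply: eq_map_poly => z; rewrite /= rmorph_int.
exfalso; case/negP: pT; apply: dvdn_trans TD; rewrite -(intr_pchar_eq0 _ Ep).
rewrite (eisen_norm_factor _ _ w2') -DE // mulf_eq0 rmorph_prod /=.
apply/orP; left; apply/prodf_eq0; exists (Ordinal (ltn_pmod p N_gt0)) => //; apply/eqP.
rewrite matnorm_map; apply/matnorm_eq0; exists r => //.
rewrite pdiff_horner /=; apply/eqP; rewrite subr_eq0; apply/eqP.
have l0 : l%:R != 0 :> E by rewrite -(dvdn_pcharf Ep).
by apply: (mulfI l0); rewrite gr gr'.
Qed.

End NonCubeCase.

Lemma exists_modulus_mx (N0 : nat) : (0 < N0)%N ->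
  exists e f n (C : 'M[int]_n.+1), let N := (2 ^ e.+1 * (4 ^ f).-1)%N in
  [/\ (0 < f)%N, (N0 %| N)%N, cyclotomic_mx C N &
      forall R : comNzRingType, 2 \in [pchar R] ->
        map_poly intr (char_poly C) = map_poly intr 'Phi_(4 ^ f).-1 ^+ (2 ^ e) :> {poly R}].
Proof.
move=> N0_gt0; have [e [f [f_gt0 N0N]]] := exists_modulus N0_gt0.
have := leq_pexp2l (isT : 0 < 4)%N f_gt0; rewrite expn1 => f4.
have f4gt0 : (0 < 4 ^ f)%N by apply: leq_trans f4.
have [||n [C [CN C2]]] := @exists_cyclotomic_mx e (4 ^ f).-1.
- have : odd (4 ^ f).-1.+1 = false by rewrite prednK // oddX orbF gtn_eqF.
  by rewrite /= => /negbFE.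
- by rewrite -ltnS prednK // (leq_trans _ f4).
by exists e, f, n, C.
Qed.

Lemma exists_prime_cube_mod (N0 M : nat) : (0 < N0)%N ->
  exists p : nat, [/\ prime p, (M < p)%N, (N0 %| p.-1)%N & cube_mod 2 p].
Proof.
move=> N0_gt0; have [e [f [n [C [f_gt0 N0N CN _]]]]] := exists_modulus_mx N0_gt0.
have [||p [p_pr Mp Np p2]] := exists_prime_cube CN _ _ M.
- by rewrite predn_exp mulnCA dvdn_mulr.
- rewrite muln_gt0 expn_gt0 /= ltn_predRL.
  by rewrite -{1}(expn0 4) ltn_exp2l.
by exists p; rewrite (dvdn_trans N0N).
Qed.

Lemma exists_prime_not_cube_mod (N0 M : nat) : (0 < N0)%N ->
  exists p : nat, [/\ prime p, (M < p)%N, (N0 %| p.-1)%N & ~ cube_mod 2 p].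
Proof.
move=> N0_gt0; have [e [f [n [C [f_gt0 N0N CN C2]]]]] := exists_modulus_mx N0_gt0.
apply: contrapT => none; apply: (primes_not_all_cube f_gt0 CN C2 (M := M)).
move=> p p_pr Mp Np; apply: contrapT => p2; apply: none.
by exists p; rewrite (dvdn_trans N0N).
Qed.

(** * Coefficients of rational power series *)

Lemma poly_bounded (R : realFieldType) (h : {poly R}) :
  exists2 B, 0 <= B & forall y, 0 <= y <= 1 -> `|h.[y]| <= B.
Proof.
exists (\sum_(i < size h) `|h`_i|); first by apply: sumr_ge0 => i _.
move=> y /andP[y0 y1]; rewrite horner_coef; apply: le_trans (ler_norm_sum _ _ _) _.
apply: ler_sum => i _; rewrite normrM normrX (ger0_norm y0) ler_piMr //.
by rewrite exprn_ile1.
Qed.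

(** The constant coefficient of h is the value approached at 0, hence 0 if n >
    0; then h / X satisfies the same hypothesis for n - 1. *)
Lemma poly_small_coef (R : realFieldType) (n : nat) (h : {poly R}) (c y0 : R) :
  0 < y0 <= 1 -> (forall y, 0 < y <= y0 -> `|h.[y]| <= c * y ^+ n) ->
  forall j, (j < n)%N -> h`_j = 0.
Proof.
move=> /andP[y0_gt0 y0_le1]; elim: n h => // n IH h hle.
have [h' [c0 hE]] : exists h' c0, h = h' * 'X + c0%:P.
  by elim/poly_ind: (h) => [|h' c0 _]; [exists 0, 0; rewrite mul0r addr0|exists h', c0].
have [B B0 hB] := poly_bounded h'.
have c00 : c0 = 0.
  apply/eqP; rewrite -normr_eq0 eq_le normr_ge0 andbT leNgt; apply/negP=> c0_gt0.
  pose D := `|c| + B + 1.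
  have D_gt0 : 0 < D by rewrite /D ltr_wpDl // addr_ge0.
  pose y := Num.min y0 (`|c0| / (2 * D)).
  have y_gt0 : 0 < y by rewrite lt_min y0_gt0 divr_gt0 // mulr_gt0.
  have yy0 : y <= y0 by rewrite ge_min lexx.
  have y_le1 : y <= 1 by apply: le_trans yy0 _.
  have yD : y * D <= `|c0| / 2.
    have : y <= `|c0| / (2 * D) by rewrite ge_min lexx orbT.
    move=> /(ler_wpM2r (ltW D_gt0)) /le_trans; apply; rewrite le_eqVlt; apply/orP; left.
    by apply/eqP; field; rewrite gt_eqF.
  have := hle y; rewrite y_gt0 yy0 => /(_ isT); rewrite hE hornerMXaddC => h1.
  have h2 := hB y; rewrite (ltW y_gt0) y_le1 in h2; have {}h2 := h2 isT.
  have h3 : `|c0| <= `|h'.[y] * y + c0| + `|h'.[y] * y|.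
    by rewrite -{1}[c0](addKr (h'.[y] * y)) addrC; apply: le_trans (ler_normB _ _) _.
  have h4 : `|h'.[y] * y| <= B * y by rewrite normrM (gtr0_norm y_gt0) ler_pM2r.
  have h5 : c * y ^+ n.+1 <= `|c| * y.
    rewrite exprS mulrCA [leRHS]mulrC ler_pM2l //.
    apply: le_trans (ler_norm _) _; rewrite normrM normrX (gtr0_norm y_gt0).
    by rewrite ler_piMr // exprn_ile1 // ltW.
  have : `|c0| <= y * D by rewrite /D; nra.
  by nra.
case=> [|j] jn; first by rewrite hE c00 addr0 coefMX.
rewrite hE c00 addr0 coefMX /=; apply: IH => // y yy.
have y_gt0 : 0 < y by case/andP: yy.
have := hle y yy; rewrite hE c00 hornerMXaddC addr0 normrM (gtr0_norm y_gt0).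
by rewrite exprSr mulrA ler_pM2r.
Qed.

(** Spelled out so that the estimates below hold over any ordered field. *)
Definition tends (R : realFieldType) (u : nat -> R) (l : R) : Prop :=
  forall e, 0 < e -> exists n0, forall n, (n0 <= n)%N -> `|l - u n| < e.

Section PowerSeries.
Variables (R : realFieldType) (a : nat -> R).
Hypothesis a_ge0 : forall i, 0 <= a i.
Let S (n : nat) (y : R) := \sum_(i < n) a i * y ^+ i.

(** Since the coefficients are nonnegative, the tail at y is at most (y /
    y0)^K times the tail at y0. *)
Lemma tends_power_series_tail (l0 l y0 y : R) (K : nat) :
  0 < y <= y0 -> tends (S^~ y0) l0 -> tends (S^~ y) l ->
  `|S K y - l| <= (l0 + 1) / y0 ^+ K * y ^+ K.
Proof.
move=> /andP[y_gt0 yy0] cv0 cv.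
have y0_gt0 : 0 < y0 by apply: lt_le_trans yy0.
have S_split n z : (K <= n)%N -> S n z = S K z + \sum_(K <= i < n) a i * z ^+ i.
  by move=> Kn; rewrite /S -!(big_mkord xpredT (fun i => a i * z ^+ i)) (big_cat_nat (n := K)).
have S_ge0 n z : 0 <= z -> 0 <= S n z.
  by move=> z0; apply: sumr_ge0 => i _; rewrite mulr_ge0 // exprn_ge0.
apply/ler_addgt0Pr => eps eps_gt0.
have [n0 h0] := cv0 1 ltr01; have [n1 h1] := cv eps eps_gt0.
pose n := maxn K (maxn n0 n1).
have {}h0 := h0 n (leq_trans (leq_maxl _ _) (leq_maxr _ _)).
have {}h1 := h1 n (leq_trans (leq_maxr _ _) (leq_maxr _ _)).
have Kn : (K <= n)%N by apply: leq_maxl.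
have tail : S n y - S K y <= (l0 + 1) / y0 ^+ K * y ^+ K.
  rewrite S_split // addrAC subrr add0r.
  apply: (@le_trans _ _ ((\sum_(K <= i < n) a i * y0 ^+ i) / y0 ^+ K * y ^+ K)).
    rewrite !mulr_suml big_nat [leRHS]big_nat; apply: ler_sum => i /andP[Ki _].
    have eX z : z ^+ i = z ^+ (i - K) * z ^+ K :> R by rewrite -exprD subnK.
    rewrite !eX -!mulrA mulVKf; last by rewrite expf_neq0 // gt_eqF.
    rewrite ler_wpM2l // ler_wpM2r ?exprn_ge0 ?(ltW y_gt0) //.
    by rewrite lerXn2r ?nnegrE ?(ltW y_gt0) ?(ltW y0_gt0).
  rewrite ler_wpM2r ?exprn_ge0 ?(ltW y_gt0) // ler_wpM2r ?invr_ge0 ?exprn_ge0 ?(ltW y0_gt0) //.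
  have := S_split n y0 Kn; have := S_ge0 K y0 (ltW y0_gt0).
  move: h0; rewrite ltr_norml => /andP[]; lra.
have tail0 : 0 <= S n y - S K y.
  rewrite S_split // addrAC subrr add0r; apply: sumr_ge0 => i _.
  by rewrite mulr_ge0 // exprn_ge0 // ltW.
move: h1; rewrite ltr_norml ler_norml => /andP[h1 h2]; apply/andP; split; lra.
Qed.

(** Replacing the power series by its partial sum of length k + 1 introduces
    an error O(y^(k+1)), which does not affect the coefficient of index k. *)
Lemma power_series_rational (q p : {poly R}) (eps : R) : 0 < eps ->
  (forall y, 0 < y < eps -> exists2 l, tends (S^~ y) l & l * q.[y] = p.[y]) ->
  forall k, \sum_(i < k.+1) a i * q`_(k - i) = p`_k.
Proof.
move=> eps_gt0 h k; pose y0 := Num.min 1 (eps / 2).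
have y0_gt0 : 0 < y0 by rewrite lt_min ltr01 divr_gt0.
have y0_le1 : y0 <= 1 by rewrite ge_min lexx.
have y0_lt : y0 < eps by rewrite gt_min; apply/orP; right; lra.
have [|l0 cv0 _] := h y0; first by rewrite y0_gt0.
have [B B0 hB] := poly_bounded q.
pose A := \poly_(i < k.+1) a i.
have AE y : A.[y] = S k.+1 y by rewrite horner_poly.
suff : (A * q - p)`_k = 0.
  rewrite coefB coefM => /eqP; rewrite subr_eq0 => /eqP <-.
  by apply: eq_bigr => i _; rewrite coef_poly ltn_ord.
apply: (@poly_small_coef _ k.+1 _ ((l0 + 1) / y0 ^+ k.+1 * B) y0); rewrite ?y0_gt0 // => y yy.
have /andP[y_gt0 yy0] := yy.
have [|l cv lq] := h y; first by rewrite y_gt0 (le_lt_trans yy0).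
rewrite hornerD hornerN hornerM AE -lq -mulrBl normrM mulrAC.
apply: ler_pM; rewrite ?normr_ge0 ?(tends_power_series_tail _ yy cv0) //.
by apply: hB; rewrite (ltW y_gt0) (le_trans yy0).
Qed.

End PowerSeries.

(** * Coefficients of a zeta function that is RFORC *)

Section Evaluation.
Variable R : realType.
Local Notation C := R[i].

Lemma cpow_real (p : nat) (s : R) (i : nat) : (0 < p)%N ->
  cpow p%:R (- (i%:R * (s%:C)%C)) = ((expR (- s * ln p%:R) ^+ i)%:C)%C.
Proof.
move=> p_gt0.
have -> : - (i%:R * (s%:C)%C) = ((- (i%:R * s))%:C)%C :> C.
  by rewrite -(rmorph_nat (real_complex R)) -rmorphM -rmorphN.
rewrite /cpow /= mul0r cos0 sin0 mulr1 mulr0; congr (_ +i* _)%C.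
by rewrite -expRM_natl mulrA mulrN mulNr.
Qed.

(** The polynomial P(p, Y): the outer variable of P is X. *)
Definition eval_left (p : nat) (P : {poly {poly rat}}) : {poly R} :=
  (map_poly (map_poly ratr) P).[p%:R%:P].

Lemma coef_eval_left p P j : (eval_left p P)`_j = ratr ((swapXY P)`_j).[p%:R].
Proof.
rewrite /eval_left (@horner_coef_wide _ (size P)) ?coef_sum; last exact: size_poly.
have -> : ratr ((swapXY P)`_j).[p%:R] = (map_poly (@ratr R) (swapXY P)`_j).[p%:R].
  by rewrite -horner_map rmorph_nat.
have szj : (size (map_poly (@ratr R) (swapXY P)`_j) <= size P)%N.
  rewrite size_map_poly; apply/leq_sizeP=> i Pi.
  by rewrite coef_swapXY (nth_default 0 Pi) coef0.
rewrite (horner_coef_wide _ szj); apply: eq_bigr => i _.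
by rewrite -polyC_exp coefMC !coef_map /= coef_swapXY.
Qed.

Lemma poly2_eval_real p P (y : R) :
  poly2_eval P (p%:R : C) (y%:C)%C = (((eval_left p P).[y])%:C)%C.
Proof.
rewrite /poly2_eval /eval_left -[RHS](horner_map (real_complex R)) /=; congr (_.[_]).
rewrite -[RHS]horner_map /= map_polyC /= -map_poly_comp.
congr (_.[_]); last by rewrite !rmorph_nat.
apply: eq_map_poly => q /=; rewrite -map_poly_comp.
by apply: eq_map_poly => x; rewrite /= fmorph_rat.
Qed.

Variables (G : groupType) (p : nat).
Hypothesis p_pr : prime p.
Let a i : R := (nb_normal_subgroups G (p ^ i))%:R.

Lemma series_real (s : R) (n : nat) :
  series (normal_zeta_term G p (s%:C)%C) n =
  ((\sum_(i < n) a i * expR (- s * ln p%:R) ^+ i)%:C)%C.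
Proof.
rewrite /series /= big_mkord rmorph_sum; apply: eq_bigr => i _.
by rewrite /normal_zeta_term cpow_real ?prime_gt0 // rmorphM rmorph_nat.
Qed.

Lemma normal_zeta_tends (s : R) : normal_zeta_cvg G p (s%:C)%C ->
  tends (fun n => \sum_(i < n) a i * expR (- s * ln p%:R) ^+ i)
    (complex.Re (normal_zeta G p (s%:C)%C)).
Proof.
move=> cv e e_gt0.
have e_gt0' : 0 < (e%:C)%C :> C by rewrite ltcR.
have /cvgrPdist_lt /(_ _ e_gt0') [n0 _ h] := cv.
exists n0 => n n0n; have := h n n0n; rewrite /= series_real -/(normal_zeta G p _).
move: (normal_zeta _ _ _) (\sum_(i < n) _) => v u hv.
rewrite -ltcR; apply: le_lt_trans hv; rewrite (le_trans _ (normc_ge_Re _)) //.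
by rewrite lecR; case: v.
Qed.

(** For real s > alpha the number y = p^(-s) runs over an interval 0 < y <
    eps. *)
Lemma local_zeta_value (W : {fraction {poly {poly rat}}}) (alpha : R) :
  (forall s : C, alpha < complex.Re s -> normal_zeta_cvg G p s /\
     ratfun_value W p%:R (cpow p%:R (- s)) (normal_zeta G p s)) ->
  exists2 eps : R, 0 < eps & forall y, 0 < y < eps ->
    exists l, tends (fun n => \sum_(i < n) a i * y ^+ i) l /\
    exists P Q, [/\ W = tofrac P / tofrac Q, (eval_left p Q).[y] != 0 &
      l * (eval_left p Q).[y] = (eval_left p P).[y]].
Proof.
have lnp_gt0 : 0 < ln (p%:R : R) by rewrite ln_gt0 // ltr1n prime_gt1.
move=> h; exists (expR (- alpha * ln p%:R)); first exact: expR_gt0.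
move=> y /andP[y_gt0 y_lt]; pose s := - ln y / ln p%:R.
have yE : expR (- s * ln p%:R) = y.
  have -> : - s * ln p%:R = ln y by rewrite /s; field; rewrite gt_eqF.
  exact: lnK.
have s_gt : alpha < s.
  move: y_lt; rewrite -yE ltr_expR ltr_pM2r // ltrN2 //.
have [cv [P [Q [WE Q0 vE]]]] := h (s%:C)%C s_gt.
have cE : cpow p%:R (- (s%:C)%C) = (y%:C)%C :> C.
  by have := cpow_real s 1 (prime_gt0 p_pr); rewrite mul1r expr1 yE.
rewrite cE poly2_eval_real in Q0.
rewrite cE !poly2_eval_real -fmorph_div in vE.
exists (complex.Re (normal_zeta G p (s%:C)%C)); split.
  by have := normal_zeta_tends cv; rewrite yE.
have Q0' : (eval_left p Q).[y] != 0 by rewrite -(fmorph_eq0 (real_complex R)).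
by exists P, Q; split=> //; rewrite vE /= divfK.
Qed.
End Evaluation.

Lemma tofrac_cross (A : idomainType) (P Q P' Q' : A) : Q != 0 -> Q' != 0 ->
  tofrac P / tofrac Q = tofrac P' / tofrac Q' -> P * Q' = P' * Q.
Proof.
move=> Q0 Q'0 /eqP; rewrite eqr_div ?tofrac_eq0 // -!rmorphM tofrac_eq.
by move/eqP.
Qed.

(** The a i are determined recursively from their convolution with the b i,
    and each step of the recursion divides once by b 0. *)
Lemma series_coef_cleared (b c : nat -> {poly rat}) (k : nat) :
  exists A : {poly rat}, forall (x : rat) (a : nat -> rat),
    (forall j, \sum_(i < j.+1) a i * (b (j - i)%N).[x] = (c j).[x]) ->
    (b 0%N).[x] ^+ k.+1 * a k = A.[x].
Proof.
elim/ltn_ind: k => k IH.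
have /fin_all_exists[A AE] (i : 'I_k) := IH i (ltn_ord i).
exists (b 0%N ^+ k * c k - \sum_(i < k) b 0%N ^+ (k - i.+1) * b (k - i)%N * A i).
move=> x a h; rewrite hornerD hornerN hornerM horner_exp horner_sum -h.
rewrite big_ord_recr /= subnn mulrDr addrAC mulr_sumr.
rewrite [X in X - _](eq_bigr (fun i : 'I_k =>
    (b 0%N ^+ (k - i.+1) * b (k - i)%N * A i).[x])) => [|i _].
  by rewrite subrr add0r exprSr mulrA mulrAC.
rewrite !hornerM horner_exp -(AE i x a h).
have {1}-> : k = (k - i.+1 + i.+1)%N by rewrite subnK.
by rewrite exprD; ring.
Qed.

(** Only the residue class of 1 modulo N is used. The numerator and
    denominator representing W_1 may depend on s, but they are proportional to
    a fixed pair P0, Q0, so that the power series in Y with coefficients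
    a_{p^i} times Q0(p, Y) is P0(p, Y). Comparing coefficients gives a
    recursion for the a_{p^i}; it starts at the lowest nonzero coefficient of
    Q0 with respect to Y, which is a polynomial in p. *)
Lemma RFORC_coef (R : realType) (G : groupType) (k : nat) : normal_zeta_RFORC R G ->
  exists (N : nat) (q A : {poly rat}), [/\ (0 < N)%N, q != 0 &
    forall p, prime p -> (N %| p.-1)%N ->
      q.[p%:R] * (nb_normal_subgroups G (p ^ k))%:R = A.[p%:R]].
Proof.
case=> N [W [N_gt0 h]].
have local p : prime p -> (N %| p.-1)%N -> exists2 eps : R, 0 < eps & forall y, 0 < y < eps ->
    exists l, tends (fun n => \sum_(i < n) (nb_normal_subgroups G (p ^ i))%:R * y ^+ i) l /\
    exists P Q, [/\ W 1%N = tofrac P / tofrac Q, (eval_left R p Q).[y] != 0 &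
      l * (eval_left R p Q).[y] = (eval_left R p P).[y]].
  move=> p_pr pN; have [|alpha] := h p 1%N p_pr N_gt0; last exact: local_zeta_value.
  by apply/eqP; rewrite eqn_mod_dvd ?prime_gt0 // subn1.
have [P0 [Q0 [W0 Q00]]] : exists P Q, W 1%N = tofrac P / tofrac Q /\ Q != 0.
  have [p [p_pr _ pN _]] := exists_prime_cube_mod 0 N_gt0.
  have [eps eps_gt0 /(_ (eps / 2))[]] := local p p_pr pN; first by apply/andP; split; lra.
  move=> l [_ [P [Q [WE Q0 _]]]]; exists P, Q; split=> //; apply: contraNneq Q0 => ->.
  by rewrite /eval_left rmorph0 !horner0.
pose B := swapXY Q0; have B_neq0 : B != 0 by rewrite swapXY_eq0.
have [j0 Bj0 Bj_lt] : exists2 j0, B`_j0 != 0 & forall j, (j < j0)%N -> B`_j = 0.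
  have ex : exists j, B`_j != 0 by exists (size B).-1; rewrite -/(lead_coef B) lead_coef_eq0.
  exists (ex_minn ex); case: ex_minnP => // j _ jmin i ij; apply/eqP/contraT => /jmin.
  by rewrite leqNgt ij.
have [A AE] := series_coef_cleared (fun j => B`_(j0 + j)) (fun j => (swapXY P0)`_(j0 + j)) k.
exists N, (B`_(j0 + 0) ^+ k.+1), A; split; rewrite ?expf_neq0 ?addn0 // => p p_pr pN.
rewrite -(AE p%:R (fun i => (nb_normal_subgroups G (p ^ i))%:R)) ?addn0 ?horner_exp // => j.
have [eps eps_gt0 hy] := local p p_pr pN.
have evM (P Q : {poly {poly rat}}) : eval_left R p (P * Q) = eval_left R p P * eval_left R p Q.
  by rewrite /eval_left rmorphM /= hornerM.
have coefs : forall i, \sum_(l < i.+1) (nb_normal_subgroups G (p ^ l))%:R * (B`_(i - l)%N).[p%:R] =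
    ((swapXY P0)`_i).[p%:R].
  move=> i; apply: (fmorph_inj (@ratr R)).
  rewrite rmorph_sum /= -coef_eval_left.
  rewrite -(power_series_rational _ eps_gt0 (q := eval_left R p Q0)
     (a := fun i => (nb_normal_subgroups G (p ^ i))%:R)) //.
    by apply: eq_bigr => l _; rewrite rmorphM /= ratr_nat coef_eval_left.
  move=> y /hy[l [cv [P [Q [WE Qy lE]]]]]; exists l => //.
  have Q_neq0 : Q != 0.
    by apply: contraNneq Qy => ->; rewrite /eval_left rmorph0 !horner0.
  apply: (mulIf Qy); rewrite mulrAC lE -!(hornerM (eval_left R p _)) -!evM.
  by rewrite (tofrac_cross Q_neq0 Q00 (etrans (esym WE) W0)).
have := coefs (j0 + j)%N; rewrite -addnS -(big_mkord xpredT (fun l =>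
    (nb_normal_subgroups G (p ^ l))%:R * (B`_(j0 + j - l)%N).[p%:R])).
rewrite addnC (big_cat_nat (n := j.+1)) ?leq_addr //= [X in _ + X]big_nat [X in _ + X]big1 ?addr0 => [<-|i].
  by rewrite big_mkord; apply: eq_bigr => l _; rewrite addnBA // -ltnS.
case/andP=> ji ij; rewrite Bj_lt ?horner0 ?mulr0 //; lia.
Qed.

(** * Coordinates on the group *)

Section BasisCoordinates.
Variables (V : zmodType) (I : finType) (b : I -> V).
Hypothesis bB : Z_basis b.

Definition basis_coord (v : V) : {ffun I -> int} := projT1 (cid (bB v)).

Lemma basis_coordK v : v = \sum_i b i *~ basis_coord v i.
Proof. by rewrite /basis_coord; case: cid => c []. Qed.

Lemma basis_coord_unique v (c : I -> int) :
  v = \sum_i b i *~ c i -> forall i, basis_coord v i = c i.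
Proof.
move=> vc i; rewrite /basis_coord; case: cid => c0 [_ /= uniq].
rewrite (uniq [ffun i => c i]) ?ffunE // vc.
by apply: eq_bigr => j _; rewrite ffunE.
Qed.

Lemma basis_coordB i : zmod_morphism (fun v => basis_coord v i).
Proof.
move=> u v; rewrite (basis_coord_unique (c := fun i => basis_coord u i - basis_coord v i)) //.
rewrite {1}[u]basis_coordK {1}[v]basis_coordK -sumrB.
by apply: eq_bigr => j _; rewrite mulrzBr.
Qed.

Lemma basis_coord_basis i j : basis_coord (b i) j = (i == j).
Proof.
apply: (basis_coord_unique (c := fun j => (i == j)%:Z)).
rewrite (bigD1 i) //= eqxx mulr1z big1 ?addr0 // => k ki.
by rewrite eq_sym (negPf ki) mulr0z.
Qed.

Lemma basis_coord_inj u v : basis_coord u =1 basis_coord v -> u = v.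
Proof. by move=> uv; rewrite [u]basis_coordK [v]basis_coordK; apply: eq_bigr => i _; rewrite uv. Qed.
End BasisCoordinates.

Section ClassTwo.
Variables (G : groupType) (hG : T2_group G).
Local Open Scope group_scope.
Implicit Types g h k : G.

Lemma commg_central g h k : [~ g, h] * k = k * [~ g, h].
Proof. exact: (derived_central hG) (derivedR g h). Qed.

Lemma commMg2 g h k : [~ g * h, k] = [~ g, k] * [~ h, k].
Proof.
rewrite commgEl conjMg invgM -mulgA (mulgA g^-1) -commgEl mulgA.
by rewrite -(commg_central g k h^-1) -mulgA -commgEl.
Qed.

End ClassTwo.

Section LieBracket.
Local Open Scope quotient_scope.
Variables (G : groupType) (hG : T2_group G).
Local Notation L := (lie_ring hG).
Local Notation D := (derived_module hG).

Lemma lie_ringP (u : L) : exists (g : G) (d : D), u = (\pi g, d).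
Proof. by case: u => v d; have [g ->] := abel_piP v; exists g, d. Qed.

Lemma lie_bracketDl (v : L) : {morph (fun u => lie_bracket u v) : u u' / u + u'}.
Proof.
have [k [d ->]] := lie_ringP v.
move=> u u'; have [g [d1 ->]] := lie_ringP u; have [h [d2 ->]] := lie_ringP u'.
have -> : ((\pi g, d1) : L) + (\pi h, d2) = (\pi_(abelianization G) (g * h)%g, d1 + d2).
  by congr (_, _); exact: abel_addE.
rewrite !lie_bracketE; congr (_, _); first by rewrite addr0.
by apply: val_inj; rewrite /= (commMg2 hG).
Qed.

Lemma lie_bracketN (u v : L) : lie_bracket u v = - lie_bracket v u.
Proof.
have [g [d ->]] := lie_ringP u; have [h [d' ->]] := lie_ringP v.
rewrite !lie_bracketE; congr (_, _); first by rewrite oppr0.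
by apply: val_inj; rewrite /= invgR.
Qed.

Lemma lie_bracketBl (v : L) : zmod_morphism (fun u => lie_bracket u v).
Proof.
move=> u u'; apply/eqP; rewrite eq_sym subr_eq -lie_bracketDl subrK //.
Qed.

Lemma lie_bracketBr (u : L) : zmod_morphism (fun v => lie_bracket u v).
Proof. by move=> v v'; rewrite !(lie_bracketN u) lie_bracketBl opprB opprK addrC. Qed.
End LieBracket.

(** Half of the commutator form: the coordinates of a bracket with respect to
    y_1 and y_2 are obtained from form0 and form1 by antisymmetrization. *)
Definition form0 (u v : nat -> int) : int :=
  u 0%N * v 3%N + u 1%N * v 4%N + u 2%N * v 5%N.
Definition form1 (u v : nat -> int) : int :=
  u 0%N * v 4%N + u 1%N * v 5%N + 2 * u 2%N * v 3%N.

(** Here a g lists the coordinates of the class of g in G/G', and b g those of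
    g itself when g lies in G'. *)
Record coordinates (G : groupType) (a b : G -> nat -> int) : Prop := Coordinates {
  coordM : forall g h k, a (g * h)%g k = a g k + a h k;
  coord_surj : forall c : nat -> int, exists g, forall k, (k < 6)%N -> a g k = c k;
  coord_derived : forall g, derived g <-> forall k, (k < 6)%N -> a g k = 0;
  coord_derivedM : forall g h k, derived g -> derived h -> b (g * h)%g k = b g k + b h k;
  coord_derived_inj : forall g, derived g -> b g 0%N = 0 -> b g 1%N = 0 -> g = 1%g;
  coord_derived_surj : forall m n : int, exists g, [/\ derived g, b g 0%N = m & b g 1%N = n];
  coord_comm0 : forall g h, b [~ g, h]%g 0%N = form0 (a g) (a h) - form0 (a h) (a g);
  coord_comm1 : forall g h, b [~ g, h]%g 1%N = form1 (a g) (a h) - form1 (a h) (a g) }.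

Lemma sum_ord_inord (V : nmodType) (n : nat) (F : 'I_n.+1 -> V) :
  \sum_(i < n.+1) F i = \sum_(0 <= k < n.+1) F (inord k).
Proof. by rewrite big_mkord; apply: eq_bigr => i _; rewrite inord_val. Qed.

Section Presentation.
Local Open Scope quotient_scope.
Variables (G : groupType) (hG : T2_group G).
Local Notation L := (lie_ring hG).
Variables (x : 'I_6 -> L) (y : 'I_2 -> L).
Let basis (k : 'I_6 + 'I_2) : L := match k with inl i => x i | inr j => y j end.
Hypothesis xyB : Z_basis basis.
Hypothesis xx : forall i j, lie_bracket (x i) (x j) = relation_matrix y i j.
Hypothesis xy : forall i j, lie_bracket (x i) (y j) = 0.
Hypothesis yx : forall i j, lie_bracket (y i) (x j) = 0.
Hypothesis yy : forall i j, lie_bracket (y i) (y j) = 0.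

Let cd (v : L) k : int := basis_coord xyB v k.

Let cdD k : {morph (fun v => cd v k) : u v / u + v}.
Proof.
pose f : {additive L -> int} := HB.pack (fun v => cd v k)
  (GRing.isZmodMorphism.Build L int _ (basis_coordB xyB k)).
exact: (raddfD f).
Qed.

Lemma coord_bracket (f : L -> int) (u v : L) : zmod_morphism f ->
  f (lie_bracket u v) =
  f (y ord0) * (form0 (fun k => cd u (inl (inord k))) (fun k => cd v (inl (inord k)))
    - form0 (fun k => cd v (inl (inord k))) (fun k => cd u (inl (inord k)))) +
  f (y ord_max) * (form1 (fun k => cd u (inl (inord k))) (fun k => cd v (inl (inord k)))
    - form1 (fun k => cd v (inl (inord k))) (fun k => cd u (inl (inord k)))).
Proof.
move=> fB.
pose f' : {additive L -> int} := HB.pack f (GRing.isZmodMorphism.Build L int f fB).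
pose br w : {additive L -> L} := HB.pack (fun u => lie_bracket u w)
  (GRing.isZmodMorphism.Build L L _ (lie_bracketBl w)).
pose br' w : {additive L -> L} := HB.pack (fun v => lie_bracket w v)
  (GRing.isZmodMorphism.Build L L _ (lie_bracketBr w)).
have brz (p q : L) (m n : int) :
    f (lie_bracket (p *~ m) (q *~ n)) = f (lie_bracket p q) * m * n.
  rewrite -[lie_bracket _ _]/(br (q *~ n) (p *~ m)) raddfMz /=.
  rewrite -[lie_bracket _ _]/(br' p (q *~ n)) raddfMz /=.
  by rewrite -[f _]/(f' _) !raddfMz /= !mulrzz mulrAC.
have E : f (lie_bracket u v) = \sum_(i < 6) \sum_(j < 6)
    f (relation_matrix y i j) * cd u (inl i) * cd v (inl j).
  transitivity (\sum_k \sum_l f (lie_bracket (basis k) (basis l)) * cd u k * cd v l).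
    rewrite {1}[u](basis_coordK xyB) {1}[v](basis_coordK xyB).
    rewrite -[lie_bracket _ _]/(br _ (\sum_k _)) raddf_sum.
    rewrite -[f _]/(f' _) raddf_sum; apply: eq_bigr => k _ /=.
    rewrite -[lie_bracket _ _]/(br' _ (\sum_l _)) raddf_sum.
    by rewrite -[f _]/(f' _) raddf_sum; apply: eq_bigr => l _ /=; rewrite brz.
  have f0 : f 0 = 0 by exact: (raddf0 f').
  rewrite big_sumType /= [X in _ + X]big1 ?addr0 => [|j _]; last first.
    rewrite big_sumType /= !big1 ?addr0 // => i _.
      by rewrite yy f0 !mul0r.
    by rewrite yx f0 !mul0r.
  apply: eq_bigr => i _; rewrite big_sumType /= [X in _ + X]big1 ?addr0 => [|j _].
    by apply: eq_bigr => j _; rewrite xx.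
  by rewrite xy f0 !mul0r.
rewrite E sum_ord_inord.
under eq_bigr do rewrite sum_ord_inord.
rewrite unlock /= /relation_matrix !mxE !inordK //=.
have f0 : f 0 = 0 by exact: (raddf0 f').
have fN z : f (- z) = - f z by exact: (raddfN f').
have f2 z : f (z *+ 2) = 2 * f z by rewrite -[LHS]/(f' _) raddfMn /= mulr_natl.
rewrite !(f0, fN, f2) /form0 /form1; ring.
Qed.

Let cdB k : zmod_morphism (fun v => cd v k) := basis_coordB xyB k.

Let cd0 k : cd 0 k = 0.
Proof. by rewrite -(subrr (0 : L)) cdB subrr. Qed.

Let y_fst j : (y j).1 = 0.
Proof.
have [->|->] : j = ord0 \/ j = ord_max.
  by case: j => [[|[|//]] i]; [left|right]; apply: val_inj.
- have := xx (inord 0) (inord 3); rewrite /relation_matrix mxE !inordK //= => <-.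
  by [].
- have := xx (inord 0) (inord 4); rewrite /relation_matrix mxE !inordK //= => <-.
  by [].
Qed.

Let cd_y j k : cd (y j) (inl k) = 0.
Proof. exact: (basis_coord_basis xyB (inr j) (inl k)). Qed.

Let commE (g h : G) :
  (0, to_derived hG (derivedR g h)) = lie_bracket (\pi g, 0) (\pi h, 0) :> L.
Proof. by rewrite lie_bracketE. Qed.

Let to_derivedE (g : G) (d d' : derived g) : to_derived hG d = to_derived hG d'.
Proof. exact: val_inj. Qed.

Let to_derivedM (g h : G) (dg : derived g) (dh : derived h) (dgh : derived (g * h)%g) :
  (0, to_derived hG dgh) = (0, to_derived hG dg) + (0, to_derived hG dh) :> L.
Proof. by congr (_, _); [rewrite addr0|apply: val_inj]. Qed.

Let to_derived1 (g : G) (dg : derived g) : g = 1%g -> (0, to_derived hG dg) = 0 :> L.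
Proof.
move=> g1; transitivity ((0, 0) : L) => //.
by apply: (f_equal (pair 0)); apply: val_inj.
Qed.

(** The subgroup G' is generated by commutators, whose components lie in the
    span of y_1 and y_2. *)
Let cd_derived (g : G) (dg : derived g) i : cd (0, to_derived hG dg) (inl i) = 0.
Proof.
suff [dg' h] : exists dg' : derived g, forall i, cd (0, to_derived hG dg') (inl i) = 0.
  by rewrite (to_derivedE dg dg').
pose S := [set h : G | exists dh : derived h, forall i, cd (0, to_derived hG dh) (inl i) = 0]%classic.
apply: (dg S); split=> [|z [g1 _ [g2 _ <-]]]; last first.
  exists (derivedR g1 g2) => j; rewrite commE.
  by rewrite (coord_bracket _ _ (cdB (inl j))) !cd_y !mul0r addr0.
split=> [|h k [dh Sh] [dk Sk]|h [dh Sh]].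
- by exists (@derived1 G) => j; rewrite to_derived1 ?cd0.
- exists (derivedM dh dk) => j; rewrite (to_derivedM dh dk) cdD.
  by rewrite [X in X + _]Sh [X in _ + X]Sk addr0.
- exists (derivedV dh) => j; have := to_derivedM dh (derivedV dh) (derivedM dh (derivedV dh)).
  move/(congr1 (fun v => cd v (inl j))); rewrite cdD [X in X + _]Sh add0r => <-.
  by rewrite to_derived1 ?cd0 ?mulgV.
Qed.

(** The x_i induce a basis of G/G' and the y_j form a basis of G', because the
    y_j are brackets and G' lies in their span. *)
Lemma exists_coordinates : exists a b, @coordinates G a b.
Proof.
pose a (g : G) k := cd (\pi g, 0) (inl (inord k)).
pose b (g : G) k : int := if pselect (derived g) is left dg
  then cd (0, to_derived hG dg) (inr (inord k)) else 0.
have bE g k (dg : derived g) : b g k = cd (0, to_derived hG dg) (inr (inord k)).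
  by rewrite /b; case: pselect => // dg'; rewrite (to_derivedE dg dg').
have pi_derived (g : G) : \pi g = 0 :> abelianization G <-> derived g.
  rewrite -[0]/(\pi_(abelianization G) (1 : G)%g); split=> [/esym/eqP/abel_eqP|dg].
    by rewrite invg1 mul1g.
  by apply/esym/eqP/abel_eqP; rewrite invg1 mul1g.
have ord2 (j : 'I_2) : j = inord 0 \/ j = inord 1.
  by case: j => [[|[|//]] i]; [left|right]; apply: val_inj; rewrite /= inordK.
have cd_yy i j : cd (y i) (inr j) = (i == j).
  exact: (basis_coord_basis xyB (inr i) (inr j)).
have cdMz v m k : cd (v *~ m) k = cd v k * m.
  pose f : {additive L -> int} := HB.pack (fun v => cd v k)
    (GRing.isZmodMorphism.Build L int _ (cdB k)).
  by rewrite -[LHS]/(f (v *~ m)) raddfMz /= mulrzz.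
have y0E : y ord0 = y (inord 0) by congr y; apply: val_inj; rewrite /= inordK.
have y1E : y ord_max = y (inord 1) by congr y; apply: val_inj; rewrite /= inordK.
exists a, b; split=> [g h k|c|g|g h k dg dh|g dg b0 b1|m n|g h|g h].
- rewrite /a -cdD; congr (cd _ _); congr (_, _); last by rewrite addr0.
  by symmetry; exact: abel_addE.
- pose v : L := \sum_(i < 6) x i *~ c i.
  exists (repr v.1) => k k6; rewrite /a.
  have dv := derived_moduleP v.2.
  have -> : (\pi_(abelianization G) (repr v.1), 0) = v - (0, to_derived hG dv) :> L.
    rewrite reprK; case: (v) dv => v1 v2 dv /=; congr (_, _); first by rewrite subr0.
    by rewrite (_ : to_derived hG dv = v2) ?subrr //; apply: val_inj.
  rewrite cdB cd_derived subr0 /cd (@basis_coord_unique _ _ _ xyB _ (fun k =>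
    match k with inl i => c i | inr _ => 0 end)) ?inordK //.
  rewrite big_sumType /= [X in _ + X]big1 ?addr0 // => j _; exact: mulr0z.
- split=> [/pi_derived pg k k6|ag]; first by rewrite /a pg cd0.
  apply/pi_derived; rewrite -[\pi g]/((\pi g, 0) : L).1 [(_, _)](basis_coordK xyB).
  rewrite big_sumType /= big1 ?add0r => [|i _]; last first.
    have := ag i (ltn_ord i); rewrite /a inord_val /cd => ->; exact: mulr0z.
  pose fstm : {additive L -> abelianization G} := fst.
  rewrite -[_.1]/(fstm _) raddf_sum big1 // => j _.
  by rewrite raddfMz /= y_fst mul0rz.
- by rewrite (bE _ _ dg) (bE _ _ dh) (bE _ _ (derivedM dg dh)) (to_derivedM dg dh) cdD.
- rewrite (bE _ _ dg) in b0; rewrite (bE _ _ dg) in b1.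
  have : (0, to_derived hG dg) = 0 :> L.
    apply: (@basis_coord_inj _ _ _ xyB) => -[i|j].
      by rewrite [LHS]cd_derived [RHS]cd0.
    by rewrite [RHS]cd0; case: (ord2 j) => ->.
  by move/(congr1 (fun v : L => val v.2)).
- pose v : L := y (inord 0) *~ m + y (inord 1) *~ n.
  pose fstm : {additive L -> abelianization G} := fst.
  have v1 : v.1 = 0.
    by rewrite -[_.1]/(fstm _) raddfD !raddfMz /= !y_fst !mul0rz addr0.
  have vE (dv : derived (val v.2)) : (0, to_derived hG dv) = v :> L.
    rewrite [RHS]surjective_pairing v1; apply: (f_equal (pair 0)); exact: val_inj.
  have cdv k : cd v k = m * cd (y (inord 0)) k + n * cd (y (inord 1)) k.
    by rewrite /v cdD !cdMz mulrC; congr (_ + _); rewrite mulrC.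
  have dv := derived_moduleP v.2; exists (val v.2); split=> //.
    by rewrite (bE _ _ dv) (vE dv) cdv !cd_yy -!val_eqE /= !inordK //= mulr1 mulr0 addr0.
  by rewrite (bE _ _ dv) (vE dv) cdv !cd_yy -!val_eqE /= !inordK //= mulr1 mulr0 add0r.
- rewrite (bE _ _ (derivedR g h)) commE (coord_bracket _ _ (cdB _)) -/(a g) -/(a h).
  by rewrite y0E y1E !cd_yy -!val_eqE /= !inordK //= mul1r mul0r addr0.
- rewrite (bE _ _ (derivedR g h)) commE (coord_bracket _ _ (cdB _)) -/(a g) -/(a h).
  by rewrite y0E y1E !cd_yy -!val_eqE /= !inordK //= mul1r mul0r add0r.
Qed.
End Presentation.

Lemma presentation_coordinates (G : groupType) (hG : T2_group G) :
  has_presentation_np8' hG -> exists a b, @coordinates G a b.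
Proof. by case=> x [y [? ? ? ? ?]]; apply: (@exists_coordinates G hG x y). Qed.

(** * Subgroups of finite index in free abelian groups *)

(** The index is expressed by a numbering of the classes, which can be
    transported along maps without forming quotient sets. *)
Definition classified (X : Type) (E : X -> X -> Prop) (m : nat) : Prop :=
  exists f : X -> nat, [/\ forall x, (f x < m)%N, forall i, (i < m)%N -> exists x, f x = i
    & forall x y, f x = f y <-> E x y].

Lemma classified_fin (X : Type) (F : finType) (E : X -> X -> Prop) (f : X -> F) :
  (forall i, exists x, f x = i) -> (forall x y, f x = f y <-> E x y) ->
  classified E #|F|.
Proof.
move=> fsurj fE; exists (fun x => nat_of_ord (enum_rank (f x))); split=> [x|i iF|x y].
- exact: ltn_ord.
- have [x fx] := fsurj (enum_val (Ordinal iF)); exists x.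
  by rewrite fx enum_valK.
- by rewrite -fE; split=> [/val_inj/enum_rank_inj|->].
Qed.

Lemma classified_leq (X : Type) (E E' : X -> X -> Prop) (m m' : nat) :
  (forall x y, E x y -> E' x y) -> classified E m -> classified E' m' -> (m' <= m)%N.
Proof.
move=> EE' [f [f_lt _ fE]] [g [g_lt g_surj gE]].
have /choice[x gx] (i : 'I_m') : exists x, g x = i by apply: g_surj.
rewrite -(card_ord m) -(card_ord m'); apply: (@leq_card _ _ (fun i => Ordinal (f_lt (x i)))).
move=> i j [] /fE/EE'/gE; rewrite !gx; exact: val_inj.
Qed.

Lemma classified_unique (X : Type) (E : X -> X -> Prop) (m m' : nat) :
  classified E m -> classified E m' -> m = m'.
Proof.
by move=> c c'; apply/eqP; rewrite eqn_leq (classified_leq _ c c') // (classified_leq _ c' c).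
Qed.

Lemma has_index_classified (G : groupType) (H : set G) (m : nat) : subgroup H ->
  has_index H m <-> classified (fun x y => H (x^-1 * y)%g) m.
Proof.
case=> H1 HM HV.
pose coset (x : G) : set G := [set (x * h)%g | h in H]%classic.
have cosetE x y : coset x = coset y <-> H (x^-1 * y)%g.
  split=> [cxy|Hxy].
    have : coset y y by exists 1%g; rewrite ?mulg1.
    by rewrite -cxy => -[h Hh <-]; rewrite mulKg.
  apply/seteqP; split=> z [h Hh <-].
    exists (y^-1 * x * h)%g; last by rewrite !mulgA mulgV mul1g.
    by apply: HM => //; rewrite -[X in H X]invgK invgM invgK; apply: HV.
  exists (x^-1 * y * h)%g; last by rewrite !mulgA mulgV mul1g.
  exact: HM.
split=> [/card_set_bijP[f [fT finj fsurj]]|[f [f_lt f_surj fE]]].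
  exists (fun x => f (coset x)); split=> [x|i im|x y].
  - by apply: fT; exists x.
  - by have [_ [x _ <-] <-] := fsurj i im; exists x.
  - rewrite -cosetE; split=> [|-> //]; apply: finj; rewrite inE; by [exists x|exists y].
apply/card_esym/card_set_bijP.
have /choice[r rP] (i : nat) : exists x, (i < m)%N -> f x = i.
  by have [/f_surj[x <-]|_] := boolP (i < m)%N; [exists x|exists 1%g].
exists (fun i => coset (r i)); split=> [i im|i j|_ [x _ <-]].
- by exists (r i).
- by rewrite !inE => im jm /cosetE/fE; rewrite !rP.
- by exists (f x); [exact: f_lt|apply/cosetE/fE; rewrite rP].
Qed.

Section AdditiveSubgroups.
Variable V : zmodType.
Implicit Types K : set V.

Definition add_subgroup K : Prop := K 0 /\ forall x y, K x -> K y -> K (x - y).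

Definition subgroups_of_index (m : nat) : set (set V) :=
  [set K | add_subgroup K /\ classified (fun x y => K (y - x)) m]%classic.

Lemma add_subgroupN K x : add_subgroup K -> K x -> K (- x).
Proof. by case=> K0 KB Kx; rewrite -sub0r; apply: KB. Qed.

Lemma add_subgroupD K x y : add_subgroup K -> K x -> K y -> K (x + y).
Proof. by move=> sK Kx Ky; rewrite -[y]opprK; apply: sK.2 => //; apply: add_subgroupN. Qed.

Lemma add_subgroupMz K x n : add_subgroup K -> K x -> K (x *~ n).
Proof.
move=> sK Kx; have Kn k : K (x *+ k).
  elim: k => [|k IH]; first by rewrite mulr0n; case: sK.
  by rewrite mulrS; apply: add_subgroupD.
by case: n => k; rewrite ?NegzE ?mulrNz -pmulrn; [|apply: add_subgroupN].
Qed.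
End AdditiveSubgroups.

Section Extension.
Variable V : zmodType.
Local Notation ZV := (int * V)%type.

(** The subgroup of Z x V with image dZ in Z, intersection K with V, and
    containing (d, u). *)
Definition ext_subgroup (d : nat) (K : set V) (u : V) : set ZV :=
  [set w | exists2 q : int, w.1 = q * d%:Z & K (w.2 - u *~ q)]%classic.

Lemma ext_subgroup_add d K u : add_subgroup K -> add_subgroup (ext_subgroup d K u : set (ZV : zmodType)).
Proof.
move=> sK; split; first by exists 0; rewrite ?mul0r ?mulr0z ?subr0 //; case: sK.
move=> [n v] [n' v'] [q /= -> Kv] [q' /= -> Kv']; exists (q - q'); first by rewrite mulrBl.
have -> : v - v' - u *~ (q - q') = (v - u *~ q) - (v' - u *~ q').
  by rewrite mulrzBr !opprD !opprK addrACA.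
exact: sK.2.
Qed.

Lemma ext_subgroup_classified d K u m : (0 < d)%N -> add_subgroup K ->
  classified (fun x y => K (y - x)) m ->
  classified (fun x y : ZV => ext_subgroup d K u (y - x)) (d * m).
Proof.
move=> d_gt0 sK [f [f_lt f_surj fE]].
have d0 : d%:Z != 0 by lia.
have r_lt (n : int) : (`|(n %% d)%Z| < d)%N.
  by rewrite -ltz_nat gez0_abs ?modz_ge0 // ltz_pmod.
have -> : (d * m)%N = #|{: 'I_d * 'I_m}| by rewrite card_prod !card_ord.
apply: (@classified_fin _ _ _ (fun w : ZV =>
  (Ordinal (r_lt w.1), Ordinal (f_lt (w.2 - u *~ (w.1 %/ d)%Z))))).
  move=> [i j]; have [x fx] := f_surj j (ltn_ord j).
  exists (i%:Z, x); congr (_, _); apply: val_inj => /=.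
    by rewrite modz_nat modn_small.
  by rewrite divz_nat divn_small // mulr0z subr0.
have shift v v' (q q' : int) : v' - u *~ q' - (v - u *~ q) = v' - v - u *~ (q' - q).
  by rewrite mulrzBr !opprD !opprK addrACA.
move=> [n v] [n' v']; split=> [[/= rn /fE]|].
  rewrite shift => Kv; exists ((n' %/ d)%Z - (n %/ d)%Z); last exact: Kv.
  have {}rn : (n %% d)%Z = (n' %% d)%Z.
    by rewrite -[LHS]gez0_abs ?modz_ge0 // rn gez0_abs ?modz_ge0.
  have := divz_eq n d; have := divz_eq n' d; rewrite /= rn mulrBl.
  by move: (_ * _) (_ * _) (_ %% _)%Z => x x0 r; lia.
case=> q /= nq Kv.
have nE : n' = q * d%:Z + n by lia.
have qE : (n' %/ d)%Z = q + (n %/ d)%Z by rewrite nE divzMDl.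
congr (_, _); apply: val_inj => /=; first by rewrite nE modzMDl.
by apply/fE; rewrite shift qE addrK.
Qed.

(** The projection of H to Z is nonzero, because H has finite index; d is its
    positive generator, and u is chosen such that (d, u) lies in H. *)
Lemma ext_subgroup_surj M (H : set ZV) :
  add_subgroup (H : set (ZV : zmodType)) -> classified (fun x y : ZV => H (y - x)) M ->
  exists d m K u, [/\ (0 < d)%N, (d * m)%N = M, add_subgroup K,
    classified (fun x y : V => K (y - x)) m & H = ext_subgroup d K u].
Proof.
move=> sH cH; have [f [f_lt _ fE]] := cH.
pose P (n : nat) := `[< (0 < n)%N /\ exists v, H (n%:Z, v) >].
have exP : exists n, P n.
  have [i [j [ij fij]]] : exists i j : 'I_M.+1, (i < j)%N /\ f (i%:Z, 0) = f (j%:Z, 0).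
    apply: contrapT => no; pose g (i : 'I_M.+1) := Ordinal (f_lt (i%:Z, 0)).
    have /leq_card : injective g.
      move=> i j [] fij; apply: val_inj; have [ij|ji|//] := ltngtP (i : nat) j.
        by case: no; exists i, j.
      by case: no; exists j, i.
    by rewrite !card_ord ltnn.
  exists (j - i)%N; apply/asboolP; split; first by rewrite subn_gt0.
  exists 0; move/fE: fij => /=; rewrite (_ : (_, _) - _ = ((j - i)%N%:Z, 0)) //.
  by congr (_, _) => /=; [rewrite subzn // ltnW|rewrite subrr].
pose d := ex_minn exP.
have [d_gt0 [u Hdu]] : (0 < d)%N /\ exists v, H (d%:Z, v).
  by rewrite /d; case: ex_minnP => n /asboolP.
have d_min n v : (0 < n)%N -> H (n%:Z, v) -> (d <= n)%N.
  move=> n_gt0 Hn; rewrite /d; case: ex_minnP => k _; apply.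
  by apply/asboolP; split=> //; exists v.
pose K : set V := [set v | H (0, v)]%classic.
have sK : add_subgroup K.
  case: sH => H0 HB; split=> // v v' Kv Kv'; have := HB _ _ Kv Kv'.
  by rewrite /K /= (_ : (0, v) - (0, v') = (0, v - v')).
have pairMz (q : int) : ((d%:Z, u) : ZV) *~ q = (q * d%:Z, u *~ q).
  pose fstm : {additive ZV -> int} := fst; pose sndm : {additive ZV -> V} := snd.
  rewrite [LHS]surjective_pairing -[_.1]/(fstm _) -[_.2]/(sndm _) !raddfMz /=.
  by rewrite mulrzz mulrC.
have pairB (n n' : int) (v v' : V) : (n, v) - (n', v') = (n - n', v - v') :> ZV by [].
have pairD (n n' : int) (v v' : V) : (n, v) + (n', v') = (n + n', v + v') :> ZV by [].
have defH : H = ext_subgroup d K u.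
  apply/seteqP; split=> -[n v] /=.
    move=> Hn; have d0 : d%:Z != 0 by lia.
    have Hr : H ((n %% d)%Z, v - u *~ (n %/ d)%Z).
      have := sH.2 _ _ Hn (add_subgroupMz (n %/ d)%Z sH Hdu).
      by rewrite pairMz pairB {1}(divz_eq n d) addrAC subrr add0r.
    have r_ge0 := modz_ge0 n d0; have r_lt : (n %% d)%Z < d%:Z by rewrite ltz_pmod.
    have r0 : (n %% d)%Z = 0.
      apply/eqP; apply: contraT => r0; have := d_min `|(n %% d)%Z|%N _ _.
      by move=> /(_ (v - u *~ (n %/ d)%Z)); rewrite gez0_abs // => /(_ _ Hr); lia.
    exists (n %/ d)%Z; first by rewrite {1}(divz_eq n d) r0 addr0.
    by rewrite r0 in Hr.
  case=> q /= -> Kv; have := add_subgroupD sH (add_subgroupMz q sH Hdu) Kv.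
  by rewrite pairMz pairD addr0 addrC subrK.
pose A := [pred i : 'I_M | `[< exists v, f (0, v) = i >]].
have fA v : Ordinal (f_lt (0, v)) \in A by apply/asboolP; exists v.
pose f0 v : {i | i \in A} := exist _ (Ordinal (f_lt (0, v))) (fA v).
have f0_surj i : exists v, f0 v = i.
  by case: i => i iA; have /asboolP[v fv] := iA; exists v; do 2!apply: val_inj.
have f0E v v' : f0 v = f0 v' <-> K (v' - v).
  have -> : K (v' - v) = H ((0, v') - (0, v)) by rewrite pairB subrr.
  by rewrite -fE; split=> [[]//|fvv]; do 2!apply: val_inj.
have cK := classified_fin f0_surj f0E.
eexists d, _, K, u; split; [by []| |by []|exact: cK|by []].
apply: classified_unique (ext_subgroup_classified u d_gt0 sK cK) _.
by rewrite -defH.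
Qed.
End Extension.

Lemma card_eq_fin_range (T : Type) (F : finType) (A : set T) (f : F -> T) :
  injective f -> (forall x, A x <-> exists i, f i = x) -> A #= `I_#|F|.
Proof.
move=> finj Af; have -> : A = (f @` [set: F])%classic.
  apply/seteqP; split=> x; first by move=> /Af[i <-]; exists i.
  by case=> i _ <-; apply/Af; exists i.
apply: card_eq_trans (inj_card_eq _) _; first by move=> x y _ _; apply: finj.
apply/card_set_bijP; exists (fun i => nat_of_ord (enum_rank i)); split.
- by move=> i _; exact: ltn_ord.
- by move=> i j _ _ /val_inj/enum_rank_inj.
- by move=> k kF; exists (enum_val (Ordinal kF)); rewrite ?enum_valK.
Qed.

Lemma ext_subgroup_inj (V : zmodType) (d d' : nat) (K K' : set V) (u u' : V) :
  (0 < d)%N -> (0 < d')%N -> add_subgroup K -> add_subgroup K' ->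
  ext_subgroup d K u = ext_subgroup d' K' u' -> [/\ d = d', K = K' & K (u' - u)].
Proof.
move=> d0 d'0 sK sK' E.
have mem (e : nat) (L : set V) v : add_subgroup L -> ext_subgroup e L v (e%:Z, v).
  by move=> [L0 _]; exists 1; rewrite ?mul1r //= mulr1z subrr.
have H1 := mem d K u sK; rewrite E in H1; have H2 := mem d' K' u' sK'; rewrite -E in H2.
case: H1 H2 => q /= dq _ [q' /= d'q'] Ku.
have dd : d = d'.
  apply/eqP; rewrite eqn_dvd; apply/andP; split.
    by have /dvdzP := ex_intro (fun q => d'%:Z = q * d%:Z) q' d'q'; rewrite dvdzE.
  by have /dvdzP := ex_intro (fun q => d%:Z = q * d'%:Z) q dq; rewrite dvdzE.
subst d'; split=> //; last first.
  suff q1 : q' = 1 by move: Ku; rewrite q1 mulr1z.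
  by apply: (mulIf (_ : d%:Z != 0)); [lia|rewrite -d'q' mul1r].
have K0 (L L' : set V) w w' v : ext_subgroup d L w = ext_subgroup d L' w' -> L v -> L' v.
  move=> EL Lv; have : ext_subgroup d L w (0, v) by exists 0; rewrite ?mul0r //= mulr0z subr0.
  rewrite EL => -[x /= /esym/eqP]; rewrite mulf_eq0 => /orP[/eqP->|]; last by lia.
  by rewrite mulr0z subr0.
by apply/seteqP; split=> v; [apply: K0 E|apply: K0 (esym E)].
Qed.

(** A subgroup of index p^k amounts to its image p^e Z in Z, its intersection
    K with V, which has index p^(k - e), and a class u modulo K. *)
Lemma count_ext (V : zmodType) (p : nat) (c : nat -> nat) : prime p ->
  (forall k, @subgroups_of_index V (p ^ k) #= `I_(c k)) ->
  forall k, @subgroups_of_index (int * V)%type (p ^ k)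
    #= `I_(\sum_(e < k.+1) c (k - e) * p ^ (k - e))%N.
Proof.
move=> p_pr hc k; have p_gt0 e : (0 < p ^ e)%N by rewrite expn_gt0 prime_gt0.
have /choice[g gP] j : exists g : nat -> set V, set_bij `I_(c j) (@subgroups_of_index V (p ^ j)) g.
  by apply/card_set_bijP/card_esym.
have gsub j i : (i < c j)%N -> subgroups_of_index (p ^ j) (g j i).
  by move=> ic; have [gT _ _] := gP j; apply: gT.
have /choice[r rP] (ji : nat * nat) : exists r : nat -> V, (ji.2 < c ji.1)%N ->
    forall v, exists! t, (t < p ^ ji.1)%N /\ g ji.1 ji.2 (v - r t).
  have [/gsub[sK [f [f_lt f_surj fE]]]|_] := boolP (ji.2 < c ji.1)%N; last by exists (fun=> 0).
  have /choice[r rE] t : exists v, (t < p ^ ji.1)%N -> f v = t.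
    by have [/f_surj[v fv]|_] := boolP (t < p ^ ji.1)%N; [exists v|exists 0].
  exists r => _ v; exists (f v); split.
    by split=> //; apply/fE; rewrite rE.
  by move=> t [tp /fE]; rewrite rE.
pose T := {e : 'I_k.+1 & 'I_(c (k - e)%N) * 'I_(p ^ (k - e))%N}%type.
pose F (w : T) : set (int * V)%type :=
  let: existT e (i, t) := w in ext_subgroup (p ^ e) (g (k - e)%N i) (r ((k - e)%N, nat_of_ord i) t).
have -> : (\sum_(e < k.+1) c (k - e) * p ^ (k - e))%N = #|{: T}|.
  rewrite card_tagged sumnE big_map big_enum /=; apply: eq_bigr => e _.
  by rewrite card_prod !card_ord.
apply: (@card_eq_fin_range _ _ _ F).
  move=> [e [i t]] [e' [i' t']]; rewrite /F.
  have [sK _] := gsub _ _ (ltn_ord i); have [sK' _] := gsub _ _ (ltn_ord i').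
  case/(ext_subgroup_inj (p_gt0 e) (p_gt0 e') sK sK') => /eqP.
  rewrite eqn_exp2l ?prime_gt1 // => /eqP/val_inj ee'; subst e'.
  have [_ ginj _] := gP (k - e)%N.
  move/ginj; rewrite !inE => /(_ (ltn_ord i) (ltn_ord i'))/val_inj ii'; subst i'.
  move=> Kt; suff -> : t = t' by []; apply: val_inj => /=.
  have [t0 [_ uniq]] := rP ((k - e)%N, nat_of_ord i) (ltn_ord i) (r ((k - e)%N, nat_of_ord i) t').
  rewrite -(uniq t) ?(uniq t') //=; split; rewrite ?ltn_ord ?subrr //; exact: sK.1.
move=> H; split=> [[sH cH]|[[e [i t]] <-]].
  have [d [m [K [u [d_gt0 dm sK cK ->]]]]] := ext_subgroup_surj sH cH.
  have /(dvdn_pfactor _ _ p_pr)[e ek de] : (d %| p ^ k)%N by rewrite -dm dvdn_mulr.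
  have me : m = (p ^ (k - e))%N.
    apply/eqP; rewrite -(eqn_pmul2l d_gt0) dm de -expnD subnKC //.
  rewrite me in cK; have [_ _ gsurj] := gP (k - e)%N.
  have [i ic gi] := gsurj K (conj sK cK).
  have [t [[tp Kt] _]] := rP ((k - e)%N, i) ic u.
  rewrite /= gi in Kt; have ek' : (e < k.+1)%N by [].
  exists (existT _ (Ordinal ek') (Ordinal (ic : (i < c (k - Ordinal ek'))%N),
     Ordinal (tp : (t < p ^ (k - Ordinal ek'))%N))).
  rewrite /F /= gi de; apply/seteqP; split=> -[n v] [q /= -> Kv]; exists q => //=.
    rewrite (_ : v - _ = (v - r ((k - e)%N, i) t *~ q) - (u - r ((k - e)%N, i) t) *~ q).
      exact: (sK.2 _ _ Kv (add_subgroupMz q sK Kt)).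
    by rewrite mulrzBl opprB addrA subrK.
  rewrite (_ : v - _ = (v - u *~ q) + (u - r ((k - e)%N, i) t) *~ q).
    exact: (add_subgroupD sK Kv (add_subgroupMz q sK Kt)).
  by rewrite mulrzBl addrA subrK.
have [sK cK] := gsub _ _ (ltn_ord i); split; first exact: ext_subgroup_add.
have := ext_subgroup_classified (r ((k - e)%N, nat_of_ord i) t) (p_gt0 e) sK cK.
by rewrite -expnD subnKC // -ltnS.
Qed.

(** A product built one factor at a time, as count_ext requires. *)
Fixpoint Zpower (n : nat) : zmodType :=
  if n is n'.+1 then (int * Zpower n')%type else 'I_1.

Lemma count_Zpower (n k : nat) : exists S : {poly rat}, forall p, prime p ->
  exists2 c : nat, @subgroups_of_index (Zpower n) (p ^ k) #= `I_c & S.[p%:R] = c%:R.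
Proof.
elim: n k => [|n IH] k.
  exists ((k == 0%N)%:R) => p p_pr; exists (k == 0%N : nat); last first.
    by case: eqP; rewrite ?hornerC ?horner0.
  have triv (x : 'I_1) : x = 0 by rewrite ord1.
  have sT : @add_subgroup ('I_1 : zmodType) setT by split.
  have cT : classified (fun x y : 'I_1 => [set: 'I_1]%classic (y - x)) 1.
    by exists (fun=> 0%N); split=> // i; rewrite ltnS leqn0 => /eqP->; exists 0.
  have KT (K : set ('I_1 : zmodType)) : add_subgroup K -> K = setT.
    by case=> K0 _; apply/seteqP; split=> x _ //; rewrite (triv x).
  case: eqP => [->|k0] /=.
    rewrite expn0 -[X in _ #= `I_X](card_ord 1).
    apply: (@card_eq_fin_range _ _ _ (fun=> setT)) => [i j _|K]; first by rewrite !ord1.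
    split=> [[sK _]|[i <-]]; last by split.
    by exists 0; rewrite (KT _ sK).
  rewrite -[X in _ #= `I_X]/0%N -[X in _ #= `I_X](card_ord 0).
  apply: (@card_eq_fin_range _ _ _ (fun=> setT)) => [[]//|K].
  split=> [[/KT -> cK]|[[]//]]; have := classified_unique cK cT.
  by move/eqP; rewrite -[X in _ == X](expn0 p) eqn_exp2l ?prime_gt1 // => /eqP.
have /choice[S SP] := IH.
exists (\sum_(e < k.+1) S (k - e)%N * 'X^(k - e)) => p p_pr.
have /choice[c cP] j : exists c : nat,
    @subgroups_of_index (Zpower n) (p ^ j) #= `I_c /\ (S j).[p%:R] = c%:R.
  by have [c ? ?] := SP j p p_pr; exists c.
exists (\sum_(e < k.+1) c (k - e)%N * p ^ (k - e))%N.
  by apply: count_ext => // j; have [] := cP j.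
rewrite horner_sum natr_sum; apply: eq_bigr => e _.
by rewrite hornerM hornerXn natrM natrX (cP _).2.
Qed.

(** * Normal subgroups that contain the derived group *)

Section OverDerived.
Variables (G : groupType) (a b : G -> nat -> int).
Hypothesis ab : coordinates a b.

Definition abel_coord (g : G) : Zpower 6 :=
  (a g 0%N, (a g 1%N, (a g 2%N, (a g 3%N, (a g 4%N, (a g 5%N, 0)))))).

Lemma abel_coordM g h : abel_coord (g * h)%g = abel_coord g + abel_coord h.
Proof. by rewrite /abel_coord !(coordM ab) -{1}(addr0 (0 : 'I_1)). Qed.

Lemma abel_coordV g : abel_coord g^-1%g = - abel_coord g.
Proof.
have abel1 : abel_coord 1%g = 0.
  by apply: (addrI (abel_coord 1%g)); rewrite -abel_coordM mulg1 addr0.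
by apply/eqP; rewrite -addr_eq0 -abel_coordM mulVg abel1.
Qed.

Lemma abel_coordVM g h : abel_coord (g^-1 * h)%g = abel_coord h - abel_coord g.
Proof. by rewrite abel_coordM abel_coordV addrC. Qed.

Lemma abel_coord_derived g : abel_coord g = 0 <-> derived g.
Proof.
rewrite (coord_derived ab); split=> [[g0 g1 g2 g3 g4 g5]|ag].
  by do 6?[case=> //].
by rewrite /abel_coord !ag.
Qed.

Lemma abel_coord_surj v : exists g, abel_coord g = v.
Proof.
case: v => v0 [v1 [v2 [v3 [v4 [v5 z]]]]].
have [g ag] := coord_surj ab (nth 0 [:: v0; v1; v2; v3; v4; v5]).
by exists g; rewrite /abel_coord !ag // (ord1 z).
Qed.

Lemma over_derivedP (m : nat) (H : set G) :
  (normal_subgroup H /\ has_index H m) /\ (@derived G `<=` H)%classic <->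
  exists2 K, subgroups_of_index m K & H = (abel_coord @^-1` K)%classic.
Proof.
have [sec secK] := choice abel_coord_surj.
split=> [[[[[H1 HM HV] HJ] iH] dH]|[K [[K0 KB] [f [f_lt f_surj fE]]] ->]].
  have Hab g h : abel_coord g = abel_coord h -> H h -> H g.
    move=> gh Hh; rewrite -(mulVKg h g); apply: HM => //; apply/dH/abel_coord_derived.
    by rewrite abel_coordVM gh subrr.
  pose K : set (Zpower 6) := (abel_coord @` H)%classic.
  have HK g : K (abel_coord g) <-> H g.
    split=> [[h Hh hg]|Hg]; last by exists g.
    exact: (Hab g h (esym hg) Hh).
  have K0 : K 0 by exists 1%g => //; apply/abel_coord_derived; exact: derived1.
  exists K; last by apply/seteqP; split=> g /HK.
  split; first split.
  - exact: K0.
  - move=> _ _ [g Hg <-] [h Hh <-]; rewrite -abel_coordVM; apply/HK.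
    by apply: HM => //; apply: HV.
  have /(has_index_classified _ (And3 H1 HM HV))[f [f_lt f_surj fE]] := iH.
  exists (fun v => f (sec v)); split=> [v|i im|v v'] //.
    have [g fg] := f_surj i im; exists (abel_coord g); rewrite -fg.
    by apply/fE/HK; rewrite abel_coordVM secK subrr.
  by rewrite fE -HK abel_coordVM !secK.
have KD x y : K x -> K y -> K (x + y) by move=> Kx Ky; apply: (@add_subgroupD _ K).
have sH : subgroup (abel_coord @^-1` K)%classic.
  split=> [|g h|g] /=.
  - by rewrite (abel_coord_derived 1).2 //; apply: derived1.
  - by rewrite abel_coordM; apply: KD.
  - by rewrite abel_coordV; apply: add_subgroupN.
split; first split.
- by split=> // g h /=; rewrite conjgE !abel_coordM abel_coordV addrCA addNr addr0.
- apply/has_index_classified => //; exists (fun g => f (abel_coord g)); split=> [g|i im|g h] //.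
    have [v <-] := f_surj i im; exists (sec v); by rewrite secK.
  by rewrite fE /= abel_coordVM.
by move=> g /abel_coord_derived /= ->.
Qed.

(** Every subgroup that contains G' is normal, and these subgroups correspond
    to the subgroups of G/G'. *)
Lemma card_over_derived (m c : nat) : @subgroups_of_index (Zpower 6) m #= `I_c ->
  [set H : set G | (normal_subgroup H /\ has_index H m) /\ (@derived G `<=` H)%classic]%classic #= `I_c.
Proof.
move=> Kc; rewrite (_ : [set H | _]%classic =
    ((fun K => abel_coord @^-1` K) @` subgroups_of_index m)%classic).
  apply: card_eq_trans Kc; apply: inj_card_eq => K K' _ _ KK'.
  apply/seteqP; split=> v; have [g <-] := abel_coord_surj v.
    by move=> Kg; have : (abel_coord @^-1` K)%classic g by []; rewrite KK'.
  by move=> Kg; have : (abel_coord @^-1` K')%classic g by []; rewrite -KK'.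
apply/seteqP; split=> H; first by move/over_derivedP => [K ? ->]; exists K.
by move=> [K KK <-]; apply/over_derivedP; exists K.
Qed.

End OverDerived.

(** * Normal subgroups of index p^5 when 2 is not a cube modulo p *)

Section Lagrange.
Variables (G : groupType) (H : set G) (m : nat).
Hypotheses (sH : subgroup H) (iH : has_index H m).
Local Open Scope group_scope.

(** The action on the cosets gives access to the theory of finite permutation
    groups. *)
Lemma coset_action : exists (f : G -> 'I_m) (pi : G -> {perm 'I_m}),
  [/\ forall i, exists x, f x = i, forall x y, f x = f y <-> H (x^-1 * y),
      forall g x, pi g (f x) = f (g * x) & forall g h, pi (g * h) = (pi h * pi g)%g].
Proof.
have /(has_index_classified _ sH)[f0 [f_lt f_surj fE]] := iH.
pose f x := Ordinal (f_lt x).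
have fP x y : f x = f y <-> H (x^-1 * y).
  by rewrite -fE; split=> [[]|] // fxy; apply: val_inj.
have /choice[r rP] (i : 'I_m) : exists x, f x = i.
  by have [x fx] := f_surj i (ltn_ord i); exists x; apply: val_inj.
have frf g x : f (g * r (f x)) = f (g * x).
  by apply/fP; rewrite invgM -mulgA mulKg; apply/fP; rewrite rP.
have inj g : injective (fun i => f (g * r i)).
  apply: (can_inj (g := fun i => f (g^-1 * r i))) => i.
  by rewrite frf mulKg rP.
exists f, (fun g => perm (inj g)); split=> // [i|g x|g h]; first by exists (r i).
  by rewrite permE frf.
by apply/permP=> i; rewrite permM !permE frf mulgA.
Qed.

(** As H is normal, the permutations of the cosets induced by G form a group
    of order m. *)
Lemma expg_index x : (forall g h, H g -> H (g ^ h)) -> H (x ^+ m).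
Proof.
move=> HJ; have [f [pi [fsurj fE piE piM]]] := coset_action; have [H1 HM HV] := sH.
have pi_eq g h : pi g = pi h <-> H (g^-1 * h).
  split=> [gh|Hgh]; first by apply/fE; rewrite -[g]mulg1 -[h in RHS]mulg1 -!piE gh.
  apply/permP=> i; have [y <-] := fsurj i; rewrite !piE; apply/fE.
  have -> : (g * y)^-1 * (h * y) = (g^-1 * h) ^ y by rewrite conjgE invgM !mulgA.
  exact: HJ.
have pi1 : pi 1 = 1%g by apply/permP=> i; have [y <-] := fsurj i; rewrite piE mul1g perm1.
have piX k : pi (x ^+ k) = (pi x ^+ k)%g.
  by elim: k => [|k IH]; rewrite ?expg0 // expgSr piM IH expgS.
pose P : {set {perm 'I_m}} := [set s | `[< exists g, pi g = s >]].
have PP s : reflect (exists g, pi g = s) (s \in P) by rewrite finset.inE; apply: asboolP.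
have gP : group_set P.
  apply/group_setP; split; first by apply/PP; exists 1.
  by move=> s t /PP[g <-] /PP[h <-]; apply/PP; exists (h * g); rewrite piM.
have /choice[r rP] (i : 'I_m) : exists y, f y = i by apply: fsurj.
have cardP : #|P| = m.
  rewrite (_ : P = [set pi (r i) | i : 'I_m]); last first.
    apply/setP=> s; apply/PP/imsetP=> [[g <-]|[i _ ->]]; last by exists (r i).
    by exists (f g) => //; apply/pi_eq/fE; rewrite rP.
  rewrite card_imset ?card_ord // => i j /pi_eq/fE; by rewrite !rP.
have : pi x \in Group gP by apply/PP; exists x.
move/order_dvdG; rewrite cardP order_dvdn -piX -pi1 => /eqP/esym/pi_eq.
by rewrite invg1 mul1g.
Qed.
End Lagrange.

Section NonCube.
Variables (G : groupType) (a b : G -> nat -> int) (p : nat).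
Hypotheses (hG : T2_group G) (ab : coordinates a b).
Hypotheses (p_pr : prime p) (p2 : ~ cube_mod 2 p).
Local Notation F := 'F_p.

Let Fp : p \in [pchar F].
Proof. by rewrite pchar_Fp. Qed.

(** The expression c0^3 + 2 c1^3 is the Pfaffian of the alternating form
    obtained by pairing the commutator form with (c0, c1). *)
Lemma pfaffian_neq0 (c0 c1 : F) : c0 ^+ 3 + 2 * c1 ^+ 3 = 0 -> c0 = 0 /\ c1 = 0.
Proof.
have [->|c1_neq0] := eqVneq c1 0.
  by rewrite expr0n mulr0 addr0 => /eqP; rewrite expf_eq0 => /eqP.
move=> c0E; case: p2; pose t : F := - (c0 / c1).
have t3 : t ^+ 3 = 2.
  apply: (mulIf (expf_neq0 3 c1_neq0)); rewrite -exprMn mulNr divfK // exprNn.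
  by rewrite -signr_odd expr1 mulN1r; apply/eqP; rewrite eq_sym -addr_eq0 addrC c0E.
exists (t : nat); apply: (natr_pchar_modn Fp); rewrite natrX -t3; congr (_ ^+ 3).
by rewrite natr_Zp.
Qed.

(** The commutators [h, g] lie in H, so every h in H is in the radical modulo
    p of the commutator form paired with (c0, c1). This form is nondegenerate,
    since its Pfaffian is nonzero. *)
Lemma noncube_radical (H : set G) (c0 c1 : F) : normal_subgroup H ->
  (forall h, H h -> derived h -> c0 * (b h 0%N)%:~R + c1 * (b h 1%N)%:~R = 0) ->
  c0 != 0 \/ c1 != 0 -> forall h k, H h -> (k < 6)%N -> (a h k)%:~R = 0 :> F.
Proof.
move=> [[H1 HM HV] HJ] Hc c_neq0 h k Hh k6.
have Hhg g : H [~ h, g]%g.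
  have -> : [~ h, g]%g = (h^-1 * h ^ g)%g by rewrite commgEl.
  by apply: HM; [apply: HV|apply: HJ].
pose A k : F := (a h k)%:~R.
have eqn j : (j < 6)%N -> let v := (fun k => (k == j)%:R : F) in
    c0 * ((A 0 * v 3 + A 1 * v 4 + A 2 * v 5) - (v 0 * A 3 + v 1 * A 4 + v 2 * A 5))
  + c1 * ((A 0 * v 4 + A 1 * v 5 + 2 * A 2 * v 3) - (v 0 * A 4 + v 1 * A 5 + 2 * v 2 * A 3)) = 0.
  move=> j6 v; have [g ag] := coord_surj ab (fun k => (k == j)%:Z).
  have := Hc _ (Hhg g) (derivedR h g).
  rewrite (coord_comm0 ab) (coord_comm1 ab) /form0 /form1 !ag //.
  rewrite !(rmorphN, rmorphD, rmorphM) /= => <-.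
  have vE k' : (k' == j)%:Z%:~R = v k' :> F by [].
  by rewrite -!vE.
have det_neq0 : c0 ^+ 3 + 2 * c1 ^+ 3 != 0.
  by apply/eqP=> /pfaffian_neq0[c00 c10]; case: c_neq0; rewrite ?c00 ?c10 eqxx.
have := eqn 0 isT; have := eqn 1 isT; have := eqn 2 isT.
have := eqn 3 isT; have := eqn 4 isT; have := eqn 5 isT.
rewrite /= !(mulr1, mulr0, mul0r, addr0, add0r, subr0, sub0r, oppr0).
move=> e5 e4 e3 e2 e1 e0; apply: (mulfI det_neq0); rewrite mulr0 -/(A k).
have E0 : c0 * A 3 + c1 * A 4 = 0 by rewrite -[0]oppr0 -[in RHS]e0; ring.
have E1 : c0 * A 4 + c1 * A 5 = 0 by rewrite -[0]oppr0 -[in RHS]e1; ring.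
have E2 : c0 * A 5 + 2 * c1 * A 3 = 0 by rewrite -[0]oppr0 -[in RHS]e2; ring.
have E3 : c0 * A 0 + 2 * c1 * A 2 = 0 by rewrite -[RHS]e3; ring.
have E4 : c0 * A 1 + c1 * A 0 = 0 by rewrite -[RHS]e4; ring.
have E5 : c0 * A 2 + c1 * A 1 = 0 by rewrite -[RHS]e5; ring.
have comb x y z u v w : u = 0 -> v = 0 -> w = 0 -> x * u + y * v + z * w = 0 :> F.
  by move=> -> -> ->; rewrite !mulr0 !addr0.
(* Cramer's rule for the two blocks of three equations. *)
case: k k6 => [|[|[|[|[|[|//]]]]]] _.
- by rewrite -(comb (c0 ^+ 2) (- 2 * c0 * c1) (2 * c1 ^+ 2) _ _ _ E3 E5 E4); ring.
- by rewrite -(comb (c0 ^+ 2) (- c0 * c1) (2 * c1 ^+ 2) _ _ _ E4 E3 E5); ring.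
- by rewrite -(comb (c0 ^+ 2) (- c0 * c1) (c1 ^+ 2) _ _ _ E5 E4 E3); ring.
- by rewrite -(comb (c0 ^+ 2) (- c0 * c1) (c1 ^+ 2) _ _ _ E0 E1 E2); ring.
- by rewrite -(comb (c0 ^+ 2) (- c0 * c1) (2 * c1 ^+ 2) _ _ _ E1 E2 E0); ring.
- by rewrite -(comb (c0 ^+ 2) (- 2 * c0 * c1) (2 * c1 ^+ 2) _ _ _ E2 E0 E1); ring.
Qed.

Lemma derived_expg g n k : derived g -> derived (g ^+ n)%g /\ b (g ^+ n)%g k = n%:Z * b g k.
Proof.
move=> dg; elim: n => [|n [dgn bgn]].
  rewrite expg0; split; first exact: derived1.
  rewrite mul0r; have := coord_derivedM ab k (@derived1 G) (@derived1 G).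
  by rewrite mulg1 => /eqP; rewrite eq_sym addrC -subr_eq0 addrK => /eqP.
rewrite expgS; split; first exact: derivedM.
by rewrite (coord_derivedM ab) // bgn intS mulrDl mul1r.
Qed.

Lemma derived_eq g h : derived g -> derived h ->
  b g 0%N = b h 0%N -> b g 1%N = b h 1%N -> g = h.
Proof.
move=> dg dh e0 e1.
have bV k : b (h^-1)%g k = - b h k.
  apply/eqP; rewrite -addr_eq0 -(coord_derivedM ab) ?mulVg //; last exact: derivedV.
  by have [_] := derived_expg 0 k dg; rewrite expg0 mul0r => ->.
have := coord_derived_inj ab (derivedM dg (derivedV dh)).
rewrite !(coord_derivedM ab _ dg (derivedV dh)) !bV e0 e1 !subrr.
by move=> /(_ erefl erefl) gh; apply: (mulIg h^-1%g); rewrite gh mulgV.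
Qed.

(** If H /\ G' did not span G' modulo p, some (c0, c1) != 0 would vanish on
    it. By noncube_radical all coordinates of the elements of H in G/G' would
    be divisible by p, and the index of H would be at least p^6. So G' is the
    product of H /\ G' and the p-th powers in G'; by iteration one can take
    the powers of exponent p^5, and these lie in H. *)
Lemma noncube_over_derived (H : set G) : normal_subgroup H -> has_index H (p ^ 5) ->
  (@derived G `<=` H)%classic.
Proof.
move=> nH iH; have [sH HJ] := nH; have [H1 HM HV] := sH.
have p_gt0 := prime_gt0 p_pr.
have dual (c0 c1 : F) : c0 != 0 \/ c1 != 0 -> exists h, [/\ H h, derived h &
    c0 * (b h 0%N)%:~R + c1 * (b h 1%N)%:~R != 0].
  move=> c_neq0; apply: contrapT => none.
  have aH := noncube_radical nH _ c_neq0.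
  pose f g : {ffun 'I_6 -> F} := [ffun k : 'I_6 => (a g k)%:~R].
  have fsurj i : exists x, f x = i.
    have [g ag] := coord_surj ab (fun k => (i (inord k) : nat)%:Z).
    exists g; apply/ffunP=> k; rewrite ffunE ag // inord_val.
    exact: natr_Zp.
  have cf := classified_fin (E := fun x y => f x = f y) fsurj (fun x y => iff_refl _).
  have cH : classified (fun x y => H (x^-1 * y)%g) (p ^ 5) by apply/has_index_classified.
  have Hf x y : H (x^-1 * y)%g -> f x = f y.
    move=> Hxy; apply/ffunP=> k; rewrite !ffunE -(mulVKg x y) (coordM ab) rmorphD /=.
    rewrite (aH _ _ _ Hxy) ?addr0 // => h Hh dh.
    by apply: contrapT => /eqP c; apply: none; exists h.
  by have := classified_leq Hf cH cf; rewrite card_ffun card_Fp // card_ord leq_exp2l ?prime_gt1.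
(* The elements l1 and l2 of H span G' modulo p. *)
have [l1 [Hl1 dl1]] := dual 1 0 (or_introl (oner_neq0 _)).
rewrite mul1r mul0r addr0; set s0 := _%:~R => s0_neq0.
pose s1 : F := (b l1 1%N)%:~R.
have [l2 [Hl2 dl2]] := dual (- s1) s0 (or_intror s0_neq0).
set t0 : F := (b l2 0%N)%:~R; set t1 : F := (b l2 1%N)%:~R => D_neq0.
have HX g k : H g -> H (g ^+ k)%g.
  by move=> Hg; elim: k => [|k IH]; rewrite ?expg0 ?expgS //; apply: HM.
have step u : derived u -> exists l v, [/\ H l, derived l, derived v & u = (l * v ^+ p)%g].
  move=> du; pose x : F := (b u 0%N)%:~R; pose y : F := (b u 1%N)%:~R.
  pose D := - s1 * t0 + s0 * t1.
  have [m mE] : exists m : F, m = (x * t1 - y * t0) / D by eexists.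
  have [n nE] : exists n : F, n = (s0 * y - s1 * x) / D by eexists.
  pose l := (l1 ^+ (m : nat) * l2 ^+ (n : nat))%g.
  have dl : derived l by apply: derivedM; apply: (derived_expg _ 0 _).1.
  have bl k : b l k = (m : nat)%:Z * b l1 k + (n : nat)%:Z * b l2 k.
    by rewrite (coord_derivedM ab) ?(derived_expg _ k _).2 //; apply: (derived_expg _ 0 _).1.
  have [/dvdzP[w0 w0E] /dvdzP[w1 w1E]] :
      (p%:Z %| b u 0%N - b l 0%N)%Z /\ (p%:Z %| b u 1%N - b l 1%N)%Z.
    rewrite !(dvdz_pcharf Fp) !bl !(rmorphB, rmorphD, rmorphM) /= -!pmulrn !natr_Zp.
    split; apply/eqP; rewrite -/x -/y -/s0 -/s1 -/t0 -/t1 mE nE /D; field; exact: D_neq0.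
  have [v [dv v0 v1]] := coord_derived_surj ab w0 w1.
  have [dvp _] := derived_expg p 0 dv.
  exists l, v; split=> //; first by apply: HM; apply: HX.
  apply: derived_eq => //; first exact: derivedM.
    by rewrite (coord_derivedM ab) // (derived_expg p 0 dv).2 v0; lia.
  by rewrite (coord_derivedM ab) // (derived_expg p 1 dv).2 v1; lia.
have iter k u : derived u -> exists l v, [/\ H l, derived l, derived v & u = (l * v ^+ (p ^ k))%g].
  elim: k u => [|k IH] u du.
    by exists 1%g, u; split; rewrite ?mul1g //; exact: derived1.
  have [l [v [Hl dl dv ->]]] := IH u du; have [l' [v' [Hl' dl' dv' ->]]] := step v dv.
  exists (l * l' ^+ (p ^ k))%g, v'; split=> //.
  - by apply: HM => //; apply: HX.
  - by apply: derivedM => //; apply: (derived_expg _ 0 _).1.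
  - rewrite -mulgA expnS expgnA; congr (_ * _)%g; apply: expgMn.
    exact: (derived_central hG).
move=> u /(iter 5%N)[l [v [Hl _ _ ->]]]; apply: HM => //.
exact: expg_index.
Qed.

End NonCube.

(** * A normal subgroup of index p^5 when 2 is a cube modulo p *)

Section IntegerPowers.
Variable G : groupType.
Local Open Scope group_scope.

Definition expgz (x : G) (n : int) : G :=
  match n with Posz k => x ^+ k | Negz k => (x ^+ k.+1)^-1 end.

Lemma expgzS x n : expgz x (n + 1)%R = expgz x n * x.
Proof.
case: n => [n|[|n]]; first by rewrite -PoszD addn1 /= expgSr.
  by rewrite /= expg1 mulVg.
rewrite (_ : (Negz n.+1 + 1)%R = Negz n) /=; last by lia.
by rewrite [x ^+ n.+2]expgS invgM mulgKV.
Qed.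

Lemma expgzD x m n : expgz x (m + n)%R = expgz x m * expgz x n.
Proof.
have expgzP k : expgz x (k - 1)%R = expgz x k * x^-1.
  by rewrite -{2}(subrK 1%R k) expgzS mulgK.
elim/int_ind: n => [|n IH|n IH]; first by rewrite addr0 /= mulg1.
  by rewrite intS (addrC 1%R) addrA !expgzS IH mulgA.
by rewrite intS opprD (addrC (- 1)%R) addrA !expgzP IH mulgA.
Qed.
End IntegerPowers.

Section Cube.
Variables (G : groupType) (a b : G -> nat -> int) (p : nat).
Hypotheses (hG : T2_group G) (ab : coordinates a b).
Hypotheses (p_pr : prime p) (p2 : cube_mod 2 p).
Local Notation F := 'F_p.

Let Fp : p \in [pchar F].
Proof. by rewrite pchar_Fp. Qed.

Lemma coord1 k : a 1%g k = 0.
Proof. by apply: (addrI (a 1%g k)); rewrite -(coordM ab) mulg1 addr0. Qed.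

Lemma coordV g k : a g^-1%g k = - a g k.
Proof. by apply/eqP; rewrite -addr_eq0 -(coordM ab) mulVg coord1. Qed.

Lemma coord_expgz g n k : a (expgz g n) k = a g k * n.
Proof.
have aS m : a (expgz g (m + 1)) k = a (expgz g m) k + a g k by rewrite expgzS (coordM ab).
elim/int_ind: n => [|n IH|n IH]; first by rewrite /= coord1 mulr0.
  by rewrite intS addrC aS IH mulrDr mulr1 addrC.
have := aS (- n.+1%:Z); rewrite (_ : - n.+1%:Z + 1 = - n%:Z); last by lia.
by rewrite IH => h; apply: (addIr (a g k)); rewrite -h intS; ring.
Qed.

Definition in_span123 (g : G) := [/\ a g 3 = 0, a g 4 = 0 & a g 5 = 0].
Definition in_span456 (g : G) := [/\ a g 0%N = 0, a g 1%N = 0 & a g 2 = 0].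

Lemma comm_eq1 g h : form0 (a g) (a h) = form0 (a h) (a g) ->
  form1 (a g) (a h) = form1 (a h) (a g) -> commute g h.
Proof.
move=> f0 f1; apply/commgP/eqP; apply: (coord_derived_inj ab); first exact: derivedR.
  by rewrite (coord_comm0 ab) f0 subrr.
by rewrite (coord_comm1 ab) f1 subrr.
Qed.

Lemma in_span123_comm g h : in_span123 g -> in_span123 h -> commute g h.
Proof.
case=> g3 g4 g5 [h3 h4 h5]; apply: comm_eq1; rewrite /form0 /form1 g3 g4 g5 h3 h4 h5; lia.
Qed.

Lemma in_span456_comm g h : in_span456 g -> in_span456 h -> commute g h.
Proof.
case=> g3 g4 g5 [h3 h4 h5]; apply: comm_eq1; rewrite /form0 /form1 g3 g4 g5 h3 h4 h5; lia.
Qed.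

Lemma mulg_swap3 (x x' y y' z z' : G) : commute x' y -> commute (x' * y')%g z ->
  (x * x' * (y * y') * (z * z') = x * y * z * (x' * y' * z'))%g.
Proof.
move=> xy xyz; rewrite -!mulgA; congr (_ * _)%g; rewrite (mulgA x' y) xy -!mulgA.
by congr (_ * _)%g; rewrite (mulgA x' y') (mulgA (x' * y')%g z) xyz -!mulgA.
Qed.

(** The commutator form vanishes on the span of x_1, x_2, x_3 and on the span
    of x_4, x_5, x_6, so that both lift to abelian subgroups of G. Up to G',
    each g is the product of its components X g and Z g in these subgroups. *)
Lemma exists_section : exists X Z : G -> G,
  [/\ forall g h, X (g * h)%g = (X g * X h)%g, forall g h, Z (g * h)%g = (Z g * Z h)%g,
      forall g, derived g -> X g = 1%g /\ Z g = 1%g &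
      forall g, [/\ in_span123 (X g), in_span456 (Z g) & forall k, (k < 6)%N -> a (X g * Z g)%g k = a g k]].
Proof.
have /choice[e eP] (i : nat) : exists g, forall k, (k < 6)%N -> a g k = (k == i)%:Z.
  by have [g ag] := coord_surj ab (fun k => (k == i)%:Z); exists g.
pose w i g := expgz (e i) (a g i).
have wM i g h : w i (g * h)%g = (w i g * w i h)%g by rewrite /w (coordM ab) expgzD.
have wa i g k : (k < 6)%N -> a (w i g) k = (k == i)%:Z * a g i.
  by move=> k6; rewrite coord_expgz eP.
have wP i g : (i < 3)%N -> in_span123 (w i g) by case: i => [|[|[|]]] // _; split; rewrite wa ?mul0r.
have wQ i g : (i < 3)%N -> in_span456 (w i.+3 g) by case: i => [|[|[|]]] // _; split; rewrite wa ?mul0r.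
have PM g h : in_span123 g -> in_span123 h -> in_span123 (g * h)%g.
  by move=> [? ? ?] [? ? ?]; split; rewrite (coordM ab); lia.
have QM g h : in_span456 g -> in_span456 h -> in_span456 (g * h)%g.
  by move=> [? ? ?] [? ? ?]; split; rewrite (coordM ab); lia.
exists (fun g => w 0%N g * w 1%N g * w 2 g)%g, (fun g => w 3 g * w 4 g * w 5 g)%g.
split=> [g h|g h|g /(coord_derived ab) dg|g].
- rewrite !wM; apply: mulg_swap3; first by apply: in_span123_comm; apply: wP.
  by apply: in_span123_comm; [apply: PM|]; apply: wP.
- rewrite !wM; apply: mulg_swap3.
    by apply: in_span456_comm; apply: wQ.
  by apply: in_span456_comm; [apply: QM|]; apply: wQ.
- by rewrite /w !dg //= !mulg1.
- split; [by apply: (PM _ _ (PM _ _ _ _)); apply: wP|by apply: (QM _ _ (QM _ _ _ _)); apply: wQ|].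
  move=> k k6; rewrite !(coordM ab) !wa //.
  by case: k k6 => [|[|[|[|[|[|//]]]]]] _ /=; rewrite !mul0r !mul1r ?addr0 ?add0r.
Qed.

(** For t^3 = - 2 the alternating form obtained by pairing the commutator form
    with (t, 1) is degenerate: it is the antisymmetrization of u1 v1 + u2 v2
    for linear forms u1 and u2 in the first three coordinates and v1 and v2 in
    the last three. Hence u1, u2, v1, v2 together with a function s that
    extends psi, the pairing of G' with (t, 1), define a surjection of G onto
    the Heisenberg group of order p^5 over F_p. Its kernel is H. *)
Lemma cube_not_over_derived : exists H : set G,
  [/\ normal_subgroup H, has_index H (p ^ 5) & ~ (@derived G `<=` H)%classic].
Proof.
have [t t3] : exists t : F, t ^+ 3 = - 2.
  have [k kE] := p2; exists (- k%:R); rewrite exprNn -natrX.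
  by rewrite -(natr_mod_pchar _ Fp) kE (natr_mod_pchar _ Fp) -signr_odd expr1 mulN1r.
have two : 1%:~R + 1%:~R = - t ^+ 3 :> F by rewrite t3 opprK.
have [X [Z [XM ZM XZ1 XZ]]] := exists_section.
pose A g k : F := (a g k)%:~R.
have AM g h k : A (g * h)%g k = A g k + A h k by rewrite /A (coordM ab) rmorphD.
pose psi g : F := t * (b g 0%N)%:~R + (b g 1%N)%:~R.
have psiM g h : derived g -> derived h -> psi (g * h)%g = psi g + psi h.
  by move=> dg dh; rewrite /psi !(coord_derivedM ab) // !rmorphD /=; ring.
pose u1 g : F := A g 0%N - t ^+ 2 * A g 2; pose u2 g : F := A g 1%N + t * A g 2.
pose v1 g : F := t * A g 3 + A g 4; pose v2 g : F := t * A g 4 + A g 5.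
have u1M g h : u1 (g * h)%g = u1 g + u1 h by rewrite /u1 !AM; ring.
have u2M g h : u2 (g * h)%g = u2 g + u2 h by rewrite /u2 !AM; ring.
have v1M g h : v1 (g * h)%g = v1 g + v1 h by rewrite /v1 !AM; ring.
have v2M g h : v2 (g * h)%g = v2 g + v2 h by rewrite /v2 !AM; ring.
(* Substituting 2 = - t^3 makes the paired form split. *)
have psiR g h : psi [~ g, h]%g = u1 g * v1 h + u2 g * v2 h - (u1 h * v1 g + u2 h * v2 g).
  rewrite /psi (coord_comm0 ab) (coord_comm1 ab) /form0 /form1.
  rewrite !(rmorphN, rmorphD, rmorphM) /= -!/(A _ _) /u1 /u2 /v1 /v2.
  by rewrite two; ring.
(* The component of g in G', with respect to the section. *)
have [r rE] : exists r : G -> G, forall g, r g = ((Z g)^-1 * ((X g)^-1 * g))%g by eexists.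
have rK g : g = (X g * Z g * r g)%g by rewrite rE -mulgA !mulVKg.
have rD g : derived (r g).
  apply/(coord_derived ab) => k k6; rewrite rE mulgA -invgM (coordM ab) coordV.
  by have [_ _ ->] := XZ g; rewrite // addNr.
have Ader g k : derived g -> (k < 6)%N -> A g k = 0.
  by move=> /(coord_derived ab) dg k6; rewrite /A dg.
have uvder g : derived g -> [/\ u1 g = 0, u2 g = 0, v1 g = 0 & v2 g = 0].
  by move=> dg; rewrite /u1 /u2 /v1 /v2 !Ader // !mulr0 subrr addr0.
have cD (c g : G) : derived c -> (c * g = g * c)%g by exact: (derived_central hG).
have rM g h : r (g * h)%g = ([~ Z g, X h] * (r g * r h))%g.
  have := commgC (Z g) (X h); move: [~ _, _]%g (derivedR (Z g) (X h)) => c dc zx.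
  apply: (mulgI (X (g * h) * Z (g * h))%g); rewrite -rK XM ZM [in LHS](rK g) [in LHS](rK h).
  rewrite -!mulgA; congr (_ * _)%g; rewrite (cD (r g) (_ * (_ * r h))%g) // -!mulgA (mulgA (Z g)) zx.
  by rewrite (cD (r g) (r h)) // -!mulgA (cD c (Z h * _)%g) // (cD c) // -!mulgA.
pose s g := psi (r g).
have AXZ g k : (k < 6)%N -> A g k = A (X g) k + A (Z g) k.
  by move=> k6; rewrite -AM; have [_ _ E] := XZ g; rewrite /A E.
have uX g : u1 (X g) = u1 g /\ u2 (X g) = u2 g.
  have [_ [z0 z1 z2] _] := XZ g.
  by rewrite /u1 /u2 !(AXZ g) // /A z0 z1 z2 !addr0.
have vZ g : v1 (Z g) = v1 g /\ v2 (Z g) = v2 g.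
  have [[x3 x4 x5] _ _] := XZ g.
  by rewrite /v1 /v2 !(AXZ g) // /A x3 x4 x5 !add0r.
have uZ g : u1 (Z g) = 0 /\ u2 (Z g) = 0.
  by have [_ [z0 z1 z2] _] := XZ g; rewrite /u1 /u2 /A z0 z1 z2 !mulr0 subrr addr0.
(* The group law of the Heisenberg group. *)
have sM g h : s (g * h)%g = s g + s h - (v1 g * u1 h + v2 g * u2 h).
  have dc := derivedR (Z g) (X h); have dr := derivedM (rD g) (rD h).
  rewrite /s rM (psiM _ _ dc dr) (psiM _ _ (rD g) (rD h)).
  rewrite psiR (uX h).1 (uX h).2 (vZ g).1 (vZ g).2 (uZ g).1 (uZ g).2; ring.
have sD g : derived g -> s g = psi g.
  by move=> dg; rewrite /s rE; have [-> ->] := XZ1 g dg; rewrite invg1 !mul1g.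
have f1 : [/\ u1 1%g = 0, u2 1%g = 0, v1 1%g = 0, v2 1%g = 0 & s 1%g = 0].
  have [? ? ? ?] := uvder _ (@derived1 G); split=> //.
  have d1 := @derived1 G; rewrite (sD _ d1).
  by apply: (addrI (psi 1%g)); rewrite -psiM // mulg1 addr0.
pose Th g := (u1 g, u2 g, v1 g, v2 g, s g).
pose H : set G := [set g | [/\ u1 g = 0, u2 g = 0, v1 g = 0, v2 g = 0 & s g = 0]]%classic.
have ThE x y : Th x = Th y <-> H (x^-1 * y)%g.
  move: (x^-1 * y)%g (mulVKg x y) => h <-; rewrite /H /mkset /Th u1M u2M v1M v2M sM.
  have e0 (w z : F) : w = w + z -> z = 0 by move=> wz; apply: (addrI w); rewrite -wz addr0.
  split=> [/eqP|[-> -> -> -> ->]]; last by rewrite !mulr0 !addr0 subr0.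
  rewrite !xpair_eqE -!andbA => /and5P[/eqP/e0-> /eqP/e0-> /eqP/e0-> /eqP/e0->].
  by rewrite !mulr0 addr0 subr0 => /eqP/e0.
have HTh x : H x -> Th x = 0 by rewrite /H /mkset /Th => -[-> -> -> -> ->].
have H1 : H 1%g by [].
have sH : subgroup H.
  split=> // [x y [x1 x2 x3 x4 x5] [y1 y2 y3 y4 y5]|x Hx].
    rewrite /H /mkset u1M u2M v1M v2M sM x1 x2 x3 x4 x5 y1 y2 y3 y4 y5.
    by split; ring.
  by rewrite -(mulg1 x^-1%g); apply/ThE; rewrite !HTh.
exists H; split.
- split=> // x y Hx; have [_ HM _] := sH; rewrite (_ : x ^ y = x * [~ x, y])%g; last first.
    by rewrite commgEl mulVKg.
  apply: HM => //; have dc := derivedR x y; have [? ? ? ?] := uvder _ dc.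
  have [x1 x2 x3 x4 _] := Hx; rewrite /H /mkset; split=> //.
  by rewrite sD // psiR x1 x2 x3 x4; ring.
- apply/has_index_classified => //; rewrite -(_ : #|{: F * F * F * F * F}| = p ^ 5)%N.
    2: by rewrite !card_prod card_Fp // !expnS expn0 muln1 !mulnA.
  suff Thsurj (i0 i1 i2 i3 i4 : F) : exists x, Th x = (i0, i1, i2, i3, i4).
    by apply: (classified_fin (f := Th)) => // -[[[[i0 i1] i2] i3] i4]; apply: Thsurj.
  have [i3' i3E] : exists i3' : F, i3' = i3 - t * i2 by eexists.
  pose c := nth 0%N [:: i0 : nat; i1 : nat; 0%N; 0%N; i2 : nat; i3' : nat].
  have [g ag] := coord_surj ab (fun k => (c k)%:Z).
  have [i4' i4E] : exists i4' : F, i4' = i4 - s g by eexists.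
  have [y [dy y0 y1]] := coord_derived_surj ab 0 (i4' : nat)%:Z.
  have [gu1 gu2 gv1 gv2] : [/\ u1 g = i0, u2 g = i1, v1 g = i2 & v2 g = i3].
    rewrite /u1 /u2 /v1 /v2 /A !ag // -[c 0%N]/(i0 : nat) -[c 1%N]/(i1 : nat) -[c 4]/(i2 : nat) -[c 5]/(i3' : nat).
    rewrite -[c 2]/0%N -[c 3]/0%N -!pmulrn !natr_Zp i3E; split; ring.
  have [yu1 yu2 yv1 yv2] := uvder _ dy.
  exists (g * y)%g; rewrite /Th u1M u2M v1M v2M sM yu1 yu2 yv1 yv2 !addr0 gu1 gu2 gv1 gv2.
  rewrite (sD y) // /psi y0 y1 -pmulrn natr_Zp i4E; congr (_, _); ring.
- have [y [dy y0 y1]] := coord_derived_surj ab 0 1.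
  move=> /(_ y dy)[_ _ _ _]; rewrite sD // /psi y0 y1 mulr0 add0r.
  by apply/eqP; rewrite oner_eq0.
Qed.
End Cube.

(** * The number of normal subgroups of index p^5 *)

(** H is the stabilizer of the coset H for the action on the cosets, and this
    action is determined by the permutations attached to finitely many
    generators. *)
Lemma finite_normal_subgroups (G : groupType) (m : nat) : finitely_generated G ->
  finite_set [set H : set G | normal_subgroup H /\ has_index H m]%classic.
Proof.
case=> A /finite_seqP[s ->] genA.
pose K (d : {ffun 'I_(size s) -> {perm 'I_m}} * 'I_m) : set G := [set g | exists pi : G -> {perm 'I_m},
  [/\ forall x y, pi (x * y)%g = (pi y * pi x)%g, forall i, pi (tnth (in_tuple s) i) = d.1 i
    & pi g d.2 = d.2]]%classic.
apply: (@sub_finite_set _ _ (K @` classical_sets.setT)%classic); last first.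
  by apply: finite_image; exact: finite_finset.
move=> H [[sH _] iH]; have [f [pi [_ fE piE piM]]] := coset_action sH iH.
exists ([ffun i => pi (tnth (in_tuple s) i)], f 1%g) => //.
have stab g : pi g (f 1%g) = f 1%g <-> H g.
  by rewrite piE mulg1; split=> [/esym/fE|Hg]; [|apply/esym/fE]; rewrite invg1 mul1g.
apply/seteqP; split=> g; last by move=> Hg; exists pi; split=> // [i|]; [rewrite ffunE|apply/stab].
case=> pi' [pi'M pi's pi'g]; apply/stab.
suff -> : pi g = pi' g by [].
pose S := [set x | pi x = pi' x]%classic.
have : [set: G]%classic g by []; rewrite -genA => /(_ S); apply.
have h1 (rho : G -> {perm 'I_m}) : (forall x y, rho (x * y)%g = (rho y * rho x)%g) -> rho 1%g = 1%g.
  by move=> rhoM; apply: (mulgI (rho 1%g)); rewrite -rhoM !mulg1.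
split; first split=> [|x y Sx Sy|x Sx]; rewrite /S /=.
- by rewrite !h1.
- by rewrite piM pi'M Sx Sy.
- by apply: (mulgI (pi x)); rewrite -piM mulVg (Sx : pi x = pi' x) -pi'M mulVg !h1.
- move=> x /= /(nthP x)[i i_lt <-]; have := pi's (Ordinal i_lt).
  by rewrite ffunE !(tnth_nth x) /= => ->.
Qed.

Section Count.
Variables (G : groupType) (hG : T2_group G) (a b : G -> nat -> int).
Hypothesis ab : coordinates a b.
Variables (p c : nat).
Hypotheses (p_pr : prime p) (hc : (@subgroups_of_index (Zpower 6) (p ^ 5) #= `I_c)%card).

Lemma nb_normal_noncube : ~ cube_mod 2 p -> nb_normal_subgroups G (p ^ 5) = c.
Proof.
move=> p2; have := card_over_derived ab hc.
rewrite /nb_normal_subgroups (_ : [set H | _ /\ _]%classic =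
  [set H : set G | normal_subgroup H /\ has_index H (p ^ 5)]%classic).
  exact: card_fset_set.
apply/seteqP; split=> H /= [nH iH]; first by [].
by split=> //; apply: (noncube_over_derived hG ab p_pr p2 nH iH).
Qed.

Lemma nb_normal_cube : cube_mod 2 p -> (c < nb_normal_subgroups G (p ^ 5))%N.
Proof.
move=> p2; have := card_over_derived ab hc; set T := [set H | _ /\ _]%classic => cT.
rewrite /nb_normal_subgroups; set S := [set H | _ /\ _]%classic.
have fS : finite_set S by case: hG => fg _ _; apply: finite_normal_subgroups.
have TS : (T `<=` S)%classic by move=> H [].
have fT : finite_set T := sub_finite_set TS fS.
rewrite -(card_fset_set cT); apply: fproper_ltn_card; rewrite fproperE; apply/andP; split.
  by apply/fsubsetP=> H; rewrite !in_fset_set // !inE; apply: TS.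
have [H [nH iH dH]] := cube_not_over_derived hG ab p_pr p2.
apply/negP=> /fsubsetP/(_ H); rewrite !in_fset_set // !inE => TH.
by case: TH.
Qed.
End Count.

Lemma poly_eq0_unbounded (q : {poly rat}) :
  (forall M, exists p, (M < p)%N /\ q.[p%:R] = 0) -> q = 0.
Proof.
have [n] := ubnP (size q); elim: n q => // n IH q /ltnSE qn h.
have [p0 [_ /eqP/factor_theorem[r qE]]] := h 0%N.
have [rE|r0] := eqVneq r 0; first by rewrite qE rE mul0r.
rewrite qE size_Mmonic ?monicXsubC // size_XsubC addn2 in qn.
case/eqP: r0; apply: IH => // M; have [p [Mp qp]] := h (maxn M p0).
move: Mp; rewrite gtn_max => /andP[Mp p0p]; exists p; split=> //.
move/eqP: qp; rewrite qE hornerM hornerXsubC mulf_eq0 subr_eq0 eqr_nat (gtn_eqF p0p) orbF.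
by move/eqP.
Qed.

Theorem theorem4p3 (R : realType) (G : groupType) (hG : T2_group G) :
  has_presentation_np8' hG -> ~ normal_zeta_RFORC R G.
Proof.
move=> /presentation_coordinates[a [b ab]] /(RFORC_coef 5)[N [q [A [N_gt0 q0 qA]]]].
have [S SP] := count_Zpower 6 5.
have qS : q * S = A.
  apply/eqP; rewrite -subr_eq0; apply/eqP/poly_eq0_unbounded => M.
  have [p [p_pr Mp Np p2]] := exists_prime_not_cube_mod M N_gt0.
  exists p; split=> //; have [c hc Sc] := SP p p_pr.
  rewrite hornerD hornerN hornerM -(qA p p_pr Np) (nb_normal_noncube hG ab p_pr hc p2) Sc.
  by rewrite subrr.
have [M qM] : exists M, forall p, (M < p)%N -> q.[p%:R] != 0.
  apply: contrapT => noM; case/eqP: q0; apply: poly_eq0_unbounded => M.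
  apply: contrapT => h; apply: noM; exists M => p Mp; apply/negP=> /eqP qp.
  by apply: h; exists p.
have [p [p_pr Mp Np p2]] := exists_prime_cube_mod M N_gt0.
have [c hc Sc] := SP p p_pr.
have := qA p p_pr Np; rewrite -qS hornerM => /(mulfI (qM p Mp))/eqP.
by rewrite Sc eqr_nat gtn_eqF // (nb_normal_cube hG ab p_pr hc).
Qed.
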